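(* There is a randomized online algorithm for the $k$-server problem which, on every metric space with $n$ points, is $O(\log^2 k \,\log^3 n\, \log\log n)$-competitive (against an oblivious adversary).
   Context: The $k$-server problem: a finite metric space $(M,d)$ with $n$ points is given, and $k$ servers occupy given initial points. Requests $\rho(1),\rho(2),\ldots\in M$ arrive online; when $\rho(t)$ arrives, the algorithm must move servers so that some server is located at $\rho(t)$ before the next request is revealed. The cost is the total distance travelled by all servers. A randomized online algorithm is $c$-competitive (against an oblivious adversary) if there is a constant $b$, independent of the request sequence, such that for every request sequence the expected cost of the algorithm is at most $c\cdot \mathrm{OPT}+b$, where $\mathrm{OPT}$ is the minimum cost of serving the sequence offline from the same initial configuration. *)

(* Defs.v *)
From HB Require Import structures.
From mathcomp Require Import all_boot all_order all_algebra.
From mathcomp Require Import all_classical all_reals all_analysis.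

Set Implicit Arguments.
Unset Strict Implicit.
Unset Printing Implicit Defensive.

Import Order.TTheory GRing.Theory Num.Theory.
Local Open Scope classical_set_scope.
Local Open Scope ring_scope.

(* Positions of k labelled servers; several servers may share a point. *)
Definition config (k : nat) (M : Type) : Type := 'I_k -> M.

Section Kserver.
Context {R : realType} {k : nat} {M : metricType R}.
Implicit Types (x y : config k M) (rho : seq M) (S : seq (config k M)).

Definition move_cost x y : R := \sum_(i < k) mdist (x i) (y i).

Fixpoint schedule_cost x S : R :=
  if S is y :: S' then move_cost x y + schedule_cost y S' else 0.

Definition covers (r : M) x : bool := [exists i, x i == r].

(* The t-th configuration of S is the one reached on the t-th request; all2
   also forces S and rho to have the same length. *)
Definition serves rho S : bool := all2 covers rho S.

(* For k > 0 and M finite this infimum is over a nonempty set with finitely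
   many values, hence a minimum. *)
Definition opt x0 rho : R := inf [set schedule_cost x0 S | S in [set S | serves rho S]].

End Kserver.

(* A probability distribution over deterministic online policies: [policy w s]
   is the configuration reached, for random outcome w, once the requests s
   (all those revealed so far) have been handled. Being a function of the
   requests revealed so far, it cannot depend on later ones; since w is drawn
   independently of the requests, the adversary is oblivious. *)
Record rand_policy (R : realType) (k : nat) (M : metricType R) := RandPolicy {
  rp_display : measure_display;
  rp_space : measurableType rp_display;
  rp_prob : probability rp_space R;
  policy : rp_space -> seq M -> config k M }.

Section Algorithm.
Context {R : realType} {k : nat} {M : metricType R}.
Implicit Types (A : rand_policy k M) (x : config k M) (rho : seq M).

Definition run A (w : rp_space A) rho : seq (config k M) :=
  [seq policy w (take t rho) | t <- iota 1 (size rho)].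

(* The first clause says that [policy ^~ rho] is a random variable, the set of
   configurations being finite. *)
Definition kserver_algorithm A : Prop :=
  (forall rho (x : config k M), measurable [set w : rp_space A | policy w rho = x])
  /\ (forall (w : rp_space A) rho, serves rho (run w rho)).

Definition expected_cost A x0 rho : \bar R :=
  ('E_(rp_prob A)[fun w => schedule_cost x0 (run w rho)])%E.

Definition competitive A x0 (c : R) : Prop :=
  exists b : R, forall rho, (expected_cost A x0 rho <= (c * opt x0 rho + b)%:E)%E.

End Algorithm.

(* Main.v *)
Require Import Defs.
From mathcomp Require Import all_boot all_order all_algebra.
From mathcomp Require Import fingroup perm.
From mathcomp Require Import all_classical all_reals all_analysis.
From mathcomp Require Import measurable_realfun.
From mathcomp Require Import ring lra zify.

(** The n-point metric is replaced by a random hierarchically separated tree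
    (Fakcharoenphol, Rao and Talwar), which costs a factor O(log n). Following
    heavy subclusters, the points themselves become the nodes of a tree of depth
    O(log n) that still carries the tree metric up to constants. On it a
    fractional solution, encoded by the missing server mass in every subtree, is
    projected at each request onto the polytope of solutions serving the request,
    in the Bregman divergence of a shifted entropy (Bubeck, Cohen, Lee, Lee and
    Madry). The divergence to the offline solution, corrected by a linear term
    weighted by the levels, is a potential that pays for the movement; its
    Lipschitz constant is O(log k) times the depth. Finally the fractional
    solution is rounded online, at a constant factor, by a law on configurations
    in which every cluster always holds its fractional mass rounded up or down:
    the new law is a minimiser of a linear program, whose optimality excludes
    inconsistent roundings. The resulting random process is realised on the unit
    interval by splitting sets of prescribed measure. The ratio obtained is
    O(log k * log^2 n). *)

Set Implicit Arguments.
Unset Strict Implicit.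
Unset Printing Implicit Defensive.
Import Order.TTheory GRing.Theory Num.Theory.
Import numFieldNormedType.Exports.
Local Open Scope classical_set_scope.
Local Open Scope ring_scope.

(** The demand at the request is met only up to [margin] = 1/(2k+1). This slack makes a discrete
    projection analysable: half of the offline solution, which needs no slack, mixed with half of a
    copy of the projected point enlarged on the deeper coordinates, which needs twice the slack, is
    again feasible. Optimality tested in this direction, once per level, bounds the upward movement
    there. The entropy is shifted by the same amount, so its divergence to a 0-1 point varies by
    O(log k) per flipped coordinate: this is the origin of the log k. The missing mass is regained
    by rescaling and a superadditive rounding, at a constant factor. Two trees coexist. The depth of
    the hierarchy depends on the ratio of the largest to the smallest distance, so the potential,
    which pays for levels, lives on the heavy tree; the rounding loses nothing per level and works
    on the hierarchy itself. A linear program is needed there because floors and ceilings chosen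
    separately at the clusters need not add up, and then no configuration has them as loads. *)

Lemma ln_le_subr1 (R : realType) (x : R) : 0 < x -> ln x <= x - 1.
Proof.
move=> x0; have := @le_ln1Dx R (x - 1).
rewrite addrCA subrr addr0; apply; lra.
Qed.

Lemma sum_pow2 (R : realType) n : \sum_(i < n) 2 ^+ i = 2 ^+ n - 1 :> R.
Proof. by elim: n => [|n IH]; rewrite ?big_ord0 ?subrr // big_ord_recr /= IH exprS; ring. Qed.

(** * Minimisation over compact polytopes *)

Section FiniteDimensionalMin.
Context {R : realType} {T : finType}.
Local Notation PT := (prod_topology (fun _ : T => R)).
Implicit Types F G : (T -> R) -> R.

Definition pt_continuous F := forall x : PT, {for x, continuous (F : PT -> R)}.

Lemma pt_continuous_cst (c : R) : pt_continuous (fun=> c).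
Proof. by move=> x; exact: cst_continuous. Qed.

Lemma pt_continuous_coord t : pt_continuous (fun x => x t).
Proof. by move=> x; exact: (@proj_continuous T (fun _ => R) t x). Qed.

Lemma pt_continuous_sum_at (I : Type) (r : seq I) (P : pred I) (F : I -> (T -> R) -> R) (x : PT) :
  (forall i, P i -> {for x, continuous (F i : PT -> R)}) ->
  {for x, continuous ((fun y => \sum_(i <- r | P i) F i y) : PT -> R)}.
Proof.
move=> H; elim: r => [|i r IH].
  rewrite (_ : (fun _ => _) = fun=> 0); first exact: cst_continuous.
  by apply/funext => y; rewrite big_nil.
rewrite (_ : (fun _ => _) = fun y => (if P i then F i y else 0) + \sum_(i <- r | P i) F i y).
  apply: (@continuousD _ _ PT) => //.
  by case: (boolP (P i)) => Pi; [exact: H|exact: cst_continuous].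
by apply/funext => y; rewrite big_cons; case: ifP; rewrite ?add0r.
Qed.

Lemma pt_continuous_sum (I : Type) (r : seq I) (P : pred I) (F : I -> (T -> R) -> R) :
  (forall i, P i -> pt_continuous (F i)) ->
  pt_continuous (fun y => \sum_(i <- r | P i) F i y).
Proof. by move=> H x; apply: pt_continuous_sum_at => i Pi; exact: H. Qed.

Lemma pt_continuousD F G : pt_continuous F -> pt_continuous G ->
  pt_continuous (fun y => F y + G y).
Proof. by move=> cF cG x; apply: (@continuousD _ _ PT); [exact: cF|exact: cG]. Qed.

Lemma pt_continuousN F : pt_continuous F -> pt_continuous (fun y => - F y).
Proof. by move=> cF x; apply: (@continuousN _ _ PT); exact: cF. Qed.

Lemma pt_continuousM F G : pt_continuous F -> pt_continuous G ->
  pt_continuous (fun y => F y * G y).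
Proof. by move=> cF cG x; apply: (@continuousM _ PT); [exact: cF|exact: cG]. Qed.

Lemma pt_closed_ge0 (I : Type) (F : I -> (T -> R) -> R) : (forall i, pt_continuous (F i)) ->
  closed ([set x | forall i, 0 <= F i x] : set PT).
Proof.
move=> cF.
rewrite (_ : mkset _ = \bigcap_(i in setT) [set x : PT | 0 <= F i x]); last first.
  by apply/seteqP; split => x /= H i; [move=> _; exact: H|exact: H].
apply: closed_bigI => i _.
have -> : [set x : PT | 0 <= F i x] = (F i : PT -> R) @^-1` [set y | 0 <= y] by [].
by apply: closed_comp => [x _|]; [exact: cF|exact: closed_ge].
Qed.

(** Serves both for the Bregman projection and for the optimal rounding law; equations enter [F] as
    pairs of opposite inequalities. *)
Lemma polytope_min (I : Type) (F : I -> (T -> R) -> R) (phi : T -> R -> R) :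
  (forall i, pt_continuous (F i)) ->
  (exists x, forall i, 0 <= F i x) ->
  (forall x, (forall i, 0 <= F i x) -> forall t, 0 <= x t <= 1) ->
  (forall t s, 0 <= s <= 1 -> {for s, continuous (phi t)}) ->
  exists2 c, (forall i, 0 <= F i c) &
    forall x, (forall i, 0 <= F i x) -> \sum_t phi t (c t) <= \sum_t phi t (x t).
Proof.
move=> cF nF bF cphi.
have cK := pt_closed_ge0 cF.
have cpt : compact ([set x | forall i, 0 <= F i x] : set PT).
  apply: (@subclosed_compact PT _ [set x : PT | forall t, `[0, 1]%classic (x t)] cK).
    by apply: (@tychonoff T (fun=> R) (fun=> `[0, 1]%classic)) => t; exact: segment_compact.
  by move=> x Kx t /=; rewrite in_itv /=; exact: bF.
have [|c cK' H] := @compact_EVT_min PT R (fun x => \sum_t phi t (x t)) _ nF cpt.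
  apply: continuous_in_subspaceT => x; rewrite inE /= => Kx.
  apply: pt_continuous_sum_at => t _.
  apply: (@continuous_comp PT R R (fun y => y t) (phi t)); first exact: pt_continuous_coord.
  exact/cphi/bF.
exists c; first by rewrite inE in cK'.
by move=> x Kx; apply: H; rewrite inE.
Qed.

End FiniteDimensionalMin.

(** * Bregman divergence of a shifted entropy *)

Section Bregman.
Context {R : realType} (d : R).
Hypothesis d_gt0 : 0 < d.
Implicit Types a b s t : R.

(** Difference of the derivatives, at [b] and at [a], of the map sending t to (t + d) ln (t + d);
    [breg a b] is the Bregman divergence of [b] from [a] for this map. *)
Definition lgap a b : R := ln ((b + d) / (a + d)).
Definition breg a b : R := (b + d) * lgap a b - (b - a).

Lemma lgap_add a s t : 0 <= a -> 0 <= s -> 0 <= t -> lgap a t = lgap a s + lgap s t.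
Proof.
have d0 := d_gt0; move=> a0 s0 t0; rewrite /lgap -lnM ?posrE ?divr_gt0 //; try lra.
by congr ln; field; apply/andP; split; apply: lt0r_neq0; lra.
Qed.

Lemma lgapxx a : 0 <= a -> lgap a a = 0.
Proof. have d0 := d_gt0; by move=> a0; rewrite /lgap divff ?ln1 //; apply: lt0r_neq0; lra. Qed.

(** Three-point identity: it turns the first-order condition at [s] into a comparison of
    divergences. *)
Lemma breg3 a s t : 0 <= a -> 0 <= s -> 0 <= t ->
  breg a t = breg a s + breg s t + (t - s) * lgap a s.
Proof.
by move=> a0 s0 t0; rewrite /breg (@lgap_add a s t) //; ring.
Qed.

Lemma breg_ge0 a b : 0 <= a -> 0 <= b -> 0 <= breg a b.
Proof.
have d0 := d_gt0; move=> a0 b0; rewrite /breg.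
have ba : lgap a b = - lgap b a.
  by apply/eqP; rewrite -subr_eq0 opprK -lgap_add // lgapxx.
have : (b + d) * lgap b a <= (b + d) * ((a + d) / (b + d) - 1).
  by apply: ler_wpM2l; [lra|apply: ln_le_subr1; apply: divr_gt0; lra].
have -> : (b + d) * ((a + d) / (b + d) - 1) = a - b.
  by field; apply: lt0r_neq0; lra.
by rewrite ba; lra.
Qed.

Lemma breg_le_sqr s t : 0 <= s -> 0 <= t -> breg s t <= (t - s) ^+ 2 / d.
Proof.
have d0 := d_gt0; move=> s0 t0.
have H : breg s t <= (t - s) ^+ 2 / (s + d).
  have : (t + d) * lgap s t <= (t + d) * ((t + d) / (s + d) - 1).
    by apply: ler_wpM2l; [lra|apply: ln_le_subr1; apply: divr_gt0; lra].
  have -> : (t + d) * ((t + d) / (s + d) - 1) = (t - s) ^+ 2 / (s + d) + (t - s).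
    by field; apply: lt0r_neq0; lra.
  by rewrite /breg; lra.
apply: le_trans H _; apply: ler_wpM2l; first exact: sqr_ge0.
by rewrite lef_pV2 ?posrE; lra.
Qed.

(** Beyond 1 the divergence from a point of [0, 1] only grows, so capping a comparison point is
    free. *)
Lemma breg_min1 a t : 0 <= a <= 1 -> 0 <= t -> breg a (Num.min t 1) <= breg a t.
Proof.
have d0 := d_gt0; move=> /andP[a0 a1] t0; case: (lerP t 1) => // t1.
have h1 := breg_ge0 ler01 t0.
have h2 : 0 <= (t - 1) * lgap a 1.
  by apply: mulr_ge0; [lra|apply: ln_ge0; rewrite ler_pdivlMr; lra].
by rewrite (@breg3 a 1 t) //; lra.
Qed.

Lemma breg_continuous a s : 0 <= a -> 0 <= s -> {for s, continuous (breg a)}.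
Proof.
have d0 := d_gt0; move=> a0 s0; rewrite /breg /lgap.
have cD : {for s, continuous (fun b : R => b + d)}.
  by apply: continuousD; [exact: cvg_id|exact: cst_continuous].
apply: continuousB; last by apply: continuousB; [exact: cvg_id|exact: cst_continuous].
apply: continuousM => //.
apply: (@continuous_comp _ _ _ (fun b : R => (b + d) / (a + d)) (@ln R)).
  by apply: continuousM => //; exact: cst_continuous.
by apply: continuous_ln; rewrite divr_gt0; lra.
Qed.

(** The distance is twice the positive part of [b - a], minus [b - a], and nonnegativity of [breg]
    bounds an increase by the gradient gap. Only increases remain to be controlled; the linear
    remainder telescopes over time. *)
Lemma dist_le_lgap a b : 0 <= a -> 0 <= b ->
  `|b - a| <= 2 * ((b + d) * Num.max (lgap a b) 0) - (b - a).
Proof.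
have d0 := d_gt0; move=> a0 b0; have := breg_ge0 a0 b0; rewrite /breg => H.
have h1 : (b + d) * lgap a b <= (b + d) * Num.max (lgap a b) 0.
  by apply: ler_wpM2l; [lra|rewrite le_max lexx].
have h2 : 0 <= (b + d) * Num.max (lgap a b) 0.
  by apply: mulr_ge0; [lra|rewrite le_max lexx orbT].
by case: (ger0P (b - a)) => _; lra.
Qed.

End Bregman.

(** * The polytope of fractional server distributions on a rooted tree *)

Section AntiServerPolytope.
Context {R : realType} {V : finType}.
Variables (k : nat) (r : V) (par : V -> V).
Local Notation X := (V * 'I_k -> R).
Implicit Types (x y : X) (u v : V) (S : {set V * 'I_k}).

Definition child u c := (c != r) && (par c == u).

(* [x (u, j)] is the probability that the subtree of [u] holds at most [j]
   servers; the coordinates with [j >= k] are implicitly equal to 1. *)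
Definition ext x u (j : nat) : R := if insub j is Some i then x (u, i) else 1.

Definition prefix_sum x u m : R := \sum_(0 <= j < m) ext x u j.

(* On 0-1 points with server counts [N] the last condition reads
   [\sum_(children c of u) N c + (u == rho) <= N u]; [tau] relaxes the demand at
   the request [rho]. *)
Definition antiserver (rho : V) (tau : R) x : Prop :=
  [/\ forall p, 0 <= x p, forall j, x (r, j) = 0 &
    forall u S (e : bool), (forall p, p \in S -> child u p.1) -> (e -> u = rho) ->
    prefix_sum x u (#|S| + e) <= \sum_(p in S) x p + e%:R * tau].

Definition trunc1 x : X := fun p => Num.min (x p) 1.

Lemma ext_trunc1 x u j : ext (trunc1 x) u j = Num.min (ext x u j) 1.
Proof. by rewrite /ext; case: insub => //; rewrite minxx. Qed.

Lemma prefix_sum_trunc1 x u m n :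
  prefix_sum (trunc1 x) u (n + m) <= n%:R + prefix_sum x u m.
Proof.
rewrite /prefix_sum (big_cat_nat (n := m)) ?leq_addl //= [leRHS]addrC lerD //.
  by apply: ler_sum => j _; rewrite ext_trunc1 ge_min lexx.
apply: (@le_trans _ _ (\sum_(m <= j < n + m) 1)).
  by apply: ler_sum => j _; rewrite ext_trunc1 ge_min lexx orbT.
by rewrite sumr_const_nat addnK.
Qed.

(** Members of [S] above 1 are dropped from the constraint: each contributes exactly 1 on the right
    after capping, while each dropped index costs at most 1 on the left. *)
Lemma antiserver_trunc1 rho tau x : antiserver rho tau x -> antiserver rho tau (trunc1 x).
Proof.
move=> [x0 xr H]; split=> [p|j|u S e Su eu].
- by rewrite le_min x0 ler01.
- by rewrite /trunc1 xr minEle ler01.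
pose S2 := [set p in S | x p <= 1].
pose S1 := [set p in S | 1 < x p].
have cS : #|S| = (#|S1| + #|S2|)%N.
  rewrite -(cardsID S1 S); congr (_ + _)%N; apply: eq_card => p; rewrite !inE.
    by case: (p \in S).
  by case: (p \in S); rewrite //= andbT -leNgt.
rewrite cS -addnA; apply: le_trans (prefix_sum_trunc1 _ _ _ _) _.
have -> : \sum_(p in S) trunc1 x p = #|S1|%:R + \sum_(p in S2) x p.
  rewrite (bigID (fun p => 1 < x p)) /=; congr (_ + _).
    rewrite (eq_bigr (fun=> 1)) => [|p /andP[_ h]]; last by rewrite /trunc1 minEle leNgt h.
    rewrite -sumr_const; apply: eq_bigl => p; by rewrite inE.
  apply: eq_big => [p|p /andP[_ h]]; first by rewrite inE -leNgt.
  by rewrite /trunc1 minEle leNgt h.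
rewrite -addrA lerD2l; apply: H => // p; rewrite inE => /andP[pS _]; exact: Su.
Qed.

Lemma prefix_sum_mix x y u m (th : R) :
  prefix_sum (fun p => (1 - th) * x p + th * y p) u m =
  (1 - th) * prefix_sum x u m + th * prefix_sum y u m.
Proof.
rewrite /prefix_sum !mulr_sumr -big_split /=; apply: eq_bigr => j _.
by rewrite /ext; case: insub => // ; ring.
Qed.

(** The constraints are affine in the point and the demand jointly, so the slack is averaged along
    with the points. *)
Lemma antiserver_mix rho (t1 t2 th : R) x y : 0 <= th <= 1 ->
  antiserver rho t1 x -> antiserver rho t2 y ->
  antiserver rho ((1 - th) * t1 + th * t2) (fun p => (1 - th) * x p + th * y p).
Proof.
move=> /andP[th0 th1] [x0 xr Hx] [y0 yr Hy]; split=> [p|j|u S e Su eu].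
- by rewrite addr_ge0 // mulr_ge0 // subr_ge0.
- by rewrite xr yr !mulr0 addr0.
rewrite prefix_sum_mix big_split /= -!mulr_sumr.
have h1 : (1 - th) * prefix_sum x u (#|S| + e) <=
    (1 - th) * (\sum_(p in S) x p + e%:R * t1).
  by apply: ler_wpM2l; [rewrite subr_ge0|exact: Hx].
have h2 : th * prefix_sum y u (#|S| + e) <= th * (\sum_(p in S) y p + e%:R * t2).
  by apply: ler_wpM2l => //; exact: Hy.
by move: h1 h2; rewrite !mulrDr; lra.
Qed.

Lemma antiserver_le rho (t1 t2 : R) x : t1 <= t2 -> antiserver rho t1 x -> antiserver rho t2 x.
Proof.
move=> t12 [x0 xr H]; split=> // u S e Su eu; apply: le_trans (H u S e Su eu) _.
by rewrite lerD2l ler_wpM2l.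
Qed.

(* The scaled point serves as a comparison point in the variational inequality
   of the projection, once for each level of the tree. *)
Lemma antiserver_scale rho (d : R) (c : pred (V * 'I_k)) x : 0 < d ->
  (forall j, c (r, j) = false) ->
  (forall u v i j, child u v -> c (u, i) -> c (v, j)) ->
  antiserver rho d x ->
  antiserver rho (2 * d) (fun p => x p + 2^-1 * ((c p)%:R * (x p + d))).
Proof.
move=> d0 cr cc [x0 xr H].
have inc p : x p <= x p + 2^-1 * ((c p)%:R * (x p + d)).
  rewrite lerDl mulr_ge0 // mulr_ge0 //; apply: addr_ge0; [exact: x0|exact: ltW].
split=> [p|j|u S e Su eu].
- by apply: le_trans (x0 p) (inc p).
- by rewrite cr mul0r mulr0 addr0 xr.
have [/existsP[i ci]|/existsPn nc] := boolP [exists i, c (u, i)].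
  have -> : \sum_(p in S) (x p + 2^-1 * ((c p)%:R * (x p + d))) =
      3 / 2 * \sum_(p in S) x p + d / 2 * #|S|%:R.
    rewrite mulr_sumr mulr_natr -sumr_const -big_split /=.
    by apply: eq_bigr => -[v j] pS; rewrite (cc u v i j (Su _ pS) ci) /=; field.
  apply: (@le_trans _ _ (3 / 2 * prefix_sum x u (#|S| + e) + d / 2 * (#|S| + e)%:R)).
    rewrite /prefix_sum mulr_sumr mulr_natr.
    have -> : (d / 2) *+ (#|S| + e) = \sum_(0 <= j < #|S| + e) (d / 2).
      by rewrite sumr_const_nat subn0.
    rewrite -big_split /=; apply: ler_sum => j _.
    rewrite /ext; case: insub => [i'|]; last lra.
    by have := x0 (u, i'); case: (c (u, i')) => /=; lra.
  by have := H u S e Su eu; rewrite natrD; case: (e) => /=; lra.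
have -> : prefix_sum (fun p => x p + 2^-1 * ((c p)%:R * (x p + d))) u (#|S| + e) =
    prefix_sum x u (#|S| + e).
  apply: eq_bigr => j _; rewrite /ext; case: insub => // i.
  by rewrite (negbTE (nc i)) mul0r mulr0 addr0.
apply: le_trans (H u S e Su eu) _; apply: lerD; first by apply: ler_sum => p _; exact: inc.
by apply: ler_wpM2l => //; lra.
Qed.

End AntiServerPolytope.

(** * Movement cost of one projection *)

Section ProjectionStep.
Context {R : realType} {V : finType}.
Variables (k : nat) (r : V) (par : V -> V) (lev : V -> nat) (D : nat) (w : V -> R) (d : R).
Hypothesis d_gt0 : 0 < d.
Hypothesis w_gt0 : forall v, 0 < w v.
Hypothesis lev_root : lev r = 0%N.
Hypothesis lev_par : forall v, v != r -> (lev (par v) < lev v)%N.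
Hypothesis lev_le : forall v, (lev v <= D)%N.
Local Notation X := (V * 'I_k -> R).
Local Notation antiserver := (antiserver r par).
Implicit Types (x y a b : X).

Definition in_box x := forall p, 0 <= x p <= 1.

Definition divergence y x : R := \sum_p w p.1 * breg d (x p) (y p).

Lemma divergence_ge0 x y : (forall p, 0 <= x p) -> (forall p, 0 <= y p) -> 0 <= divergence y x.
Proof.
by move=> x0 y0; apply: sumr_ge0 => p _; rewrite mulr_ge0 ?breg_ge0 // ltW.
Qed.

Definition is_projection rho a b :=
  [/\ antiserver rho d b, in_box b &
    forall x, antiserver rho d x -> in_box x -> divergence b a <= divergence x a].

Lemma projection_exists rho a : in_box a ->
  (exists2 y, antiserver rho 0 y & in_box y) -> exists b, is_projection rho a b.
Proof.
move=> a01 [y0 y0K y0b].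
pose CI : Type := ((V * 'I_k + V * 'I_k) + ('I_k + (V * {set V * 'I_k} * bool)))%type.
pose F (i : CI) (x : X) : R := match i with
  | inl (inl p) => x p
  | inl (inr p) => 1 - x p
  | inr (inl j) => - x (r, j)
  | inr (inr (u, S0, e)) =>
    if [forall p in S0, child r par u p.1] && (e ==> (u == rho)) then
      (\sum_(p in S0) x p + e%:R * d) - prefix_sum x u (#|S0| + e)
    else 0
  end.
have FP x : (forall i, 0 <= F i x) <-> antiserver rho d x /\ in_box x.
  split=> [H|[[x0 xr H] xb] [[p|p]|[j|[[u S] e]]]] /=.
  - have xb : in_box x.
      by move=> p; have := H (inl (inl p)); have /= := H (inl (inr p)); rewrite subr_ge0 => -> ->.
    split=> //; split=> [p|j|u S e Su eu]; first by case/andP: (xb p).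
      apply/eqP; rewrite eq_le; have /= := H (inr (inl j)).
      by rewrite oppr_ge0 => ->; case/andP: (xb (r, j)).
    have := H (inr (inr (u, S, e))); rewrite /=.
    have -> : [forall p in S, child r par u p.1] by apply/'forall_implyP => p /Su.
    have -> : e ==> (u == rho) by apply/implyP => /eu ->.
    by rewrite subr_ge0.
  - exact: x0.
  - by rewrite subr_ge0; case/andP: (xb p).
  - by rewrite xr oppr0.
  - case: ifP => // /andP[/'forall_implyP Su /implyP eu]; rewrite subr_ge0; apply: H => //.
    by move=> /eu /eqP.
have [||||b /FP[bK bb] Hb] := @polytope_min R _ CI F (fun p s => w p.1 * breg d (a p) s).
- case=> [[p|p]|[j|[[u S] e]]] /=.
  + exact: pt_continuous_coord.
  + apply: pt_continuousD; first exact: pt_continuous_cst.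
    by apply: pt_continuousN; exact: pt_continuous_coord.
  + by apply: pt_continuousN; exact: pt_continuous_coord.
  + rewrite /F; case: ([forall p in S, child r par u p.1] && _); last exact: pt_continuous_cst.
    apply: pt_continuousD; last apply: pt_continuousN.
      apply: pt_continuousD; last exact: pt_continuous_cst.
      by apply: pt_continuous_sum => p _; exact: pt_continuous_coord.
    apply: pt_continuous_sum => j _; rewrite /ext; case: insub => [i|].
      exact: pt_continuous_coord.
    exact: pt_continuous_cst.
- by exists y0; apply/FP; split=> //; apply: (antiserver_le _ y0K); exact: ltW.
- by move=> x /FP[_ xb].
- move=> p s /andP[s0 _]; apply: continuousM; first exact: cst_continuous.
  by apply: breg_continuous => //; case/andP: (a01 p).
by exists b; split=> // x xK xb; apply: Hb; apply/FP.
Qed.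

(** First-order optimality. The point [y] may lie outside the box: capping a point of the segment
    towards it keeps it feasible and does not raise the divergence. *)
Lemma projection_variational rho a b y : in_box a -> is_projection rho a b ->
  antiserver rho d y ->
  0 <= \sum_p w p.1 * (lgap d (a p) (b p) * (y p - b p)).
Proof.
move=> a01 [bK bb bmin] yK.
set A := \sum_p _; rewrite leNgt; apply/negP => A0.
pose C := \sum_p w p.1 * ((y p - b p) ^+ 2 / d).
have C0 : 0 <= C.
  by apply: sumr_ge0 => p _; rewrite mulr_ge0 ?divr_ge0 ?sqr_ge0 // ltW.
have key e : 0 < e <= 1 -> 0 <= A + e * C.
  move=> /andP[e0 e1]; pose x p := (1 - e) * b p + e * y p.
  have xK : antiserver rho d x.
    have -> : d = (1 - e) * d + e * d by ring.
    by apply: antiserver_mix => //; apply/andP; split; [exact: ltW|].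
  have x0 p : 0 <= x p by case: xK.
  have tK := antiserver_trunc1 xK.
  have tb : in_box (trunc1 x).
    by move=> p; rewrite /trunc1 le_min x0 ler01 ge_min lexx orbT.
  have h1 := bmin _ tK tb.
  have h2 : divergence (trunc1 x) a <= divergence x a.
    by apply: ler_sum => p _; apply: ler_wpM2l; [exact: ltW|exact: breg_min1].
  have h3 : divergence x a <= divergence b a + e * (A + e * C).
    rewrite /divergence /A /C mulr_sumr -big_split /= mulr_sumr -big_split /=.
    apply: ler_sum => p _.
    have /andP[ap _] := a01 p; have /andP[bp _] := bb p.
    have xb : x p - b p = e * (y p - b p) by rewrite /x; ring.
    rewrite (@breg3 _ _ d_gt0 (a p) (b p) (x p)) //.
    have := breg_le_sqr d_gt0 bp (x0 p); rewrite xb => h.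
    rewrite -subr_ge0.
    have -> : w p.1 * breg d (a p) (b p) +
      e * (w p.1 * (lgap d (a p) (b p) * (y p - b p)) +
      e * (w p.1 * ((y p - b p) ^+ 2 / d))) -
      w p.1 * (breg d (a p) (b p) + breg d (b p) (x p) + e * (y p - b p) * lgap d (a p) (b p))
      = w p.1 * ((e * (y p - b p)) ^+ 2 / d - breg d (b p) (x p)) by ring.
    by rewrite mulr_ge0 ?subr_ge0 // ltW.
  have : 0 <= e * (A + e * C) by lra.
  by rewrite pmulr_rge0.
have D0 : 0 < C + 1 - A by lra.
(* If the slope [A] is negative, this step length lies in (0, 1] and is too short for the quadratic
   term [C] to make up for it. *)
have := key (- A / (C + 1 - A)).
rewrite divr_gt0 ?oppr_gt0 //= ler_pdivrMr // mul1r => /(_ ltac:(lra)).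
have -> : A + - A / (C + 1 - A) * C = A * (1 - A) / (C + 1 - A) by field; rewrite gt_eqF.
rewrite pmulr_lge0 ?invr_gt0 // leNgt => /negP; apply.
by rewrite nmulr_rlt0 //; lra.
Qed.

(** The weight 2 lev comes from adding the tests of all levels, the -1 from writing movement as
    twice the upward part minus the net change. *)
Definition potential x : R := \sum_p w p.1 * ((2 * (lev p.1)%:R - 1) * x p).

(** A coordinate of level [l > 0] enters the [l - 1] tests of smaller levels, and the test of its
    own level only under [P]. With [P] meaning [G < 0] the total is [l * G] minus the positive part
    of [G]. *)
Lemma sum_levels l (P : bool) (G : R) : (l <= D)%N -> (l = 0%N -> G = 0) ->
  \sum_(i < D) ((i.+1 < l)%N || ((l == i.+1) && P))%:R * G = l%:R * G - (if P then 0 else G).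
Proof.
move=> lD l0; rewrite -mulr_suml.
have [lz|lp] := posnP l; first by rewrite l0 // !mulr0 if_same subr0.
have -> : \sum_(i < D) (((i.+1 < l)%N || ((l == i.+1) && P))%:R : R) =
    (\sum_(i < D) ((i.+1 < l) + ((l == i.+1) && P)))%N%:R.
  rewrite natr_sum; apply: eq_bigr => i _; rewrite natrD.
  case: ltngtP => //=; rewrite ?addr0 ?add0r //.
have -> : (\sum_(i < D) ((i.+1 < l) + ((l == i.+1) && P)))%N = (l.-1 + P)%N.
  elim: D lD => [|m IH]; first by move: lp; case: l {l0}.
  rewrite leq_eqVlt => /orP[/eqP lE|lm].
    rewrite big_ord_recr /= lE eqxx ltnn /= add0n; congr (_ + _)%N.
    rewrite (eq_bigr (fun=> 1%N)) ?sum1_card ?card_ord // => i _.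
    by rewrite ltnS ltn_ord eqn_leq ltnS [(m <= i)%N]leqNgt ltn_ord /=.
  rewrite big_ord_recr /= IH // ltnNge leqW //= add0n.
  by rewrite (ltn_eqF lm) addn0.
rewrite -{2}(prednK lp) natrD -natr1; case: P => /=; ring.
Qed.

(** The coordinates deeper than a given level, together with those on it that decreased, form a set
    closed under descent, so enlarging them is a legitimate test direction. The tests of all levels
    add up to a bound on the increases by a level-weighted net change plus the drop of the
    divergence to [y]. *)
Theorem projection_step rho a b y : in_box a -> (forall j, a (r, j) = 0) ->
  is_projection rho a b -> antiserver rho 0 y ->
  \sum_p w p.1 * `|b p - a p| <=
  potential b - potential a - 4 * D%:R * (divergence y b - divergence y a).
Proof.
move=> a01 ar bP yK.
have d0 := d_gt0.
have [bK bb _] := bP.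
have b0 p : 0 <= b p by case/andP: (bb p).
have a0 p : 0 <= a p by case/andP: (a01 p).
have y0 p : 0 <= y p by case: yK.
have br j : b (r, j) = 0 by case: bK.
pose g p := lgap d (a p) (b p).
pose I := \sum_p w p.1 * (g p * (y p - b p)).
have g0 p : lev p.1 = 0%N -> g p = 0.
  case: p => v j /= /eqP lv0; have -> : v = r.
    by apply: contraTeq lv0 => /lev_par; case: (lev v).
  by rewrite /g ar br lgapxx.
have I0 : 0 <= I.
  exact: (projection_variational a01 bP (antiserver_le (ltW d_gt0) yK)).
have test (h : 'I_D) : 0 <= \sum_p ((h.+1 < lev p.1)%N || ((lev p.1 == h.+1) && (g p < 0)))%:R *
    (w p.1 * ((b p + d) * g p)) + 2 * I.
  pose c (p : V * 'I_k) := (h.+1 < lev p.1)%N || ((lev p.1 == h.+1) && (g p < 0)).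
  pose z p := b p + 2^-1 * ((c p)%:R * (b p + d)).
  have zK : antiserver rho (2 * d) z.
    apply: antiserver_scale => // [j|u v i j /andP[vr /eqP pv]].
      by rewrite /c /= lev_root.
    rewrite /c /= => H; apply/orP; left; apply: leq_trans (lev_par vr); rewrite pv.
    by case/orP: H => [|/andP[/eqP -> _]] //; exact: ltnW.
  have mK : antiserver rho d (fun p => (1 - 2^-1) * z p + 2^-1 * y p).
    have -> : d = (1 - 2^-1) * (2 * d) + 2^-1 * 0 by field.
    by apply: antiserver_mix => //; apply/andP; split; lra.
  have := projection_variational a01 bP mK.
  set s := \sum_p _ => s0.
  suff -> : \sum_p (c p)%:R * (w p.1 * ((b p + d) * g p)) + 2 * I = 4 * s by lra.
  rewrite /I /s !mulr_sumr -big_split /=; apply: eq_bigr => p _.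
  by rewrite /z -/(g p); field.
have tests : 0 <= \sum_p w p.1 * ((b p + d) * ((lev p.1)%:R * g p - Num.max (g p) 0)) + 2 * D%:R * I.
  have : 0 <= \sum_(h < D) (\sum_p ((h.+1 < lev p.1)%N || ((lev p.1 == h.+1) && (g p < 0)))%:R *
    (w p.1 * ((b p + d) * g p)) + 2 * I) by apply: sumr_ge0 => h _; exact: test.
  rewrite big_split /= sumr_const card_ord exchange_big /= -[_ *+ D]mulr_natl.
  have -> : D%:R * (2 * I) = 2 * D%:R * I by ring.
  congr (0 <= _ + _); apply: eq_bigr => p _.
  rewrite sum_levels // => [|/g0 ->]; last by rewrite !mulr0.
  case: (ltrP (g p) 0) => gp; ring.
have h1 : \sum_p w p.1 * `|b p - a p| <=
    \sum_p w p.1 * (2 * ((b p + d) * Num.max (g p) 0) - (b p - a p)).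
  by apply: ler_sum => p _; apply: ler_wpM2l; [exact: ltW|exact: dist_le_lgap].
apply: le_trans h1 _.
have h2 : \sum_p w p.1 * ((b p + d) * ((lev p.1)%:R * g p)) <=
    \sum_p w p.1 * ((lev p.1)%:R * (b p - a p)) + D%:R * \sum_p w p.1 * breg d (a p) (b p).
  rewrite mulr_sumr -big_split /=; apply: ler_sum => p _.
  have B0 := breg_ge0 d_gt0 (a0 p) (b0 p).
  have : (lev p.1)%:R * breg d (a p) (b p) <= D%:R * breg d (a p) (b p).
    by apply: ler_wpM2r => //; rewrite ler_nat.
  have E : (b p + d) * g p = breg d (a p) (b p) + (b p - a p) by rewrite /breg -/(g p); ring.
  move/(ler_wpM2l (ltW (w_gt0 p.1))); rewrite [(b p + d) * _]mulrCA E; lra.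
(* The drop of the divergence to [y] is [I] plus the divergence of [b] from [a], so it pays for both
   error terms. *)
have h3 : divergence y b - divergence y a = - I - \sum_p w p.1 * breg d (a p) (b p).
  rewrite /divergence /I -sumrB -!sumrN -big_split /=; apply: eq_bigr => p _.
  by rewrite (@breg3 _ _ d_gt0 (a p) (b p) (y p)) // -/(g p); ring.
have h4 : potential b - potential a =
    2 * (\sum_p w p.1 * ((lev p.1)%:R * (b p - a p))) - \sum_p w p.1 * (b p - a p).
  by rewrite /potential mulr_sumr -!sumrB; apply: eq_bigr => p _; ring.
have B0 : 0 <= \sum_p w p.1 * breg d (a p) (b p).
  by apply: sumr_ge0 => p _; rewrite mulr_ge0 ?breg_ge0 // ltW.
have DB0 := mulr_ge0 (ler0n R D) B0; have DI0 := mulr_ge0 (ler0n R D) I0.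
have h5 : \sum_p w p.1 * (2 * ((b p + d) * Num.max (g p) 0) - (b p - a p)) =
   2 * (\sum_p w p.1 * ((b p + d) * Num.max (g p) 0)) - \sum_p w p.1 * (b p - a p).
  by rewrite mulr_sumr -sumrB; apply: eq_bigr => p _; ring.
have h6 : \sum_p w p.1 * ((b p + d) * ((lev p.1)%:R * g p - Num.max (g p) 0)) =
   \sum_p w p.1 * ((b p + d) * ((lev p.1)%:R * g p)) - \sum_p w p.1 * ((b p + d) * Num.max (g p) 0).
  by rewrite -sumrB; apply: eq_bigr => p _; ring.
rewrite h3 h4 h5; move: tests h2; rewrite h6; lra.
Qed.

End ProjectionStep.

(** * Variation of the divergence in a 0-1 argument *)

Section LogRange.
Context {R : realType} (d : R).
Hypothesis d_gt0 : 0 < d.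

(** Lipschitz constant for a 0-1 target: the entropy contributes at most a multiple of [lgap d 0 1],
    of order log (1/d), and the linear part at most 1. *)
Definition log_range : R := (1 + 2 * d) * lgap d 0 1 + 1.

Lemma lgap_ge0 a b : 0 <= a <= b -> 0 <= lgap d a b.
Proof.
have d0 := d_gt0; move=> /andP[a0 ab].
by apply: ln_ge0; rewrite ler_pdivlMr; lra.
Qed.

Lemma log_range_ge0 : 0 <= log_range.
Proof.
have d0 := d_gt0; rewrite /log_range addr_ge0 // mulr_ge0 //; first by lra.
by apply: lgap_ge0; rewrite lexx ler01.
Qed.

Lemma breg_bool_lip (x : R) (b c : bool) : 0 <= x <= 1 ->
  breg d x b%:R - breg d x c%:R <= log_range * (b != c)%:R.
Proof.
have d0 := d_gt0; move=> /andP[x0 x1].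
have h1 := @lgap_add _ _ d_gt0 0 x 1 (lexx _) x0 ler01.
have h2 := @lgap_add _ _ d_gt0 x 0 x x0 (lexx _) x0.
rewrite lgapxx // in h2.
have h3 : 0 <= lgap d 0 x by apply: lgap_ge0; rewrite lexx.
have h4 : 0 <= lgap d x 1 by apply: lgap_ge0; rewrite x0.
rewrite /log_range /breg; case: b; case: c => /=; rewrite ?subrr ?mulr0 ?mulr1 ?lexx //;
  rewrite ?mulr1n ?mulr0n; nra.
Qed.

End LogRange.

(** * A Lipschitz and superadditive substitute for the floor *)

Section DiscountedFloor.
Context {R : realType}.
Implicit Types s t : R.

(* Contracts the first half of every unit interval; the integer points stay
   fixed, half-integers are rounded down, and superadditivity survives. *)
Definition dfloor s : R :=
  Num.max (Num.floor s)%:~R (2 * s - (Num.floor s)%:~R - 1).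

Lemma floor_bounds s : (Num.floor s)%:~R <= s /\ s < (Num.floor s)%:~R + 1.
Proof. by split; [exact: floor_le|rewrite -intrD1 floorD1_gt]. Qed.

Lemma dfloor_mono_lip s t : s <= t -> dfloor s <= dfloor t <= dfloor s + 2 * (t - s).
Proof.
move=> st; rewrite /dfloor.
have [s1 s2] := floor_bounds s; have [t1 t2] := floor_bounds t.
have : (Num.floor s <= Num.floor t) by apply: le_floor.
rewrite le_eqVlt => /orP[/eqP E|].
  rewrite E in s1 s2 *; set y := (Num.floor t)%:~R in s1 s2 t1 t2 *.
  by case: (lerP y (2 * s - y - 1)) => h; case: (lerP y (2 * t - y - 1)) => h';
    apply/andP; split; lra.
rewrite -lezD1 -(ler_int R) intrD => E.
rewrite !(ge_max, le_max); set x := (Num.floor s)%:~R in E s1 s2 *.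
set y := (Num.floor t)%:~R in E t1 t2 *.
by case: (lerP x (2 * s - x - 1)) => h; case: (lerP y (2 * t - y - 1)) => h'; lra.
Qed.

(** With f the fractional part, [dfloor] adds the excess max (0, 2f - 1) to the floor. If the
    fractional parts add up to less than 1, at most one excess is positive; otherwise the carried
    unit and the new excess cover both. *)
Lemma dfloor_superadd s t : dfloor s + dfloor t <= dfloor (s + t).
Proof.
have [s1 s2] := floor_bounds s; have [t1 t2] := floor_bounds t.
have [u1 u2] := floor_bounds (s + t).
rewrite /dfloor; set x := Num.floor s in s1 s2 *; set y := Num.floor t in t1 t2 *.
set z := Num.floor (s + t) in u1 u2 *.
have : z = x + y \/ z = x + y + 1.
  have a1 : (x + y < z + 1) by rewrite -(ltr_int R) !intrD; lra.
  have a2 : (z < x + y + 1 + 1) by rewrite -(ltr_int R) !intrD; lra.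
  by move: a1 a2; lia.
case=> ->; rewrite !intrD; 
  case: (lerP x%:~R (2 * s - x%:~R - 1)) => h; case: (lerP y%:~R (2 * t - y%:~R - 1)) => h';
  rewrite le_max; lra.
Qed.

Lemma dfloor_nat (n : nat) (f : R) : 0 <= f -> 2 * f <= 1 -> dfloor (n%:R + f) = n%:R.
Proof.
move=> f0 f1; rewrite /dfloor.
have -> : Num.floor (n%:R + f) = n.
  by apply: floor_def; rewrite intrD /= -!pmulrn; lra.
by rewrite -pmulrn; case: lerP => //; lra.
Qed.

Lemma dfloor_sum (I : finType) (P : pred I) (F : I -> R) :
  \sum_(i | P i) dfloor (F i) <= dfloor (\sum_(i | P i) F i).
Proof.
elim/big_ind2 : _ => //.
  by have := @dfloor_nat 0 0; rewrite mulr0 addr0 => -> //; exact: ler01.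
move=> x1 x2 y1 y2 h1 h2; apply: le_trans (dfloor_superadd _ _); exact: lerD.
Qed.

End DiscountedFloor.

(** * From anti-server variables to masses at the points *)

Section Masses.
Context {R : realType} {V : finType}.
Variables (k : nat) (r : V) (par : V -> V).
Hypothesis k_gt0 : (0 < k)%N.
Local Notation X := (V * 'I_k -> R).
Local Notation child := (child r par).
Local Notation antiserver := (antiserver r par).
Implicit Types (x : X) (N : V -> nat).

(* Rescaling by (2k+1)/(2k) turns the mass [1 - margin] guaranteed at a request
   into 1 and the total mass [k] into [k + 1/2], which [dfloor] maps to [k]. *)
Definition margin : R := (2 * k + 1)%N%:R^-1.

Lemma margin_gt0 : 0 < margin.
Proof. by rewrite invr_gt0 ltr0n addn1. Qed.

Definition count_point N : X := fun p => (N p.1 <= p.2)%N%:R.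

Lemma count_point_box N : in_box (count_point N).
Proof. by move=> p; rewrite /count_point; case: (_ <= _)%N; rewrite ?lexx ?ler01. Qed.

Lemma sum_ltn_ord m n : (m <= n)%N -> (\sum_(j < n) (j < m))%N = m.
Proof.
move=> mn; have -> : (\sum_(j < n) (j < m))%N = minn m n; last exact/minn_idPl.
by elim: n {mn} => [|n IH]; rewrite ?big_ord0 ?minn0 // big_ord_recr /= IH; lia.
Qed.

(** At a 0-1 point the left side is the positive part of [#|A| + e - N u], while the right side is
    at least [#|A|] minus the total count of the children. *)
Lemma antiserver_counts rho N : (forall v, N v <= k)%N -> N r = k ->
  (forall u, \sum_(c | child u c) N c + (u == rho) <= N u)%N ->
  antiserver rho 0 (count_point N).
Proof.
move=> Nk Nr HN; split=> [p|j|u A e Au eu].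
- exact: ler0n.
- by rewrite /count_point /= Nr leqNgt ltn_ord.
rewrite mulr0 addr0.
have -> : prefix_sum (count_point N) u (#|A| + e) = (#|A| + e - N u)%N%:R.
  elim: (#|A| + e)%N => [|m IH]; first by rewrite /prefix_sum big_geq.
  rewrite /prefix_sum big_nat_recr //= -/(prefix_sum _ _ _) IH.
  have -> : ext (count_point N) u m = (N u <= m)%N%:R.
    rewrite /ext; case: insubP => [i _ <- //|]; rewrite -leqNgt => km.
    by rewrite (leq_trans (Nk u) km).
  by rewrite -natrD; congr (_%:R); case: leqP => h; lia.
rewrite -natr_sum ler_nat leq_subLR.
have h1 : #|A| = (\sum_(p in A) (N p.1 <= p.2) + \sum_(p in A) (p.2 < N p.1))%N.
  by rewrite -big_split /= -sum1_card; apply: eq_bigr => p _; case: leqP.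
have h2 : (\sum_(p in A) (p.2 < N p.1) <= \sum_(c | child u c) N c)%N.
  apply: (@leq_trans (\sum_(c | child u c) \sum_(j < k) (j < N c))%N); last first.
    by apply: leq_sum => c _; rewrite sum_ltn_ord.
  rewrite pair_big_dep /= big_mkcond [leqRHS]big_mkcond; apply: leq_sum => p _.
  by case: ifP => // /Au ->.
have h3 := HN u.
have h4 : (e <= (u == rho))%N by case: (e) eu => // /(_ isT) ->; rewrite eqxx.
by rewrite h1 -addnA [leqRHS]addnC leq_add2l; apply: leq_trans (leq_add h2 h4) h3.
Qed.

Variable w : V -> R.
Hypothesis w_ge0 : forall v, 0 <= w v.

(** Changing the count of [v] from [N v] to [N' v] flips exactly as many coordinates of [v] as the
    counts differ. *)
Lemma divergence_count_lip x N N' : in_box x -> (forall v, N v <= k)%N -> (forall v, N' v <= k)%N ->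
  divergence w margin (count_point N') x - divergence w margin (count_point N) x <=
  log_range margin * \sum_v w v * `|(N' v)%:R - (N v)%:R|.
Proof.
move=> xb Nk Nk'; rewrite /divergence -sumrB.
apply: (@le_trans _ _ (\sum_(p : V * 'I_k) w p.1 * (log_range margin * ((N' p.1 <= p.2) != (N p.1 <= p.2))%N%:R))).
  apply: ler_sum => p _; rewrite -mulrBr; apply: ler_wpM2l => //.
  by apply: breg_bool_lip => //; exact: margin_gt0.
rewrite -(pair_bigA _ (fun v (j : 'I_k) => w v * (log_range margin * ((N' v <= j) != (N v <= j))%N%:R))) /=.
rewrite mulr_sumr; apply: ler_sum => v _.
rewrite -mulr_sumr mulrCA ler_wpM2l // -mulr_sumr.
suff -> : \sum_(j < k) (((N' v <= j) != (N v <= j))%N%:R : R) = `|(N' v)%:R - (N v)%:R| by [].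
wlog le : N N' Nk Nk' / (N v <= N' v)%N => [H|].
  case: (leqP (N v) (N' v)) => h; first exact: H.
  rewrite distrC -H //; last exact: ltnW.
  by apply: eq_bigr => j _; rewrite eq_sym.
rewrite ger0_norm ?subr_ge0 ?ler_nat // -natrB // -natr_sum; congr (_%:R).
have E Z : (Z + N v = N' v -> Z = N' v - N v)%N by lia.
apply: E; rewrite -[X in (_ + X)%N](sum_ltn_ord (Nk v)) -[RHS](sum_ltn_ord (Nk' v)) -big_split /=.
apply: eq_bigr => j _.
by case: (leqP (N' v) j) => h1; case: (leqP (N v) j) => h2 //; lia.
Qed.

(** Tail-sum formula for the expected number of servers below [v], [1 - x (v, j)] being the
    probability of more than [j]. *)
Definition servers x v : R := \sum_(j < k) (1 - x (v, j)).

Definition quota x v : R := dfloor (servers x v * (2 * k + 1)%N%:R / (2 * k)%N%:R).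

Definition mass x v : R := quota x v - \sum_(c | child v c) quota x c.

(** The constraint is applied to all coordinates of all children at once. A prefix of any length
    gives the bound, because [1 - ext x u j] is nonnegative and vanishes for [j >= k]. *)
Lemma servers_superadd rho x u (e : bool) : antiserver rho margin x -> in_box x -> (e -> u = rho) ->
  \sum_(c | child u c) servers x c + e%:R * (1 - margin) <= servers x u.
Proof.
move=> [x0 xr H] xb eu.
pose A := finset (fun p : V * 'I_k => child u p.1).
have Ac p : p \in A -> child u p.1 by rewrite inE.
have := H u A e Ac eu.
have -> : \sum_(p in A) x p = #|A|%:R - \sum_(c | child u c) servers x c.
  rewrite /servers (pair_big_dep (child u) (fun _ _ => true) (fun c (j : 'I_k) => 1 - x (c, j))) /=.
  rewrite [X in _ - X](eq_bigl (fun p => p \in A)) => [|p]; last by rewrite inE andbT.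
  have -> : \sum_(i in A) (1 - x (i.1, i.2)) = #|A|%:R - \sum_(p in A) x p.
    by rewrite -sumr_const -sumrB; apply: eq_bigr => -[].
  ring.
have : #|A|%:R + e%:R - servers x u <= prefix_sum x u (#|A| + e).
  rewrite -natrD; move: (#|A| + e)%N => m.
  pose G j := 1 - ext x u j.
  have G0 j : 0 <= G j.
    rewrite subr_ge0 /ext; case: insub => // i; by case/andP: (xb (u, i)).
  have -> : servers x u = \sum_(0 <= j < k) G j.
    rewrite big_mkord; apply: eq_bigr => j _; rewrite /G /ext insubT //= => h.
    by congr (1 - x (_, _)); exact: val_inj.
  have : \sum_(0 <= j < m) G j <= \sum_(0 <= j < k) G j.
    case: (leqP m k) => mk.
      by rewrite (big_cat_nat (leq0n m) mk) //= lerDl sumr_ge0.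
    rewrite (big_cat_nat (leq0n k) (ltnW mk)) //= [X in _ + X]big_nat_cond.
    rewrite [X in _ + X]big1 ?addr0 // => j /andP[/andP[kj _] _].
    by rewrite /G /ext insubF ?subrr // ltnNge kj.
  rewrite {1}/G sumrB sumr_const_nat subn0 -/(prefix_sum x u m); lra.
by case: (e) => /=; lra.
Qed.

Lemma scale_ge1 : (2 * k + 1)%N%:R / (2 * k)%N%:R * (1 - margin) = 1 :> R.
Proof.
rewrite /margin natrD natrM; field.
by rewrite !pnatr_eq0 -natrM natr1 !pnatr_eq0 /= -lt0n.
Qed.

(** After rescaling a full unit is available at the request; [dfloor] fixes it and is superadditive,
    so it survives in the difference of quotas. *)
Lemma mass_ge rho x u : antiserver rho margin x -> in_box x -> (u == rho)%:R <= mass x u.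
Proof.
move=> xK xb; rewrite /mass lerBrDr.
have h := @servers_superadd rho x u (u == rho) xK xb (@elimT _ _ eqP).
pose c : R := (2 * k + 1)%N%:R / (2 * k)%N%:R.
have c0 : 0 <= c by rewrite divr_ge0.
apply: (@le_trans _ _ (dfloor (u == rho)%:R + dfloor (\sum_(v | child u v) servers x v * c))).
  rewrite lerD //; last first.
    under eq_bigr do rewrite /quota -mulrA; exact: dfloor_sum.
  by have := @dfloor_nat R (u == rho) 0; rewrite addr0 mulr0 => ->.
apply: le_trans (dfloor_superadd _ _) _.
have := @dfloor_mono_lip R ((u == rho)%:R + \sum_(v | child u v) servers x v * c) (servers x u * c).
rewrite /quota -mulrA -/c => /(_ _)/andP[] //.
rewrite -mulr_suml; apply: le_trans (ler_wpM2r c0 h).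
by rewrite mulrDl -mulrA [(1 - margin) * c]mulrC scale_ge1 mulr1 addrC.
Qed.

Lemma quota_root x : (forall j, x (r, j) = 0) -> quota x r = k%:R.
Proof.
move=> xr; rewrite /quota /servers; under eq_bigr do rewrite xr subr0.
rewrite sumr_const card_ord.
have -> : k%:R * (2 * k + 1)%N%:R / (2 * k)%N%:R = k%:R + 2^-1 :> R.
  by rewrite natrD natrM; field; rewrite pnatr_eq0 -lt0n.
by apply: dfloor_nat; lra.
Qed.

Lemma sum_mass x : \sum_v mass x v = quota x r.
Proof.
rewrite /mass sumrB.
have -> : \sum_v \sum_(c | child v c) quota x c = \sum_(c | c != r) quota x c.
  rewrite (exchange_big_dep (fun c => c != r)) /=; last by move=> v c _ /andP[].
  apply: eq_bigr => c cr; rewrite (eq_bigl (pred1 (par c))) ?big_pred1_eq // => v.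
  by rewrite /child cr /= eq_sym.
by rewrite (bigD1 r) //= addrK.
Qed.

(** The 3 is the Lipschitz constant 2 of [dfloor] times the scale (2k+1)/(2k), which is at most
    3/2. *)
Lemma quota_lip x y v : `|quota x v - quota y v| <= 3 * \sum_(j < k) `|x (v, j) - y (v, j)|.
Proof.
pose c : R := (2 * k + 1)%N%:R / (2 * k)%N%:R.
have k1 : 1 <= k%:R :> R by rewrite ler1n.
have c0 : 0 <= c by rewrite divr_ge0.
have c1 : 2 * c <= 3.
  by rewrite /c mulrA ler_pdivrMr ?ltr0n ?muln_gt0 // natrD natrM; lra.
have h : `|servers x v - servers y v| <= \sum_(j < k) `|x (v, j) - y (v, j)|.
  rewrite /servers -sumrB; apply: le_trans (ler_norm_sum _ _ _) _.
  by apply: ler_sum => j _; rewrite distrC (_ : _ - _ = x (v, j) - y (v, j)) //; ring.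
apply: (@le_trans _ _ (2 * c * `|servers x v - servers y v|)); last first.
  apply: (@le_trans _ _ (3 * `|servers x v - servers y v|)); first exact: ler_wpM2r.
  exact: ler_wpM2l.
have q z : quota z v = dfloor (servers z v * c) by rewrite /quota -mulrA.
rewrite !q; clearbody c.
wlog le : x y {h q} / servers y v <= servers x v => [H|].
  case: (leP (servers y v) (servers x v)) => h'; first exact: H.
  by rewrite distrC [`|servers x v - _|]distrC; apply: H; exact: ltW.
have := @dfloor_mono_lip R (servers y v * c) (servers x v * c) (ler_wpM2r c0 le).
move=> /andP[h1 h2]; rewrite ger0_norm ?subr_ge0 // [`|servers x v - _|]ger0_norm ?subr_ge0 //.
by lra.
Qed.

(** Summation by parts: quotas cancel on every edge with both ends on the same side of [U], and the
    quota of the root is always [k]. *)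
Lemma mass_cluster_lip x y (U : pred V) : (forall j, x (r, j) = 0) -> (forall j, y (r, j) = 0) ->
  `|\sum_(a | U a) mass x a - \sum_(a | U a) mass y a| <=
  \sum_(v | v != r) `|quota x v - quota y v| * (U v != U (par v))%:R.
Proof.
move=> xr yr.
have E z : \sum_(a | U a) mass z a =
    (U r)%:R * quota z r + \sum_(v | v != r) ((U v)%:R - (U (par v))%:R) * quota z v.
  rewrite /mass sumrB.
  have -> : \sum_(v | U v) \sum_(c | child v c) quota z c =
      \sum_(c | c != r) (U (par c))%:R * quota z c.
    rewrite (exchange_big_dep (fun c => c != r)) /=; last by move=> v c _ /andP[].
    apply: eq_bigr => c cr; case Uc: (U (par c)); last first.
      rewrite mul0r big1 // => v /andP[Uv /andP[_ /eqP pv]].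
      by rewrite -pv Uc in Uv.
    rewrite mul1r (eq_bigl (pred1 (par c))) ?big_pred1_eq // => v.
    rewrite /child cr /= eq_sym; case: eqP => [->|]; by rewrite ?Uc ?andbF.
  have -> : \sum_(v | U v) quota z v = \sum_v (U v)%:R * quota z v.
    by rewrite big_mkcond; apply: eq_bigr => v _; case: (U v); rewrite ?mul1r ?mul0r.
  rewrite (bigD1 r) //= -addrA -sumrB; congr (_ + _).
  by apply: eq_bigr => v _; rewrite mulrBl.
rewrite !E !quota_root // opprD addrACA subrr add0r -sumrB.
apply: le_trans (ler_norm_sum _ _ _) _; apply: ler_sum => v _.
rewrite -mulrBr normrM mulrC; apply: ler_wpM2l => //.
by case: (U v); case: (U (par v)); rewrite /= ?subrr ?normr0 ?subr0 ?sub0r ?normrN ?normr1.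
Qed.

(** Rescaling adds [N v / (2k)], at most one half, and this is exactly what [dfloor] discards. *)
Lemma quota_counts N v : (N v <= k)%N -> quota (count_point N) v = (N v)%:R.
Proof.
move=> Nk; have k0 : k%:R != 0 :> R by rewrite pnatr_eq0 -lt0n.
have -> : quota (count_point N) v = dfloor ((N v)%:R + (N v)%:R / (2 * k%:R)).
  rewrite /quota; congr dfloor.
  have -> : servers (count_point N) v = (N v)%:R.
    rewrite -[in RHS](sum_ltn_ord Nk) natr_sum; apply: eq_bigr => j _.
    by rewrite /count_point /=; case: leqP; rewrite ?subrr ?subr0.
  by rewrite natrD natrM; field.
apply: dfloor_nat; first by rewrite divr_ge0 // mulr_ge0.
have : (N v)%:R <= k%:R :> R by rewrite ler_nat.
have k1 : 0 < k%:R :> R by rewrite ltr0n.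
have -> : 2 * ((N v)%:R / (2 * k%:R)) = (N v)%:R / k%:R :> R by field.
by rewrite ler_pdivrMr // mul1r.
Qed.

End Masses.

(** * Hierarchical clusterings, their tree distance and transport *)

Section Hierarchy.
Context {R : realType} {P : finType}.
Variables (L : nat) (cl : nat -> P -> P).
Implicit Types (m : P -> R) (a b c : P) (i : nat).

(* [cl i a] names the level-[i] cluster of [a] by one of its members. *)
Definition hierarchy : Prop :=
  [/\ forall a, cl 0 a = a, forall i a, cl i (cl i a) = cl i a,
      forall i a b, cl i a = cl i b -> cl i.+1 a = cl i.+1 b &
      forall a b, cl L a = cl L b].

Hypothesis clH : hierarchy.

Definition cmass m i c : R := \sum_(a | cl i a == c) m a.

(** The inner factor 2 matches [tnorm]: a unit of mass moved between separated points changes two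
    cluster masses on that level. *)
Definition tdist a b : R := \sum_(i < L.+1) 2 ^+ i * (2 * (cl i a != cl i b)%:R).

Definition tnorm m : R := \sum_(i < L.+1) \sum_c 2 ^+ i * `|cmass m i c|.

Lemma cl_nest i j a b : (i <= j)%N -> cl i a = cl i b -> cl j a = cl j b.
Proof.
case: clH => _ _ nest _ /subnK <-; elim: (j - i)%N => // n IH /IH; exact: nest.
Qed.

Lemma cl_cl i a : cl i.+1 (cl i a) = cl i.+1 a.
Proof. by case: clH => _ idem nest _; apply: nest. Qed.

Lemma cmass0 m a : cmass m 0 a = m a.
Proof. by case: clH => z _ _ _; rewrite /cmass (eq_bigl (pred1 a)) ?big_pred1_eq // => x; rewrite z. Qed.

Lemma cmassS m i c : cmass m i.+1 c = \sum_(c' | cl i.+1 c' == c) cmass m i c'.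
Proof.
rewrite /cmass (exchange_big_dep (fun a => cl i.+1 a == c)) /=; last first.
  by move=> c' a /eqP <- /eqP <-; rewrite cl_cl.
apply: eq_bigr => a /eqP ac; rewrite (eq_bigl (pred1 (cl i a))) ?big_pred1_eq // => c'.
by rewrite /= [RHS]eq_sym; case: (cl i a =P c') => [<-|]; rewrite ?andbF // cl_cl ac eqxx.
Qed.

Lemma cmassL m a c : cmass m L c = (cl L a == c)%:R * \sum_x m x.
Proof.
case: clH => _ _ _ top; rewrite /cmass; case: eqP => [ac|ac].
  by rewrite mul1r; apply: eq_bigl => x; rewrite (top x a) ac eqxx.
by rewrite mul0r big1 // => x /eqP xc; rewrite (top x a) in xc.
Qed.

Lemma cmassB m m' i c : cmass (fun a => m a - m' a) i c = cmass m i c - cmass m' i c.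
Proof. by rewrite /cmass sumrB. Qed.

Lemma tdist_ge0 a b : 0 <= tdist a b.
Proof. by apply: sumr_ge0 => i _; rewrite !mulr_ge0 // exprn_ge0. Qed.

Lemma tdist_triangle a b c : tdist a c <= tdist a b + tdist b c.
Proof.
rewrite /tdist -big_split /=; apply: ler_sum => i _; rewrite -mulrDr ler_wpM2l ?exprn_ge0 //.
rewrite -mulrDr ler_wpM2l // -natrD ler_nat.
by case: (cl i a =P cl i b) => [->|_] //=; exact: leq_trans (leq_b1 _) (leq_addr _ _).
Qed.

Lemma tdist_xx a : tdist a a = 0.
Proof. by rewrite /tdist big1 // => i _; rewrite eqxx !mulr0. Qed.

Definition sep_level a b : nat := \sum_(i < L.+1) (cl i a != cl i b).

Lemma sep_level_lt a b b' (i : 'I_L.+1) : cl i a != cl i b -> cl i a = cl i b' ->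
  (sep_level a b' < sep_level a b)%N.
Proof.
move=> ab ab'; rewrite /sep_level (bigD1 i) //= [ltnRHS](bigD1 i) //= ab' eqxx add0n.
rewrite -ab' ab add1n ltnS; apply: leq_sum => j ji.
case: (ltngtP i j) => ij.
- by rewrite (cl_nest (ltnW ij) ab') eqxx.
- case E: (cl j a == cl j b); last by case: (_ == _).
  by move/eqP: E => /(cl_nest (ltnW ij)) /eqP E; rewrite E in ab.
- by rewrite (val_inj ij) eqxx in ji.
Qed.

Lemma sep_levelC a b : sep_level a b = sep_level b a.
Proof. by apply: eq_bigr => i _; rewrite eq_sym. Qed.

Variable k : nat.
Local Notation conf := {ffun 'I_k -> P}.

Definition load (l : conf) a : nat := \sum_(j < k) (l j == a).

Lemma sum_load l : (\sum_a load l a)%N = k.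
Proof.
rewrite /load exchange_big /= (eq_bigr (fun=> 1%N)) ?sum1_card ?card_ord // => j _.
rewrite (bigD1 (l j)) //= eqxx big1 ?addn0 // => a; by rewrite eq_sym => /negbTE ->.
Qed.

Definition cload l i c : nat := \sum_(j < k) (cl i (l j) == c).

Lemma cmass_load l i c : cmass (fun a => (load l a)%:R) i c = (cload l i c)%:R.
Proof.
rewrite /cmass -natr_sum /load exchange_big /=; congr (_%:R); apply: eq_bigr => j _.
case: eqP => [lc|lc].
  by rewrite (bigD1 (l j)) ?lc ?eqxx //= big1 // => a /andP[_]; rewrite eq_sym => /negbTE ->.
by rewrite big1 // => a /eqP ac; case: eqP => // la; rewrite -la in ac.
Qed.

(** Move a server from an overfull to an underfull point with the fewest separating levels. By
    minimality, a separating cluster around one of them contains no point of the other kind, so the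
    move lowers [tnorm] by exactly its own cost. *)
Lemma rearrange (l : conf) (N : P -> nat) : (\sum_a N a)%N = k ->
  exists l' : conf, (forall a, load l' a = N a) /\
    \sum_(j < k) tdist (l j) (l' j) <= tnorm (fun a => (load l a)%:R - (N a)%:R).
Proof.
move=> Nk; have [e] := ubnP (\sum_a (load l a - N a))%N; elim: e l => // e IH l le.
have [/eqP|pos] := posnP (\sum_a (load l a - N a))%N.
  rewrite sum_nat_eq0 => /forallP h.
  have lN a : (load l a <= N a)%N by rewrite -subn_eq0 (implyP (h a)).
  have E : (\sum_a load l a)%N == (\sum_a N a)%N by rewrite sum_load Nk.
  have EE a : load l a = N a.
    apply/eqP; have /leqif_sum := fun a (_ : true) => leqif_eq (lN a).
    by move=> [_]; rewrite E => /esym/forallP/(_ a).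
  exists l; split=> //; rewrite big1 => [|j _]; last exact: tdist_xx.
  by apply: sumr_ge0 => i _; apply: sumr_ge0 => c _; rewrite mulr_ge0 // exprn_ge0.
have [a0 ea0] : exists a, (N a < load l a)%N.
  apply/existsP; apply: contraLR pos => /existsPn h; rewrite -eqn0Ngt sum_nat_eq0.
  by apply/forallP => a; rewrite subn_eq0 leqNgt h.
have [b0 eb0] : exists b, (load l b < N b)%N.
  apply/existsP; apply: contraTT isT => /existsPn h.
  have : (\sum_a N a < \sum_a load l a)%N.
    rewrite (bigD1 a0) //= [ltnRHS](bigD1 a0) //= -addSn leq_add //.
    by apply: leq_sum => a _; rewrite leqNgt h.
  by rewrite sum_load Nk ltnn.
pose Q (p : P * P) := (N p.1 < load l p.1)%N && (load l p.2 < N p.2)%N.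
have Q0 : Q (a0, b0) by rewrite /Q /= ea0 eb0.
case: (arg_minnP (fun p => sep_level p.1 p.2) Q0) => -[a b] /andP[/= ea eb] minab.
have nob (i : 'I_L.+1) x : cl i a != cl i b -> cl i x = cl i a -> (N x <= load l x)%N.
  move=> ab xa; rewrite leqNgt; apply/negP => ex.
  have := minab (a, x); rewrite /Q /= ea ex => /(_ isT).
  by rewrite leqNgt (sep_level_lt ab).
have noa (i : 'I_L.+1) x : cl i a != cl i b -> cl i x = cl i b -> (load l x <= N x)%N.
  move=> ab xb; rewrite leqNgt; apply/negP => ex.
  have := minab (x, b); rewrite /Q /= eb ex => /(_ isT).
  by rewrite leqNgt sep_levelC [sep_level a b]sep_levelC (@sep_level_lt b a x i) // eq_sym.
have [j0 /eqP lj0] : exists j, l j == a.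
  apply/existsP; apply: contraTT ea => /existsPn h; rewrite -leqNgt /load big1 // => j _.
  by rewrite (negbTE (h j)).
have ab : a != b by apply: contraTneq ea => ->; rewrite -leqNgt ltnW.
pose l1 : conf := [ffun j => if j == j0 then b else l j].
have ld x : (load l1 x + (x == a) = load l x + (x == b))%N.
  rewrite /load (bigD1 j0) //= [in RHS](bigD1 j0) //= ffunE eqxx lj0.
  rewrite (eq_bigr (fun j => (l j == x) : nat)) => [|j /negbTE jj0]; last by rewrite ffunE jj0.
  by rewrite [b == x]eq_sym [a == x]eq_sym addnAC [in RHS]addnAC; congr (_ + _)%N; exact: addnC.
have ldR x : (load l1 x)%:R = (load l x)%:R - (x == a)%:R + (x == b)%:R :> R.
  by apply/eqP; rewrite addrAC eq_sym subr_eq -!natrD ld.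
have [|l' [l'N cost]] := IH l1.
  rewrite -ltnS; apply: leq_trans le; rewrite ltnS (bigD1 a) //= [ltnRHS](bigD1 a) //= -addSn.
  apply: leq_add; first by have := ld a; rewrite eqxx (negbTE ab); lia.
  apply: leq_sum => x /negbTE xa; have := ld x; rewrite xa.
  by case: (x =P b) => [->|_]; lia.
exists l'; split=> //.
have h1 : \sum_(j < k) tdist (l j) (l' j) <= tdist a b + \sum_(j < k) tdist (l1 j) (l' j).
  rewrite (bigD1 j0) //= [X in _ <= _ + X](bigD1 j0) //= addrA ffunE eqxx lj0.
  rewrite lerD ?tdist_triangle //; apply: ler_sum => j /negbTE jj0.
  by rewrite ffunE jj0.
apply: le_trans h1 _; apply: le_trans (lerD (lexx _) cost) _.
rewrite /tdist /tnorm -big_split /=; apply: ler_sum => i _.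
rewrite -!mulr_sumr -mulrDr ler_wpM2l ?exprn_ge0 //.
have ind x i' c : cmass (fun y => (y == x)%:R) i' c = (cl i' x == c)%:R.
  rewrite /cmass; case: eqP => [xc|xc].
    by rewrite (bigD1 x) ?xc ?eqxx //= big1 ?addr0 // => y /andP[_ /negbTE ->].
  by rewrite big1 // => y /eqP yc; case: eqP => // yx; rewrite yx in yc.
have E c : cmass (fun x => (load l1 x)%:R - (N x)%:R) i c =
    cmass (fun x => (load l x)%:R - (N x)%:R) i c - (cl i a == c)%:R + (cl i b == c)%:R.
  rewrite -!ind /cmass -sumrB -big_split /=; apply: eq_bigr => x _.
  by rewrite ldR; ring.
have [ciab|ciab] := eqVneq (cl i a) (cl i b).
  rewrite mulr0 add0r; apply: ler_sum => c _; rewrite E ciab.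
  rewrite (_ : _ - _ + _ = cmass (fun x => (load l x)%:R - (N x)%:R) i c) //; ring.
have ga : 1 <= cmass (fun x => (load l x)%:R - (N x)%:R) i (cl i a).
  rewrite /cmass (bigD1 a) //=; apply: le_trans (_ : 1 + 0 <= _); first by rewrite addr0.
  apply: lerD; first by rewrite lerBrDr addrC natr1 ler_nat.
  by apply: sumr_ge0 => x /andP[/eqP xa _]; rewrite subr_ge0 ler_nat (nob _ _ ciab).
have gb : cmass (fun x => (load l x)%:R - (N x)%:R) i (cl i b) <= -1.
  rewrite /cmass (bigD1 b) //=; apply: (@le_trans _ _ (-1 + 0)); last by rewrite addr0.
  apply: lerD; first by move: eb; rewrite -(ler_nat R) -natr1; lra.
  by apply: sumr_le0 => x /andP[/eqP xa _]; rewrite subr_le0 ler_nat (noa _ _ ciab).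
rewrite (bigD1 (cl i a)) //= [in leRHS](bigD1 (cl i a)) //= (bigD1 (cl i b)) 1?eq_sym //=.
rewrite [in leRHS](bigD1 (cl i b)) 1?eq_sym //=.
have -> : \sum_(c | (c != cl i a) && (c != cl i b))
    `|cmass (fun x => (load l1 x)%:R - (N x)%:R) i c| =
  \sum_(c | (c != cl i a) && (c != cl i b)) `|cmass (fun x => (load l x)%:R - (N x)%:R) i c|.
  apply: eq_bigr => c /andP[ca cb]; rewrite E eq_sym (negbTE ca) [cl i b == c]eq_sym (negbTE cb).
  by rewrite subr0 addr0.
rewrite !E !eqxx (negbTE ciab) [cl i b == cl i a]eq_sym (negbTE ciab) /= subr0 addr0.
set u := cmass _ i (cl i a) in ga *; set v := cmass _ i (cl i b) in gb *.
rewrite [`|u|]ger0_norm ?[`|v|]ler0_norm ?[`|u - 1|]ger0_norm ?[`|v + 1|]ler0_norm; lra.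
Qed.

End Hierarchy.

(** * Couplings of integer roundings *)

Section FiniteLaws.
Context {R : realType}.

Definition is_law (T : finType) (mu : T -> R) := (forall t, 0 <= mu t) /\ \sum_t mu t = 1.

(** [q t] is the probability of rounding [M'] up given [t]. The coupling is monotone, so the
    expected displacement is the difference of the means: with different integer parts independent
    rounding is already monotone; with equal ones either only low outcomes are raised or only high
    ones lowered. *)
Lemma round_marginal (T : finType) (mu : T -> R) (X : T -> nat) (M M' : R) :
  is_law mu -> 0 <= M -> 0 <= M' ->
  (forall t, 0 < mu t -> (Num.truncn M <= X t <= (Num.truncn M).+1)%N) ->
  \sum_t mu t * (X t)%:R = M ->
  exists q : T -> R, [/\ forall t, 0 <= q t <= 1,
    \sum_t mu t * q t = M' - (Num.truncn M')%:R &
    \sum_t mu t * (q t * `|(X t)%:R - (Num.truncn M').+1%:R| +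
                   (1 - q t) * `|(X t)%:R - (Num.truncn M')%:R|) <= `|M - M'|].
Proof.
move=> [mu0 mu1] M0 M'0 Xb XM.
have /andP[f1 f2] := truncn_itv M0; have /andP[g1 g2] := truncn_itv M'0.
set f := Num.truncn M in Xb f1 f2 *; set g := Num.truncn M' in g1 g2 *.
rewrite -natr1 in f2; rewrite -natr1 in g2.
have sumq (c : R) : \sum_t mu t * c = c by rewrite -mulr_suml mu1 mul1r.
have supp (F G : T -> R) : (forall t, 0 < mu t -> F t = G t) ->
    \sum_t mu t * F t = \sum_t mu t * G t.
  move=> H; apply: eq_bigr => t _; have := mu0 t; rewrite le_eqVlt => /orP[/eqP <-|/H -> //].
  by rewrite !mul0r.
case: (ltngtP f g) => fg.
- exists (fun=> M' - g%:R); split=> [t||]; [apply/andP; split; lra|exact: sumq|].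
  rewrite (supp _ (fun t => M' - (X t)%:R)) => [|t /Xb/andP[x1 x2]].
    under eq_bigr do rewrite mulrBr; rewrite sumrB sumq XM distrC; exact: ler_norm.
  have xg : (X t)%:R <= g%:R :> R by rewrite ler_nat (leq_trans x2).
  by rewrite !ler0_norm -?natr1; lra.
- exists (fun=> M' - g%:R); split=> [t||]; [apply/andP; split; lra|exact: sumq|].
  rewrite (supp _ (fun t => (X t)%:R - M')) => [|t /Xb/andP[x1 x2]].
    under eq_bigr do rewrite mulrBr; rewrite sumrB sumq XM; exact: ler_norm.
  have xg : g%:R + 1 <= (X t)%:R :> R by rewrite natr1 ler_nat (leq_trans fg).
  by rewrite !ger0_norm -?natr1; lra.
rewrite -fg in g1 g2 *.
pose Z t : R := (X t != f)%:R.
have XZ t : 0 < mu t -> (X t)%:R = f%:R + Z t.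
  move=> /Xb; rewrite /Z => /andP[x1 x2]; case: eqP => [->|/eqP xf]; first by rewrite addr0.
  by rewrite natr1; congr (_%:R); apply/eqP; rewrite eqn_leq x2 ltn_neqAle eq_sym xf x1.
have Z01 t : Z t = 0 \/ Z t = 1 by rewrite /Z; case: (_ != _); [right|left].
have sZ : \sum_t mu t * Z t = M - f%:R.
  apply/eqP; rewrite eq_sym subr_eq -XM -[X in _ + X](sumq f%:R) -big_split /=; apply/eqP.
  by under [RHS]eq_bigr do rewrite -mulrDr addrC; exact: supp.
case: (lerP M M') => MM.
- pose r := (M' - M) / (f%:R + 1 - M).
  have D0 : 0 < f%:R + 1 - M by lra.
  have r0 : 0 <= r by rewrite divr_ge0; lra.
  have r1 : r <= 1 by rewrite ler_pdivrMr //; lra.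
  have rD : (f%:R + 1 - M) * r = M' - M by rewrite /r mulrC divfK // gt_eqF.
  exists (fun t => Z t + (1 - Z t) * r); split=> [t||].
  + by case: (Z01 t) => ->; apply/andP; split; lra.
  + have -> : \sum_t mu t * (Z t + (1 - Z t) * r) = \sum_t (mu t * Z t * (1 - r) + mu t * r).
      by apply: eq_bigr => t _; ring.
    by rewrite big_split /= -mulr_suml sZ sumq; lra.
  rewrite (supp _ (fun t => (1 - Z t) * r)) => [|t /XZ ->]; last first.
    have -> : f%:R + Z t - f.+1%:R = Z t - 1 by rewrite -natr1; ring.
    have -> : f%:R + Z t - f%:R = Z t by ring.
    by case: (Z01 t) => ->; rewrite ?subrr ?sub0r ?normr0 ?normrN ?normr1; ring.
  have -> : \sum_t mu t * ((1 - Z t) * r) = \sum_t (mu t * r - mu t * Z t * r).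
    by apply: eq_bigr => t _; ring.
  by rewrite sumrB sumq -mulr_suml sZ; lra.
pose r := (M' - f%:R) / (M - f%:R).
have D0 : 0 < M - f%:R by lra.
have r0 : 0 <= r by rewrite divr_ge0; lra.
have r1 : r <= 1 by rewrite ler_pdivrMr //; lra.
have rD : (M - f%:R) * r = M' - f%:R by rewrite /r mulrC divfK // gt_eqF.
exists (fun t => Z t * r); split=> [t||].
- by case: (Z01 t) => ->; apply/andP; split; lra.
- have -> : \sum_t mu t * (Z t * r) = \sum_t (mu t * Z t * r) by apply: eq_bigr => t _; ring.
  by rewrite -mulr_suml sZ; lra.
rewrite (supp _ (fun t => Z t * (1 - r))) => [|t /XZ ->]; last first.
  have -> : f%:R + Z t - f.+1%:R = Z t - 1 by rewrite -natr1; ring.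
  have -> : f%:R + Z t - f%:R = Z t by ring.
  by case: (Z01 t) => ->; rewrite ?subrr ?sub0r ?normr0 ?normrN ?normr1; ring.
have -> : \sum_t mu t * (Z t * (1 - r)) = \sum_t (mu t * Z t * (1 - r)).
  by apply: eq_bigr => t _; ring.
by rewrite -mulr_suml sZ; lra.
Qed.

Definition bernoulli_prod (T : finType) (q : T -> R) (B : {ffun T -> bool}) : R :=
  \prod_u (if B u then q u else 1 - q u).

Lemma bernoulli_prod_ge0 (T : finType) (q : T -> R) B : (forall u, 0 <= q u <= 1) ->
  0 <= bernoulli_prod q B.
Proof.
move=> q01; apply: prodr_ge0 => u _; have /andP[q0 q1] := q01 u.
by case: (B u); rewrite ?subr_ge0.
Qed.

Lemma bernoulli_prod_marginal (T : finType) (q : T -> R) u0 (g : bool -> R) :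
  \sum_B bernoulli_prod q B * g (B u0) = q u0 * g true + (1 - q u0) * g false.
Proof.
pose F u b : R := (if b then q u else 1 - q u) * (if u == u0 then g b else 1).
have -> : \sum_B bernoulli_prod q B * g (B u0) = \sum_(B : {ffun T -> bool}) \prod_u F u (B u).
  apply: eq_bigr => B _; rewrite /F big_split /=; congr (_ * _).
  rewrite (bigD1 u0) //= eqxx big1 ?mulr1 // => u uu0; by rewrite (negbTE uu0).
rewrite -(bigA_distr_bigA F) (bigD1 u0) //= [X in _ * X]big1 => [|u /negbTE uu0].
  by rewrite mulr1 big_bool /F eqxx.
by rewrite big_bool /F uu0 /=; ring.
Qed.

Lemma bernoulli_prod_sum (T : finType) (q : T -> R) : \sum_B bernoulli_prod q B = 1.
Proof.
rewrite /bernoulli_prod -(bigA_distr_bigA (fun u (b : bool) => if b then q u else 1 - q u)).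
by rewrite big1 // => u _; rewrite big_bool /=; ring.
Qed.

End FiniteLaws.

(** * The objective of the rounding program *)

Section RoundingProgram.
Context {R : realType} {P : finType}.
Variables (L : nat) (cl : nat -> P -> P) (k : nat).
Hypothesis clH : hierarchy L cl.
Variables (m' : P -> R).
Local Notation conf := {ffun 'I_k -> P}.
Local Notation node := ('I_L.+1 * P)%type.
Local Notation cube := {ffun node -> bool}.
Implicit Types (B : cube) (i : nat) (c : P) (l : conf).

Definition rounded B i c : nat := (Num.truncn (cmass cl m' i c) + B (inord i, c))%N.

(** The subtraction is truncated: only a surplus of the children over their parent is penalised.
    Deficits then vanish by themselves, both sides having the same mean. *)
Definition defect B i c : nat :=
  (\sum_(c' | cl i.+1 c' == c) rounded B i c' - rounded B i.+1 c)%N.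

Definition deviation l B i c : R := `|(cload cl l i c)%:R - (rounded B i c)%:R|.

(* The constant 5 makes repairing a defect at level [i.+1] worthwhile although
   it may create a defect at level [i] and move two servers. *)
Definition rounding_cost (t : conf * cube) : R :=
  \sum_(i < L) \sum_c 5 * 2 ^+ i * (defect t.2 i c)%:R +
  \sum_(i < L.+1) \sum_c 2 ^+ i * deviation t.1 t.2 i c.

Lemma cloadS l i c : cload cl l i.+1 c = (\sum_(c' | cl i.+1 c' == c) cload cl l i c')%N.
Proof.
apply/eqP; rewrite -(eqr_nat R) natr_sum -cmass_load (cmassS clH); apply/eqP.
by apply: eq_bigr => c' _; rewrite cmass_load.
Qed.

(** The loads of a configuration are additive, so a surplus can only stem from deviations. *)
Lemma defect_le l B i c : (defect B i c)%:R <=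
  \sum_(c' | cl i.+1 c' == c) deviation l B i c' + deviation l B i.+1 c.
Proof.
rewrite /defect.
have dev0 j x : 0 <= deviation l B j x by exact: normr_ge0.
case: (leqP (\sum_(c' | cl i.+1 c' == c) rounded B i c') (rounded B i.+1 c)) => h.
  by rewrite (eqP h) addr_ge0 // sumr_ge0.
rewrite natrB ?(ltnW h) //.
apply: (@le_trans _ _ (\sum_(c' | cl i.+1 c' == c) ((rounded B i c')%:R - (cload cl l i c')%:R) +
   ((cload cl l i.+1 c)%:R - (rounded B i.+1 c)%:R))).
  rewrite cloadS !natr_sum sumrB; lra.
apply: lerD; last exact: ler_norm.
by apply: ler_sum => c' _; rewrite /deviation distrC ler_norm.
Qed.

(** A deviation at level i is charged with weight 2^i once as such, 5 times through the surplus at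
    its parent and 5/2 times through the surplus at its own cluster. *)
Lemma rounding_cost_le t :
  rounding_cost t <= 9 * \sum_(i < L.+1) \sum_c 2 ^+ i * deviation t.1 t.2 i c.
Proof.
case: t => l B; rewrite /rounding_cost /=.
pose G i := \sum_c deviation l B i c.
have G0 i : 0 <= G i by apply: sumr_ge0 => c _; exact: normr_ge0.
have e0 i : 0 <= 2 ^+ i :> R by exact: exprn_ge0.
have -> : \sum_(i < L.+1) \sum_c 2 ^+ i * deviation l B i c = \sum_(i < L.+1) 2 ^+ i * G i.
  by apply: eq_bigr => i _; rewrite mulr_sumr.
have h : \sum_(i < L) \sum_c 5 * 2 ^+ i * (defect B i c)%:R <=
    \sum_(i < L) (5 * (2 ^+ i * G i) + 5 / 2 * (2 ^+ i.+1 * G i.+1)).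
  apply: ler_sum => i _; rewrite -mulr_sumr.
  have : \sum_c (defect B i c)%:R <= G i + G i.+1.
    apply: le_trans (ler_sum _ (fun c _ => defect_le l B i c)) _.
    rewrite big_split /= lerD2r (exchange_big_dep xpredT) //=; apply: ler_sum => c _.
    by rewrite (eq_bigl (pred1 (cl i.+1 c))) ?big_pred1_eq // => x; rewrite eq_sym.
  by move=> /(ler_wpM2l (e0 i)); rewrite exprS; lra.
have h1 : \sum_(i < L) 2 ^+ i * G i <= \sum_(i < L.+1) 2 ^+ i * G i.
  by rewrite big_ord_recr /= lerDl mulr_ge0.
have h2 : \sum_(i < L) 2 ^+ i.+1 * G i.+1 <= \sum_(i < L.+1) 2 ^+ i * G i.
  by rewrite big_ord_recl /= lerDr mulr_ge0.
have h3 : 0 <= \sum_(i < L.+1) 2 ^+ i * G i by apply: sumr_ge0 => i _; rewrite mulr_ge0.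
by move: h; rewrite big_split /= -!mulr_sumr; lra.
Qed.

Lemma inord_neq i j : (i <= L)%N -> (j <= L)%N -> i != j -> inord i != inord j :> 'I_L.+1.
Proof.
move=> iL jL ij; apply: contraNneq ij => /(congr1 (@nat_of_ord _)).
by rewrite !inordK // => ->.
Qed.

(** One bit affects the surplus at the parent, the surplus at its own cluster, whose weight 5 *
    2^(i-1) explains the 5/2, and a single deviation, by at most 1. *)
Lemma rounding_cost_local l B B' (i : 'I_L) c (A A2 : R) : 0 <= A2 ->
  (forall u, u != (inord i, c) -> B' u = B u) ->
  (defect B' i (cl i.+1 c))%:R <= (defect B i (cl i.+1 c))%:R + A ->
  (forall i0 : 'I_L, i0.+1 = i -> (defect B' i0 c)%:R <= (defect B i0 c)%:R + A2) ->
  rounding_cost (l, B') <= rounding_cost (l, B) + 5 * 2 ^+ i * A + 5 / 2 * 2 ^+ i * A2 + 2 ^+ i.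
Proof.
move=> A20 BB' HA HA2.
have iL : (i <= L)%N by exact: ltnW.
have e0 j : 0 <= 2 ^+ j :> R by exact: exprn_ge0.
have same (j : nat) x : (j <= L)%N -> (j != i) || (x != c) -> rounded B' j x = rounded B j x.
  move=> jL H; rewrite /rounded BB' //; apply: contraTN H => /eqP [ji ->].
  by rewrite eqxx orbF negbK; apply: contraTT isT => /(inord_neq jL iL); rewrite ji eqxx.
have H1 : \sum_(j < L) \sum_x 5 * 2 ^+ j * (defect B' j x)%:R <=
    \sum_(j < L) \sum_x 5 * 2 ^+ j * (defect B j x)%:R + 5 * 2 ^+ i * A + 5 / 2 * 2 ^+ i * A2.
  pose I1 (j : 'I_L) x : R := 5 * 2 ^+ j * (((j == i) && (x == cl i.+1 c))%:R * A).
  pose I2 (j : 'I_L) x : R := 5 * 2 ^+ j * (((j.+1 == i) && (x == c))%:R * A2).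
  have s1 : \sum_(j < L) \sum_x I1 j x = 5 * 2 ^+ i * A.
    rewrite (bigD1 i) //= (bigD1 (cl i.+1 c)) //= /I1 !eqxx mul1r !big1 ?addr0 //.
      by move=> j /negbTE ji; rewrite big1 // => x _; rewrite ji !mul0r mulr0.
    by move=> x /negbTE ->; rewrite mul0r mulr0.
  have s2 : \sum_(j < L) \sum_x I2 j x <= 5 / 2 * 2 ^+ i * A2.
    have [j0 /eqP j0i|nj] := pickP (fun j : 'I_L => j.+1 == i :> nat).
      rewrite (bigD1 j0) //= (bigD1 c) //= /I2 j0i !eqxx mul1r !big1 ?addr0 //.
      - by rewrite -j0i exprS; lra.
      - move=> j jj0; rewrite big1 // => x _; case: eqP => [ji|]; last by rewrite !mul0r mulr0.
        by rewrite -j0i in ji; case: ji => /val_inj ji; rewrite ji eqxx in jj0.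
      - by move=> x /negbTE ->; rewrite mul0r mulr0.
    rewrite big1 ?mulr_ge0 ?e0 // => j _; rewrite big1 // => x _.
    by rewrite /I2 nj !mul0r mulr0.
  rewrite -s1 -addrA; apply: le_trans (lerD (lexx _) (lerD (lexx _) s2)).
  rewrite -!big_split /=; apply: ler_sum => j _; rewrite -!big_split /=; apply: ler_sum => x _.
  rewrite /I1 /I2 -!mulrDr ler_wpM2l ?mulr_ge0 //.
  have dsame : (j != i) || (x != cl i.+1 c) -> (j.+1 != i) || (x != c) -> defect B' j x = defect B j x.
    move=> h1 h2; rewrite /defect (same j.+1) //; congr (_ - _)%N; apply: eq_bigr => y /eqP yx.
    rewrite same 1?ltnW //; case: (boolP (j != i :> nat)) => //=; rewrite negbK => /eqP ji.
    have jE : j = i by exact: val_inj.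
    by move: h1; rewrite jE eqxx /= -yx jE; apply: contraNneq => ->.
  case: (boolP ((j == i) && (x == cl i.+1 c))) => [/andP[/eqP -> /eqP ->]|h1] /=.
    rewrite mul1r (_ : (i.+1 == i :> nat) = false) /=; last by rewrite eqn_leq ltnn.
    by rewrite mul0r addr0.
  case: (boolP ((j.+1 == i) && (x == c))) => [/andP[/eqP ji /eqP ->]|h2] /=.
    by rewrite mul0r mul1r add0r; exact: HA2.
  by rewrite dsame ?mul0r ?addr0 // -negb_and.
have H2 : \sum_(j < L.+1) \sum_x 2 ^+ j * deviation l B' j x <=
    \sum_(j < L.+1) \sum_x 2 ^+ j * deviation l B j x + 2 ^+ i.
  pose I1 (j : 'I_L.+1) x : R := 2 ^+ j * ((j == inord i) && (x == c))%:R.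
  have <- : \sum_(j < L.+1) \sum_x I1 j x = 2 ^+ i.
    rewrite (bigD1 (inord i)) //= (bigD1 c) //= /I1 !eqxx mulr1 !big1 ?addr0 //.
    - by rewrite inordK.
    - by move=> j /negbTE ji; rewrite big1 // => x _; rewrite ji mulr0.
    - by move=> x /negbTE ->; rewrite mulr0.
  rewrite -big_split /=; apply: ler_sum => j _; rewrite -big_split /=; apply: ler_sum => x _.
  rewrite /I1 -mulrDr ler_wpM2l // /deviation.
  case: (boolP ((j == inord i) && (x == c))) => [/andP[/eqP -> /eqP ->]|h].
    rewrite inordK // /rounded !natrD.
    set u := (cload _ _ _ _)%:R; set v := (Num.truncn _)%:R.
    have -> : u - (v + (B' (inord i, c))%:R) =
      (u - (v + (B (inord i, c))%:R)) + ((B (inord i, c))%:R - (B' (inord i, c))%:R) by ring.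
    apply: le_trans (ler_normD _ _) _; rewrite lerD2l.
    by case: (B _); case: (B' _); rewrite ?subrr ?subr0 ?sub0r ?normrN ?normr1 ?normr0.
  rewrite same ?addr0 //; first by rewrite -ltnS.
  rewrite -negb_and.
  by apply: contraNN h => /andP[/eqP <- ->]; rewrite inord_val eqxx.
by rewrite /rounding_cost /=; lra.
Qed.

End RoundingProgram.

(** * Optimal joint laws of configurations and roundings *)

Section RoundingStep.
Context {R : realType} {P : finType}.
Variables (L : nat) (cl : nat -> P -> P) (k : nat).
Hypothesis clH : hierarchy L cl.
Local Notation conf := {ffun 'I_k -> P}.
Local Notation node := ('I_L.+1 * P)%type.
Local Notation cube := {ffun node -> bool}.
Implicit Types (m : P -> R) (B : cube) (i : nat) (c : P) (l : conf).

Definition joint_law m' (mu : conf -> R) (p : conf * cube -> R) :=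
  [/\ forall t, 0 <= p t, forall l, \sum_B p (l, B) = mu l &
    forall u : node, \sum_t p t * (rounded cl m' t.2 u.1 u.2)%:R = cmass cl m' u.1 u.2].

Definition mean_cost m' (p : conf * cube -> R) : R := \sum_t rounding_cost cl m' t * p t.

Lemma sum_delta (T : finType) (t0 : T) (F : T -> R) : \sum_t (t == t0)%:R * F t = F t0.
Proof.
rewrite (bigD1 t0) //= eqxx mul1r big1 ?addr0 // => t /negbTE ->; exact: mul0r.
Qed.

Lemma sum_fiber (T1 T2 : finType) (q : T1 * T2 -> R) (z : T1) :
  \sum_y q (z, y) = \sum_t q t * (t.1 == z)%:R.
Proof.
rewrite [RHS](eq_bigr (fun t => q (t.1, t.2) * (t.1 == z)%:R)) => [|[]//].
rewrite -(pair_bigA _ (fun a b => q (a, b) * (a == z)%:R)) /= (bigD1 z) //= eqxx.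
rewrite [X in _ + X]big1 ?addr0 => [|a /negbTE al]; last by rewrite big1 // => b _; rewrite al mulr0.
by apply: eq_bigr => b _; rewrite mulr1.
Qed.

Definition flip (B : cube) (v : node) (b : bool) : cube := [ffun u => if u == v then b else B u].

Lemma rounded_flip m' B b (i j : nat) c x : (i <= L)%N -> (j <= L)%N ->
  rounded cl m' (flip B (inord i, c) b) j x =
  if (j == i) && (x == c) then (Num.truncn (cmass cl m' i c) + b)%N else rounded cl m' B j x.
Proof.
move=> iL jL; rewrite /rounded ffunE xpair_eqE.
case: (eqVneq j i) => [->|ji] /=; first by rewrite eqxx; case: eqP => [->|].
by rewrite (negbTE (inord_neq jL iL ji)).
Qed.

(* Transfers probability between a state with a surplus below a cluster and one
   with a deficit there: both change the value of one common child cluster. *)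
Lemma minimal_defect_free m' mu p : joint_law m' mu p ->
  (forall p', joint_law m' mu p' -> mean_cost m' p <= mean_cost m' p') ->
  forall t, 0 < p t -> forall (i : 'I_L) c, defect cl m' t.2 i c = 0%N.
Proof.
move=> [p0 pl pm] pmin [l1 B1] pt1 i c0; apply/eqP; rewrite -leqn0 leqNgt; apply/negP => /= d1.
have iL : (i <= L)%N by exact: ltnW.
have iL1 : (i.+1 <= L)%N by [].
pose e B := (\sum_(c | cl i.+1 c == c0) rounded cl m' B i c)%N.
have pmn j c : (j <= L)%N -> \sum_t p t * (rounded cl m' t.2 j c)%:R = cmass cl m' j c.
  by move=> jL; have := pm (inord j, c); rewrite /= inordK.
(* Parent and children have the same mean, so a surplus in one state is balanced by a deficit in
   another. *)
have bal : \sum_t p t * ((e t.2)%:R - (rounded cl m' t.2 i.+1 c0)%:R) = 0.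
  under eq_bigr do rewrite mulrBr natr_sum mulr_sumr.
  rewrite sumrB pmn // exchange_big /= (cmassS clH).
  by rewrite (eq_bigr (fun c => cmass cl m' i c)) ?subrr // => c _; rewrite pmn.
have d1' : (rounded cl m' B1 i.+1 c0 < e B1)%N by move: d1; rewrite /defect subn_gt0.
have [[l2 B2] /andP[pt2 d2]] : exists t, (0 < p t) && (e t.2 < rounded cl m' t.2 i.+1 c0)%N.
  apply/existsP; apply: contraT => /existsPn h; move: bal.
  suff : 0 < \sum_t p t * ((e t.2)%:R - (rounded cl m' t.2 i.+1 c0)%:R) by move=> /lt0r_neq0/eqP.
  rewrite (bigD1 (l1, B1)) //=; apply: ltr_pwDl.
    by rewrite mulr_gt0 // subr_gt0 ltr_nat.
  apply: sumr_ge0 => t _; have := h t; rewrite negb_and -leNgt -leqNgt => /orP[pt|et].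
    by have /eqP -> : p t == 0; [rewrite eq_le pt p0|rewrite mul0r].
  by rewrite mulr_ge0 // subr_ge0 ler_nat.
rewrite /= in d2.
(* Both states give the parent the same floor or one more, so a strict deficit and a strict surplus
   separate the sums over the children. *)
have ee : (e B2 < e B1)%N.
  apply: leq_ltn_trans (leq_ltn_trans _ d1'); last exact: leq_addr.
  by rewrite -ltnS; apply: leq_trans d2 _; rewrite /rounded -[leqRHS]addn1 leq_add2l leq_b1.
have [c /andP[/eqP cc0 cB]] :
    exists c, (cl i.+1 c == c0) && (rounded cl m' B2 i c < rounded cl m' B1 i c)%N.
  apply/existsP; apply: contraTT ee => /existsPn h; rewrite -leqNgt; apply: leq_sum => c cc0.
  by have := h c; rewrite cc0 /= -leqNgt.
have [b1 b2] : B1 (inord i, c) = true /\ B2 (inord i, c) = false.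
  by move: cB; rewrite /rounded ltn_add2l; case: (B1 _); case: (B2 _).
pose B1' := flip B1 (inord i, c) false; pose B2' := flip B2 (inord i, c) true.
pose t1 := (l1, B1); pose t2 := (l2, B2); pose t1' := (l1, B1'); pose t2' := (l2, B2').
pose ep := Num.min (p t1) (p t2).
have ep0 : 0 < ep by rewrite lt_min pt1.
pose p' t := p t + ep * ((t == t1')%:R + (t == t2')%:R - (t == t1)%:R - (t == t2)%:R).
have t12 : t1 != t2 by apply: contraTneq b1 => -[_ ->]; rewrite b2.
have p'F F : \sum_t p' t * F t = \sum_t p t * F t + ep * (F t1' + F t2' - F t1 - F t2).
  rewrite -(sum_delta t1' F) -(sum_delta t2' F) -(sum_delta t1 F) -(sum_delta t2 F).
  rewrite -!sumrN -!big_split /= mulr_sumr -big_split /=.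
  by apply: eq_bigr => t _; rewrite /p'; ring.
have rB (B : cube) (b : bool) j x : (j <= L)%N -> rounded cl m' (flip B (inord i, c) b) j x =
  if (j == i) && (x == c) then (Num.truncn (cmass cl m' i c) + b)%N else rounded cl m' B j x.
  by move=> jL; rewrite rounded_flip.
have p'law : joint_law m' mu p'.
  split=> [t|l|u].
  - have : ep * ((t == t1)%:R + (t == t2)%:R) <= p t.
      case: (eqVneq t t1) => [->|_].
        by rewrite (negbTE t12) addr0 mulr1 ge_min lexx.
      case: (eqVneq t t2) => [->|_]; last by rewrite addr0 mulr0.
      by rewrite add0r mulr1 ge_min lexx orbT.
    have h1 : 0 <= ep * (t == t1')%:R by rewrite mulr_ge0 // ltW.
    have h2 : 0 <= ep * (t == t2')%:R by rewrite mulr_ge0 // ltW.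
    by rewrite /p'; lra.
  - rewrite sum_fiber p'F -sum_fiber pl /=.
    by rewrite (_ : _ - _ = 0) ?mulr0 ?addr0 //; ring.
  - have uL : (u.1 <= L)%N by rewrite -ltnS.
    rewrite p'F pm /= /B1' /B2' !rB //.
    case: (boolP ((u.1 == i :> nat) && (u.2 == c))) => [/andP[/eqP u1 /eqP u2]|_].
      rewrite /rounded u1 u2 b1 b2 addn0 addn1 -natr1.
      by rewrite (_ : _ - _ = 0) ?mulr0 ?addr0 //; ring.
    by rewrite (_ : _ - _ = 0) ?mulr0 ?addr0 //; ring.
have cost1 : rounding_cost cl m' t1' <=
    rounding_cost cl m' t1 + 5 * 2 ^+ i * (-1) + 5 / 2 * 2 ^+ i * 1 + 2 ^+ i.
  apply: (@rounding_cost_local _ _ _ _ _ _ l1 B1 B1' i c) => //.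
  - by move=> u /negbTE uc; rewrite ffunE uc.
  - rewrite cc0 lerBrDr natr1 ler_nat /defect -/(e B1) -/(e B1') /B1'.
    have -> : rounded cl m' (flip B1 (inord i, c) false) i.+1 c0 = rounded cl m' B1 i.+1 c0.
      by rewrite rB // eqn_leq ltnn.
    suff : (e (flip B1 (inord i, c) false)).+1 = e B1 by move: d1'; lia.
    rewrite /e (bigD1 c) /= ?cc0 // [in RHS](bigD1 c) /= ?cc0 // rB // !eqxx /=.
    rewrite {2}/rounded b1 addn0 addn1 addSn; congr (_ + _).+1.
    by apply: eq_bigr => x /andP[_ /negbTE xc]; rewrite rB // xc andbF.
  - move=> i0 i0i; rewrite natr1 ler_nat /defect /B1' i0i !rB // !eqxx /=.
    have -> : (\sum_(c' | cl i c' == c) rounded cl m' (flip B1 (inord i, c) false) i0 c' =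
        \sum_(c' | cl i c' == c) rounded cl m' B1 i0 c')%N.
      by apply: eq_bigr => x _; rewrite rB 1?ltnW // -i0i ltn_eqF.
    by rewrite /rounded b1; lia.
have cost2 : rounding_cost cl m' t2' <=
    rounding_cost cl m' t2 + 5 * 2 ^+ i * 0 + 5 / 2 * 2 ^+ i * 0 + 2 ^+ i.
  apply: (@rounding_cost_local _ _ _ _ _ _ l2 B2 B2' i c) => //.
  - by move=> u /negbTE uc; rewrite ffunE uc.
  - rewrite cc0 addr0 ler_nat /defect -/(e B2) -/(e B2') /B2'.
    have -> : rounded cl m' (flip B2 (inord i, c) true) i.+1 c0 = rounded cl m' B2 i.+1 c0.
      by rewrite rB // eqn_leq ltnn.
    suff : e (flip B2 (inord i, c) true) = (e B2).+1 by move: d2; lia.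
    rewrite /e (bigD1 c) /= ?cc0 // [in RHS](bigD1 c) /= ?cc0 // rB // !eqxx /=.
    rewrite {2}/rounded b2 addn0 addn1 addSn; congr (_ + _).+1.
    by apply: eq_bigr => x /andP[_ /negbTE xc]; rewrite rB // xc andbF.
  - move=> i0 i0i; rewrite addr0 ler_nat /defect /B2' i0i !rB // !eqxx /=.
    have -> : (\sum_(c' | cl i c' == c) rounded cl m' (flip B2 (inord i, c) true) i0 c' =
        \sum_(c' | cl i c' == c) rounded cl m' B2 i0 c')%N.
      by apply: eq_bigr => x _; rewrite rB 1?ltnW // -i0i ltn_eqF.
    by rewrite /rounded b2; lia.
(* In units of 2^i the change is at most -5 + 5/2 + 1 from the first state and 1 from the second,
   hence negative. *)
have := pmin _ p'law.
have mcE q : mean_cost m' q = \sum_t q t * rounding_cost cl m' t.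
  by apply: eq_bigr => t _; rewrite mulrC.
rewrite !mcE p'F lerDl pmulr_rge0 //.
have : 0 < 2 ^+ i :> R by exact: exprn_gt0.
by move: cost1 cost2; lra.
Qed.

Lemma minimal_joint_law m' mu : is_law mu -> (exists p, joint_law m' mu p) ->
  exists2 p, joint_law m' mu p &
    forall p', joint_law m' mu p' -> mean_cost m' p <= mean_cost m' p'.
Proof.
move=> [mu0 mu1] [q0 q0J].
pose CI : Type := ((conf * cube) + ((conf * bool) + (node * bool)))%type.
pose sg (b : bool) : R := if b then 1 else -1.
pose F (z : CI) (p : conf * cube -> R) : R := match z with
  | inl t => p t
  | inr (inl (l, b)) => sg b * (\sum_B p (l, B) - mu l)
  | inr (inr (u, b)) => sg b * (\sum_t p t * (rounded cl m' t.2 u.1 u.2)%:R - cmass cl m' u.1 u.2)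
  end.
have sgP (x : R) : (forall b, 0 <= sg b * x) <-> x = 0.
  split=> [H|-> b]; last by rewrite mulr0.
  by have := H true; have := H false; rewrite /sg; lra.
have FP p : (forall z, 0 <= F z p) <-> joint_law m' mu p.
  split=> [H|[p0 pl pm] [t|[[l b]|[u b]]]] /=.
  - split=> [t|l|u]; first exact: (H (inl t)).
      apply/eqP; rewrite -subr_eq0; apply/eqP/sgP => b; exact: (H (inr (inl (l, b)))).
    by apply/eqP; rewrite -subr_eq0; apply/eqP/sgP => b; exact: (H (inr (inr (u, b)))).
  - exact: p0.
  - by rewrite pl subrr mulr0.
  - by rewrite pm subrr mulr0.
have [||||p /FP pJ pmin] := @polytope_min R _ CI F (fun t s => rounding_cost cl m' t * s).
- case=> [t|[[l b]|[u b]]] /=.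
  + exact: pt_continuous_coord.
  + apply: pt_continuousM; first exact: pt_continuous_cst.
    apply: pt_continuousD; last by apply: pt_continuousN; exact: pt_continuous_cst.
    by apply: pt_continuous_sum => B _; exact: pt_continuous_coord.
  + apply: pt_continuousM; first exact: pt_continuous_cst.
    apply: pt_continuousD; last by apply: pt_continuousN; exact: pt_continuous_cst.
    apply: pt_continuous_sum => t _; apply: pt_continuousM; first exact: pt_continuous_coord.
    exact: pt_continuous_cst.
- by exists q0; apply/FP.
- move=> p /FP[p0 pl _] [l B]; rewrite p0 /=.
  apply: (@le_trans _ _ (mu l)); first by rewrite -pl (bigD1 B) //= lerDl sumr_ge0.
  by rewrite -mu1 (bigD1 l) //= lerDl sumr_ge0.
- by move=> t s _; apply: continuousM; [exact: cst_continuous|exact: cvg_id].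
by exists p => // p' /FP; exact: pmin.
Qed.

(** Invariant of the online rounding; at level 0 it puts a server on every point of mass at least
    1. *)
Definition balanced m mu :=
  [/\ is_law mu,
    forall i c l, (i <= L)%N -> 0 < mu l ->
      (Num.truncn (cmass cl m i c) <= cload cl l i c <= (Num.truncn (cmass cl m i c)).+1)%N &
    forall i c, (i <= L)%N -> \sum_l mu l * (cload cl l i c)%:R = cmass cl m i c].

Lemma cmass_ge0 m i c : (forall a, 0 <= m a) -> 0 <= cmass cl m i c.
Proof. by move=> m0; apply: sumr_ge0. Qed.

(** A feasible competitor: given the configuration, every cluster is rounded independently by
    [round_marginal]. The values may be inconsistent, but [rounding_cost_le] reduces the cost to
    deviations at single clusters. *)
Lemma joint_law_near m m' mu : (forall a, 0 <= m a) -> (forall a, 0 <= m' a) -> balanced m mu ->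
  exists2 p, joint_law m' mu p & mean_cost m' p <= 9 * tnorm L cl (fun a => m a - m' a).
Proof.
move=> m0 m'0 [muL mub mum]; have [mu0 mu1] := muL.
have H (u : node) := @round_marginal R _ mu (fun l => cload cl l u.1 u.2) _ _ muL
  (cmass_ge0 u.1 u.2 m0) (cmass_ge0 u.1 u.2 m'0)
  (fun l => mub u.1 u.2 l (ltn_ord u.1 : u.1 <= L)%N) (mum u.1 u.2 (ltn_ord u.1 : u.1 <= L)%N).
have [q qP] := choice H.
have q01 l u : 0 <= q u l <= 1 by case: (qP u).
pose p (t : conf * cube) := mu t.1 * bernoulli_prod (q ^~ t.1) t.2.
have pF (u : node) (g : conf -> bool -> R) : \sum_t p t * g t.1 (t.2 u) =
    \sum_l mu l * (q u l * g l true + (1 - q u l) * g l false).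
  rewrite -(pair_bigA _ (fun l B => p (l, B) * g l (B u))) /=; apply: eq_bigr => l _.
  rewrite -(bernoulli_prod_marginal (q ^~ l) u) mulr_sumr; apply: eq_bigr => B _.
  by rewrite /p /= mulrA.
have iu (u : node) : (inord u.1, u.2) = u by case: u => i c; rewrite inord_val.
exists p.
  split=> [t|l|u].
  - by rewrite mulr_ge0 // bernoulli_prod_ge0.
  - by rewrite /p /= -mulr_sumr bernoulli_prod_sum mulr1.
  - have [_ qm _] := qP u.
    rewrite /rounded (eq_bigr (fun t => p t * ((Num.truncn (cmass cl m' u.1 u.2))%:R + (t.2 u)%:R))).
      rewrite (pF u (fun _ b => (Num.truncn (cmass cl m' u.1 u.2))%:R + b%:R)).
      rewrite (eq_bigr (fun l => mu l * (Num.truncn (cmass cl m' u.1 u.2))%:R + mu l * q u l)).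
        by rewrite big_split /= -mulr_suml mu1 mul1r qm; ring.
      by move=> l _; rewrite /=; ring.
    by move=> t _; rewrite iu natrD.
rewrite /mean_cost.
apply: (@le_trans _ _ (\sum_t (9 * \sum_(i < L.+1) \sum_c 2 ^+ i * deviation cl m' t.1 t.2 i c) * p t)).
  apply: ler_sum => t _; apply: ler_wpM2r; first by rewrite mulr_ge0 // bernoulli_prod_ge0.
  exact: rounding_cost_le.
under eq_bigr do rewrite -mulrA; rewrite -mulr_sumr ler_wpM2l // /tnorm.
under eq_bigr do rewrite mulr_suml; rewrite exchange_big /=; apply: ler_sum => i _.
under eq_bigr do rewrite mulr_suml; rewrite exchange_big /=; apply: ler_sum => c _.
under eq_bigr do rewrite -mulrA; rewrite -mulr_sumr ler_wpM2l ?exprn_ge0 // cmassB.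
have [_ _ qc] := qP (i, c).
pose g l (b : bool) : R := `|(cload cl l i c)%:R - (Num.truncn (cmass cl m' i c) + b)%N%:R|.
apply: (@le_trans _ _ (\sum_t p t * g t.1 (t.2 (i, c)))).
  by apply: ler_sum => t _; rewrite /deviation /rounded mulrC inord_val.
rewrite (pF (i, c) g); apply: le_trans qc; apply: ler_sum => l _.
by rewrite /g /= addn0 addn1.
Qed.

End RoundingStep.

(** * One step of the online rounding *)

Section RoundingTheorem.
Context {R : realType} {P : finType}.
Variables (L : nat) (cl : nat -> P -> P) (k : nat) (r0 : P).
Hypothesis clH : hierarchy L cl.
Local Notation conf := {ffun 'I_k -> P}.
Local Notation node := ('I_L.+1 * P)%type.
Local Notation cube := {ffun node -> bool}.
Implicit Types (m : P -> R) (B : cube) (i : nat) (c : P) (l : conf).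

(** Without surplus a parent dominates its children in every possible state; equal means then force
    equality. *)
Lemma defect_free_additive m' mu (p : conf * cube -> R) : joint_law cl m' mu p ->
  (forall t, 0 < p t -> forall (i : 'I_L) c, defect cl m' t.2 i c = 0%N) ->
  forall t, 0 < p t -> forall i c, (i <= L)%N ->
  rounded cl m' t.2 i c = (\sum_(a | cl i a == c) rounded cl m' t.2 0 a)%N.
Proof.
move=> [p0 pl pm] df t pt.
have pmn j c : (j <= L)%N -> \sum_t p t * (rounded cl m' t.2 j c)%:R = cmass cl m' j c.
  by move=> jL; have := pm (inord j, c); rewrite /= inordK.
have step i c : (i < L)%N ->
    rounded cl m' t.2 i.+1 c = (\sum_(c' | cl i.+1 c' == c) rounded cl m' t.2 i c')%N.
  move=> iL; pose e B := (\sum_(c' | cl i.+1 c' == c) rounded cl m' B i c')%N.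
  have bal : \sum_t p t * ((rounded cl m' t.2 i.+1 c)%:R - (e t.2)%:R) = 0.
    under eq_bigr do rewrite mulrBr natr_sum mulr_sumr.
    rewrite sumrB pmn // exchange_big /= (cmassS clH).
    by rewrite (eq_bigr (fun c => cmass cl m' i c)) ?subrr // => c' _; rewrite pmn // ltnW.
  have nn : forall t, true -> 0 <= p t * ((rounded cl m' t.2 i.+1 c)%:R - (e t.2)%:R).
    move=> s _; have := p0 s; rewrite le_eqVlt => /orP[/eqP <-|ps]; first by rewrite mul0r.
    rewrite mulr_ge0 // subr_ge0 ler_nat /e.
    by have /eqP := df s ps (Ordinal iL) c; rewrite /defect /= subn_eq0.
  have /eqP : p t * ((rounded cl m' t.2 i.+1 c)%:R - (e t.2)%:R) = 0 by exact: (psumr_eq0P nn bal).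
  by rewrite mulf_eq0 gt_eqF //= subr_eq0 eqr_nat => /eqP ->.
elim=> [c _|i IH c iL].
  case: clH => z _ _ _; rewrite (eq_bigl (pred1 c)) ?big_pred1_eq // => a; by rewrite z.
rewrite step // (eq_bigr (fun c' => \sum_(a | cl i a == c') rounded cl m' t.2 0 a)%N); last first.
  by move=> c' _; rewrite IH // ltnW.
rewrite (exchange_big_dep (fun a => cl i.+1 a == c)) /=; last first.
  by move=> c' a /eqP <- /eqP <-; rewrite (cl_cl clH).
apply: eq_bigr => a /eqP ac; rewrite (eq_bigl (pred1 (cl i a))) ?big_pred1_eq // => c'.
by rewrite /= [RHS]eq_sym; case: (cl i a =P c') => [<-|]; rewrite ?andbF // (cl_cl clH) ac eqxx.
Qed.

(** The values of an optimal law are additive, so those of level 0 are the loads of an actual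
    configuration; reaching it by [rearrange] costs no more than the deviations already charged by
    the program. *)
Theorem round_step m m' mu : (forall a, 0 <= m a) -> (forall a, 0 <= m' a) ->
  \sum_a m' a = k%:R -> balanced L cl m mu ->
  exists pi : conf -> conf -> R,
  [/\ forall l l', 0 <= pi l l', forall l, \sum_l' pi l l' = mu l,
      balanced L cl m' (fun l' => \sum_l pi l l') &
      \sum_l \sum_l' pi l l' * (\sum_(j < k) tdist L cl (l j) (l' j)) <=
      9 * tnorm L cl (fun a => m a - m' a)].
Proof.
move=> m0 m'0 m'k mub; have muL : is_law mu by case: mub.
have [q qJ qc] := joint_law_near clH m0 m'0 mub.
have [p pJ pmin] := minimal_joint_law muL (ex_intro _ q qJ).
have pc := le_trans (pmin q qJ) qc.
have df := minimal_defect_free clH pJ pmin.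
have add := defect_free_additive pJ df.
have [p0 pl pm] := pJ.
have p1 : \sum_t p t = 1.
  by case: muL => _ <-; rewrite -(eq_bigr _ (fun l _ => pl l)) pair_bigA; apply: eq_bigr => -[].
(* The mass of the top cluster is the integer [k], so its mean leaves no room for the extra unit. *)
have tot t : 0 < p t -> (\sum_a rounded cl m' t.2 0 a)%N = k.
  move=> pt; have := add t pt L (cl L r0) (leqnn _).
  have -> : (\sum_(a | cl L a == cl L r0) rounded cl m' t.2 0 a = \sum_a rounded cl m' t.2 0 a)%N.
    by apply: eq_bigl => a; case: clH => _ _ _ top; rewrite (top a r0) eqxx.
  move=> <-.
  have cmL : cmass cl m' L (cl L r0) = k%:R by rewrite (cmassL clH m' r0) eqxx mul1r.
  have tk : Num.truncn (cmass cl m' L (cl L r0)) = k by rewrite cmL natrK.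
  have := pm (ord_max, cl L r0); rewrite /= cmL /rounded tk.
  have -> : \sum_t p t * (k + t.2 (inord L, cl L r0))%N%:R =
      k%:R + \sum_t p t * (t.2 (inord L, cl L r0))%:R.
    under eq_bigr do rewrite natrD mulrDr; by rewrite big_split /= -mulr_suml p1 mul1r.
  move=> /eqP; rewrite -subr_eq0 addrC addKr => /eqP bal.
  have nn : forall t, true -> 0 <= p t * (t.2 (inord L, cl L r0))%:R.
    by move=> s _; rewrite mulr_ge0.
  have /eqP : p t * (t.2 (inord L, cl L r0))%:R = 0 by exact: (psumr_eq0P nn bal).
  rewrite mulf_eq0 gt_eqF //= pnatr_eq0 => /eqP ->; exact: addn0.
have ex t : exists g : conf, 0 < p t -> (forall a, load g a = rounded cl m' t.2 0 a) /\
    \sum_(j < k) tdist L cl (t.1 j) (g j) <=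
    tnorm L cl (fun a => (load t.1 a)%:R - (rounded cl m' t.2 0 a)%:R) :> R.
  have := p0 t; rewrite le_eqVlt => /orP[/eqP <-|pt]; first by exists t.1; rewrite ltxx.
  by have [g [g1 g2]] := rearrange (R := R) clH t.1 (tot t pt); exists g.
have [G GP] := choice ex.
have GL t i c : 0 < p t -> (i <= L)%N -> cload cl (G t) i c = rounded cl m' t.2 i c.
  move=> pt iL; have [gl _] := GP t pt; rewrite (add t pt i c iL).
  apply/eqP; rewrite -(eqr_nat R) -cmass_load natr_sum /cmass; apply/eqP.
  by apply: eq_bigr => a _; rewrite gl.
pose pi l l' := \sum_B p (l, B) * (G (l, B) == l')%:R.
have piF (H : conf -> conf -> R) : \sum_l \sum_l' pi l l' * H l l' = \sum_t p t * H t.1 (G t).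
  have -> : \sum_t p t * H t.1 (G t) = \sum_l \sum_B p (l, B) * H l (G (l, B)).
    by rewrite pair_bigA; apply: eq_bigr => -[].
  apply: eq_bigr => l _; under eq_bigr do rewrite mulr_suml; rewrite exchange_big /=.
  apply: eq_bigr => B _; rewrite -(sum_delta (G (l, B)) (H l)) mulr_sumr; apply: eq_bigr => l' _.
  by rewrite eq_sym mulrA.
have nuF (H : conf -> R) : \sum_l' (\sum_l pi l l') * H l' = \sum_t p t * H (G t).
  rewrite -(piF (fun _ l' => H l')) exchange_big /=; apply: eq_bigr => l' _; exact: mulr_suml.
have pi0 l l' : 0 <= pi l l' by apply: sumr_ge0 => B _; rewrite mulr_ge0.
exists pi; split=> //.
- move=> l; rewrite exchange_big /= -pl; apply: eq_bigr => B _.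
  rewrite -[RHS]mulr1 -mulr_sumr; congr (_ * _); rewrite -[RHS](sum_delta (G (l, B)) (fun=> 1)).
  by apply: eq_bigr => l' _; rewrite mulr1 eq_sym.
- split=> [|i c l' iL nu0|i c iL].
  + split=> [l'|]; first by apply: sumr_ge0.
    have := nuF (fun=> 1); under eq_bigr do rewrite mulr1; move=> ->.
    by under eq_bigr do rewrite mulr1.
  + have [l pil] : exists l, pi l l' != 0.
      apply/existsP; apply: contraLR nu0 => /existsPn h; rewrite -leNgt big1 // => l _.
      by have := h l; rewrite negbK => /eqP.
    have [B pB] : exists B : cube, p (l, B) * (G (l, B) == l')%:R != 0.
      apply/existsP; apply: contraNT pil => /existsPn h; rewrite /pi big1 // => B _.
      by have := h B; rewrite negbK => /eqP.
    move: pB; rewrite mulf_eq0 negb_or pnatr_eq0 eqb0 negbK => /andP[pB /eqP <-].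
    have pB0 : 0 < p (l, B) by rewrite lt_def pB p0.
    by rewrite GL // /rounded leq_addr /= -[leqRHS]addn1 leq_add2l leq_b1.
  + rewrite (nuF (fun l' => (cload cl l' i c)%:R)).
    have := pm (inord i, c); rewrite /= inordK // => <-; apply: eq_bigr => t _.
    have := p0 t; rewrite le_eqVlt => /orP[/eqP <-|pt]; first by rewrite !mul0r.
    by rewrite GL.
rewrite (piF (fun l l' => \sum_(j < k) tdist L cl (l j) (l' j))).
apply: le_trans pc; apply: ler_sum => t _; rewrite mulrC.
have := p0 t; rewrite le_eqVlt => /orP[/eqP <-|pt]; first by rewrite !mulr0.
apply: ler_wpM2r => //; have [gl gc] := GP t pt; apply: le_trans gc _.
have -> : tnorm L cl (fun a => (load t.1 a)%:R - (rounded cl m' t.2 0 a)%:R) =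
   \sum_(i < L.+1) \sum_c 2 ^+ i * deviation cl m' t.1 t.2 i c.
  apply: eq_bigr => i _; apply: eq_bigr => c _; congr (_ * `|_|).
  rewrite cmassB cmass_load; congr (_ - _); rewrite (add t pt) 1?natr_sum // -ltnS; exact: ltn_ord.
rewrite /rounding_cost lerDr; apply: sumr_ge0 => i _; apply: sumr_ge0 => c _.
by rewrite !mulr_ge0 // exprn_ge0.
Qed.

End RoundingTheorem.

(** * Contraction of heavy paths to a shallow tree on the points *)

Section HeavyTree.
Context {P : finType}.
Variables (L : nat) (cl : nat -> P -> P) (r0 : P).
Hypothesis clH : hierarchy L cl.
Implicit Types (a b c u v x : P) (i j : nat).

Definition csize i a : nat := \sum_b (cl i b == cl i a).

Definition best i c : P := [arg max_(b > c | cl i.+1 b == c) csize i b].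

(* [heavy i a] follows the largest subcluster from the level-[i] cluster of [a]
   down to a single point. *)
Fixpoint heavy i a : P := if i is j.+1 then heavy j (best j (cl i a)) else a.

Definition root : P := heavy L r0.

(** A heavy path is contracted to its final point: [top v] is the highest level with a cluster
    represented by [v]. *)
Definition top v : 'I_L.+1 := [arg max_(i > ord0 | heavy i v == v) (i : nat)].

Definition par v : P := heavy (top v).+1 v.

Definition below v a : bool := heavy (top v) a == v.

Let cl0 a : cl 0 a = a. Proof. by case: clH. Qed.
Let idem i a : cl i (cl i a) = cl i a. Proof. by case: clH. Qed.

Lemma bestP i a : cl i.+1 (best i (cl i.+1 a)) = cl i.+1 a /\
  forall b, cl i.+1 b = cl i.+1 a -> (csize i b <= csize i (best i (cl i.+1 a)))%N.
Proof.
rewrite /best; case: arg_maxnP => [|b /eqP bc bmax]; first by rewrite idem.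
by split=> // b' /eqP b'c; apply: bmax.
Qed.

Lemma heavy_cl i a b : cl i a = cl i b -> heavy i a = heavy i b.
Proof. by case: i => [|i] /=; [rewrite !cl0|move=> ->]. Qed.

Lemma cl_heavy i a : cl i (heavy i a) = cl i a.
Proof.
elim: i a => //= i IH a; have [bc _] := bestP i a.
by rewrite -[RHS]bc; case: clH => _ _ nest _; apply: nest; exact: IH.
Qed.

Lemma heavyK i a : heavy i (heavy i a) = heavy i a.
Proof. exact/heavy_cl/cl_heavy. Qed.

Lemma heavy_down i j v : (i <= j)%N -> heavy j v = v -> heavy i v = v.
Proof.
move=> /subnK <-; elim: (j - i)%N => // n IH; rewrite addSn /= => h.
by apply: IH; rewrite -{1}h heavyK h.
Qed.

Lemma heavy_top v : heavy (top v) v = v.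
Proof. by rewrite /top; case: arg_maxnP => [|i /eqP]. Qed.

Lemma top_max i v : (i <= L)%N -> heavy i v = v -> (i <= top v)%N.
Proof.
move=> iL hv; rewrite /top; case: arg_maxnP => [//|j _ /(_ (inord i))].
by rewrite inordK // hv eqxx => /(_ isT).
Qed.

Lemma heavy_root a : heavy L a = root.
Proof. by apply: heavy_cl; case: clH. Qed.

Lemma top_root : top root = L :> nat.
Proof.
by apply/eqP; rewrite eqn_leq -ltnS ltn_ord /= top_max // heavy_root.
Qed.

Lemma top_lt v : v != root -> (top v < L)%N.
Proof.
move=> vr; rewrite ltn_neqAle -ltnS ltn_ord andbT; apply: contraNneq vr => tv.
by rewrite -(heavy_top v) tv heavy_root.
Qed.

Lemma par_top v : v != root -> (top v < top (par v))%N.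
Proof. by move=> /top_lt tv; apply: top_max => //; exact: heavyK. Qed.

Lemma par_neq v : v != root -> par v != v.
Proof. by move=> /par_top; apply: contraTneq => ->; rewrite ltnn. Qed.

Lemma belowE v a i : (i <= L)%N -> heavy i a = v -> below v a.
Proof.
move=> iL hv; have it : (i <= top v)%N by apply: top_max => //; rewrite -hv heavyK.
rewrite /below -{2}(heavy_top v); apply/eqP/heavy_cl/(cl_nest clH it).
by rewrite -hv cl_heavy.
Qed.

Lemma below_cl v a : below v a -> cl (top v) a = cl (top v) v.
Proof. by move=> /eqP h; rewrite -[RHS](congr1 (cl (top v)) h) cl_heavy. Qed.

Lemma below_par v a : v != root -> below v a -> heavy (top v).+1 a = par v.
Proof.
move=> vr va; apply: heavy_cl; case: clH => _ _ nest _; apply: nest; exact: below_cl.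
Qed.

Lemma below_root a : below root a.
Proof. by rewrite /below top_root heavy_root. Qed.

(** Take the lowest level at which [a] is led to [u]. One level lower it is led to a point whose top
    is that lower level; this is the only child of [u] with [a] in its subtree. *)
Lemma below_child u a : (\sum_(c | child root par u c) below c a + (a == u) = below u a)%N.
Proof.
have up c : child root par u c -> below c a -> below u a /\ (top c < top u)%N.
  move=> /andP[cr /eqP pc] ca; split; last by rewrite -pc par_top.
  by apply: (@belowE u a (top c).+1); [exact: top_lt|rewrite below_par].
have no c : child root par u c -> ~~ below c u.
  move=> cu; apply/negP => ca; have /andP[cr /eqP pc] := cu.
  have tc : (top c < top u)%N by rewrite -pc par_top.
  move/eqP: ca; rewrite (heavy_down (ltnW tc) (heavy_top u)) => uc.
  by rewrite uc ltnn in tc.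
case: (eqVneq a u) => [->|au].
  rewrite big1 ?add0n => [|c cu]; last by rewrite (negbTE (no c cu)).
  by rewrite /below heavy_top eqxx.
rewrite addn0; case: (boolP (below u a)) => ua; last first.
  by rewrite big1 // => c cu; case: (boolP (below c a)) => // /(up c cu)[]; rewrite (negbTE ua).
have ex : exists i, (i <= L)%N && (heavy i a == u).
  by exists (top u); rewrite -ltnS ltn_ord; exact: ua.
case: (ex_minnP ex) => -[|i] /andP[iL /eqP hiu] imin.
  by rewrite -hiu eqxx in au.
pose c := heavy i a.
have cu : c != u.
  by apply/eqP => cu; have := imin i; rewrite (ltnW iL) -/c cu eqxx ltnn => /(_ isT).
have hc : heavy i.+1 c = u.
  by rewrite -hiu; apply: heavy_cl; case: clH => _ _ nest _; apply: nest; exact: cl_heavy.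
have tc : top c = i :> nat.
  apply/eqP; rewrite eqn_leq; apply/andP; split; last by apply: top_max; [exact: ltnW|exact: heavyK].
  rewrite leqNgt; apply/negP => ti.
  by move: cu; rewrite -hc (heavy_down ti (heavy_top c)) eqxx.
have cr : c != root by apply: contraTneq iL => cr; rewrite -tc cr top_root ltnn.
have cch : child root par u c by rewrite /child cr /par tc hc eqxx.
rewrite (bigD1 c) //= /below tc eqxx big1 ?addn0 // => c' /andP[c'u c'c].
case: eqP => // hc'; exfalso.
have c'a : below c' a by apply/eqP.
have [_ t'] := up c' c'u c'a; have /andP[c'r /eqP pc'] := c'u.
case: (ltngtP (top c') i) => ti.
- have : heavy (top c').+1 a = u by rewrite below_par.
  move=> h; have := imin (top c').+1; rewrite h eqxx top_lt //= => /(_ isT).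
  by rewrite ltnNge ti.
- have h : cl (top c') a = cl (top c') u by apply: (cl_nest clH ti); rewrite -hiu cl_heavy.
  move: hc'; rewrite (heavy_cl h) (heavy_down (ltnW t') (heavy_top u)) => uc'.
  by rewrite -uc' ltnn in t'.
- by move: hc'; rewrite ti -/c => cc'; rewrite cc' eqxx in c'c.
Qed.

Lemma csize_gt0 i a : (0 < csize i a)%N.
Proof. by rewrite /csize (bigD1 a) //= eqxx. Qed.

Lemma csize_le i j a : (i <= j)%N -> (csize i a <= csize j a)%N.
Proof.
move=> ij; apply: leq_sum => b _; case: (cl i b =P cl i a) => // /(cl_nest clH ij) ->.
by rewrite eqxx.
Qed.

Lemma csize_cl i a b : cl i a = cl i b -> csize i a = csize i b.
Proof. by rewrite /csize => ->. Qed.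

Definition weight v : nat := csize (top v) v.

(** [v] loses the next level to another subcluster at least as large as its own, and the two are
    disjoint. *)
Lemma weight_par v : v != root -> (2 * weight v <= weight (par v))%N.
Proof.
move=> vr; have tp := par_top vr.
apply: leq_trans (csize_le (par v) tp).
have -> : csize (top v).+1 (par v) = csize (top v).+1 v by apply: csize_cl; exact: cl_heavy.
have [bc bmax] := bestP (top v) v; set b := best _ _ in bc bmax.
have nb : cl (top v) b != cl (top v) v.
  apply: contraNneq (par_neq vr) => /heavy_cl; rewrite heavy_top => h.
  by rewrite /par /= -/b h.
apply: (@leq_trans (csize (top v) b + csize (top v) v)%N).
  by rewrite mul2n -addnn leq_add2r; exact: bmax.
rewrite /csize -big_split /=; apply: leq_sum => x _.
case: (cl (top v) x =P cl (top v) b) => [xb|_].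
  rewrite xb (negbTE nb) addn0; have -> : cl (top v).+1 x = cl (top v).+1 v.
    by rewrite -bc; apply: (cl_nest clH (leqnSn _) xb).
  by rewrite eqxx.
case: (cl (top v) x =P cl (top v) v) => // xv.
by rewrite (cl_nest clH (leqnSn _) xv) eqxx.
Qed.

Lemma weight_le v : (weight v <= #|P|)%N.
Proof. by rewrite -sum1_card; apply: leq_sum => b _; exact: leq_b1. Qed.

Definition depth : nat := trunc_log 2 #|P|.

(** A logarithmic rank rather than a number of edges: since weights at least double towards the
    root, it increases strictly from parent to child and stays at most [depth]. *)
Definition level v : nat := (depth - trunc_log 2 (weight v))%N.

Lemma level_root : level root = 0%N.
Proof.
rewrite /level (_ : weight root = #|P|) ?subnn // /weight top_root -sum1_card.
by apply: eq_bigr => b _; case: clH => _ _ _ t; rewrite (t b root) eqxx.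
Qed.

Lemma level_le v : (level v <= depth)%N.
Proof. exact: leq_subr. Qed.

Lemma level_par v : v != root -> (level (par v) < level v)%N.
Proof.
move=> vr; have w0 : (0 < weight v)%N by exact: csize_gt0.
have h1 : (trunc_log 2 (weight v) < trunc_log 2 (weight (par v)))%N.
  apply: (@leq_trans (trunc_log 2 (2 * weight v))); last exact/leq_trunc_log/weight_par.
  by rewrite trunc_logMp.
have h2 : (trunc_log 2 (weight (par v)) <= depth)%N by exact/leq_trunc_log/weight_le.
by rewrite /level; lia.
Qed.

Context {R : realType}.

(** Geometric sum over the levels up to [top v], the only ones that can separate [v] from
    [par v]. *)
Definition edge v : R := 4 * 2 ^+ top v.

Lemma edge_gt0 v : 0 < edge v.
Proof. by rewrite mulr_gt0 // exprn_gt0. Qed.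

Lemma tdist_par v : v != root -> tdist L cl v (par v) <= edge v.
Proof.
move=> /top_lt tv.
have -> : tdist L cl v (par v) =
    \sum_(i < L.+1 | (i < (top v).+1)%N) 2 ^+ i * (2 * (cl i v != cl i (par v))%:R) :> R.
  rewrite [RHS]big_mkcond; apply: eq_bigr => i _; case: ifP => // /negbT; rewrite -leqNgt => ti.
  by rewrite (cl_nest clH ti (esym (cl_heavy _ _))) eqxx !mulr0.
apply: (@le_trans _ _ (2 * \sum_(i < (top v).+1) 2 ^+ i)); last first.
  by rewrite sum_pow2 exprS /edge; lra.
rewrite (big_ord_widen L.+1 (fun i => 2 ^+ i)) 1?ltnW // mulr_sumr; apply: ler_sum => i _.
rewrite mulrC -mulrA ler_wpM2l // -[leRHS]mul1r ler_wpM2r ?exprn_ge0 //.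
by case: (_ != _).
Qed.

(** If [a] and [b] share the cluster of level [top v], then [v] is above both or neither. On a
    separating level at most two nodes count, those to which [a] and [b] are led. *)
Lemma below_dist a b : \sum_v edge v * (below v a != below v b)%:R <= 4 * tdist L cl a b.
Proof.
pose Q (i : 'I_L.+1) v x : R := 4 * 2 ^+ i * ((heavy i x == v)%:R * (cl i a != cl i b)%:R).
apply: (@le_trans _ _ (\sum_(i < L.+1) \sum_v (Q i v a + Q i v b))).
  rewrite exchange_big /=; apply: ler_sum => v _; rewrite (bigD1 (top v)) //=.
  have Q0 (i : 'I_L.+1) x : 0 <= Q i v x by rewrite !mulr_ge0 // exprn_ge0.
  rewrite -[leLHS]addr0 lerD ?sumr_ge0 // => [|i _]; last by rewrite addr_ge0.
  rewrite /Q -mulrDr /edge ler_wpM2l ?mulr_ge0 ?exprn_ge0 // -/(below v a) -/(below v b).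
  case: (cl (top v) a =P cl (top v) b) => [/heavy_cl h|_] /=.
    by rewrite /below h eqxx !mulr0 addr0.
  by case: (below v a); case: (below v b); rewrite /= ?mulr1 ?mul0r ?addr0 ?add0r //; lra.
rewrite /tdist mulr_sumr; apply: ler_sum => i _.
have S x : \sum_v Q i v x = 4 * 2 ^+ i * (cl i a != cl i b)%:R.
  rewrite -mulr_sumr -mulr_suml (bigD1 (heavy i x)) //= eqxx big1 ?addr0 ?mul1r // => v.
  by rewrite eq_sym => /negbTE ->.
by rewrite big_split /= !S; lra.
Qed.

End HeavyTree.

(** * Harmonic sums *)

Section Harmonic.
Context {R : realType}.

(** Ties only enlarge ranks. A point with the largest [nu] has rank [#|A|]; removing it does not
    increase the ranks of the others. *)
Lemma rank_sum_le (T : finType) (nu : T -> R) (A : {set T}) :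
  \sum_(c in A) (#|finset (fun x => (x \in A) && (nu x <= nu c))|%:R)^-1 <=
  \sum_(i < #|A|) (i.+1%:R)^-1 :> R.
Proof.
have [n] := ubnP #|A|; elim: n A => // n IH A; rewrite ltnS => An.
have [->|/set0Pn[c0 c0A]] := eqVneq A finset.set0.
  by rewrite big_set0 cards0 big_ord0.
have [c cA cmax] : exists2 c, c \in A & forall x, x \in A -> nu x <= nu c.
  by case: (@arg_maxP _ _ _ c0 (mem A) nu c0A) => c cA cm; exists c.
have cAD : #|A| = #|(A :\ c)%SET|.+1 by rewrite (cardsD1 c) cA.
rewrite (bigD1 c) //= cAD big_ord_recr /= addrC lerD //.
  rewrite (eq_bigl (fun x => x \in (A :\ c)%SET)) => [|x]; last by rewrite !inE andbC.
  apply: le_trans (IH (A :\ c)%SET _); last by rewrite -cAD.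
  apply: ler_sum => x xA; rewrite lef_pV2 ?posrE ?ltr0n.
  - by rewrite ler_nat; apply/subset_leq_card/fintype.subsetP => y; rewrite !inE => /andP[/andP[_ ->]].
  - by apply/card_gt0P; exists x; rewrite inE; case/setD1P: xA => _ -> /=.
  - by apply/card_gt0P; exists x; rewrite inE xA /=.
rewrite lef_pV2 ?posrE ?ltr0n // -?cAD ?ler_nat.
- by apply/subset_leq_card/fintype.subsetP => y yA; rewrite inE yA cmax.
- by apply/card_gt0P; exists c; rewrite inE cA /=.
Qed.

Lemma harmonic_le_ln n : (0 < n)%N -> \sum_(i < n) (i.+1%:R)^-1 <= 1 + ln n%:R :> R.
Proof.
elim: n => // -[|n] IH _; first by rewrite big_ord1 invr1 ln1 addr0.
rewrite big_ord_recr /=; have := IH isT.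
have n1 : 0 < n.+1%:R :> R by rewrite ltr0n.
have n2 : 0 < n.+2%:R :> R by rewrite ltr0n.
have : ln (n.+1%:R / n.+2%:R) <= n.+1%:R / n.+2%:R - 1 :> R.
  by apply: ln_le_subr1; rewrite divr_gt0.
rewrite ln_div ?posrE // (_ : n.+1%:R / n.+2%:R - 1 = - n.+2%:R^-1 :> R).
  by move: (ln n.+1%:R) (ln n.+2%:R) (n.+2%:R^-1) (\sum_(i < n.+1) i.+1%:R^-1) => x y z t; lra.
have -> : n.+1%:R = n.+2%:R - 1 :> R by rewrite -[n.+2%:R]natr1 addrK.
by rewrite mulrBl divff ?gt_eqF //; ring.
Qed.

Lemma bernoulli_ineq (x : R) n : 0 <= x -> 1 + n%:R * x <= (1 + x) ^+ n.
Proof.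
move=> x0; elim: n => [|n IH]; first by rewrite mul0r addr0 expr0.
rewrite exprS; apply: le_trans (ler_wpM2l (addr_ge0 ler01 x0) IH).
have : 0 <= n%:R * (x * x) by rewrite mulr_ge0 // mulr_ge0.
by rewrite -natr1; lra.
Qed.

End Harmonic.

(** * Labelling points by a random order *)

Section RandomOrder.
Context {R : realType} {P : finType}.
Implicit Types (s : {perm P}) (a b c x : P) (A : {set P}).

Definition prio s c : nat := enum_rank (s c).

Lemma prio_inj s : injective (prio s).
Proof. by move=> x y /val_inj/enum_rank_inj/perm_inj. Qed.

Definition first s A c : bool := [forall x in A, prio s c <= prio s x]%N.

(** A transposition exchanges the events for two members of [A], so all are equally likely to come
    first, and at most one does. *)
Lemma first_prob A c : c \in A -> \sum_s (first s A c)%:R <= #|{perm P}|%:R / #|A|%:R :> R.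
Proof.
move=> cA; have A0 : 0 < #|A|%:R :> R by rewrite ltr0n; apply/card_gt0P; exists c.
rewrite ler_pdivlMr //.
have E c' : c' \in A -> \sum_s (first s A c)%:R = \sum_s (first s A c')%:R :> R.
  move=> c'A; rewrite (reindex_inj (mulgI (tperm c c'))) /=; apply: eq_bigr => s _; congr (_%:R).
  have tA x : x \in A -> tperm c c' x \in A by move=> xA; case: tpermP => // ->.
  have pr x : prio (tperm c c' * s)%g x = prio s (tperm c c' x) by rewrite /prio permM.
  congr nat_of_bool; apply/'forall_implyP/'forall_implyP => H x xA.
    by have := H _ (tA x xA); rewrite !pr tpermK tpermL.
  by rewrite !pr tpermL; apply: H; exact: tA.
rewrite mulr_natr -sumr_const (eq_bigr _ E) exchange_big /= -sum1_card natr_sum.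
apply: ler_sum => s _; rewrite -natr_sum ler_nat.
case: (pickP (fun x => (x \in A) && first s A x)) => [x /andP[xA fx]|no]; last first.
  by rewrite big1 // => x xA; have := no x; rewrite xA /= => ->.
rewrite (bigD1 x) //= fx big1 // => y /andP[yA yx]; apply/eqP; rewrite eqb0.
apply: contraNN yx => fy; apply/eqP/(@prio_inj s)/eqP; rewrite eqn_leq.
by rewrite (implyP (forallP fy x) xA) (implyP (forallP fx y) yA).
Qed.

Variable d : P -> P -> R.

Definition label s (rr : R) a : P := [arg min_(c < a | d a c <= rr) prio s c].

Hypothesis d_xx : forall a, d a a = 0.

Lemma labelP s rr a : 0 <= rr -> d a (label s rr a) <= rr /\
  forall c, d a c <= rr -> (prio s (label s rr a) <= prio s c)%N.
Proof. by move=> r0; rewrite /label; case: arg_minnP => [|c h1 h2]; [rewrite d_xx|]. Qed.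

Lemma label_eq s rr a c : 0 <= rr -> d a c <= rr ->
  (forall x, d a x <= rr -> (prio s c <= prio s x)%N) -> label s rr a = c.
Proof.
move=> r0 ac H; have [h1 h2] := labelP s a r0.
by apply: (@prio_inj s); apply/eqP; rewrite eqn_leq h2 // H.
Qed.

Definition near_set a b (rr : R) : {set P} := finset (fun c => (d a c <= rr) || (d b c <= rr)).

(** If the first point of the union of both balls lay in both, it would be the label of both
    centres. *)
Lemma label_cut s rr a b : 0 <= rr -> label s rr a != label s rr b ->
  exists c, first s (near_set a b rr) c && (Num.min (d a c) (d b c) <= rr < Num.max (d a c) (d b c)).
Proof.
move=> r0 lab.
have aN : a \in near_set a b rr by rewrite inE d_xx r0.
case: (@arg_minnP _ a (fun x => x \in near_set a b rr) (prio s) aN) => c cN cmin; exists c; apply/andP; split.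
  by apply/'forall_implyP => x /cmin.
rewrite inE in cN; apply/andP; split; first by rewrite ge_min.
rewrite ltNge ge_max; apply: contraNN lab => /andP[ac bc].
rewrite (@label_eq s rr a c) // ?(@label_eq s rr b c) // => x xr; apply: cmin; rewrite inE xr ?orbT //.
Qed.

(** A point that cuts the pair precedes all points at least as close to the pair. This event no
    longer involves the radius, which allows the later sum over radii. *)
Lemma label_neq_prob rr a b : 0 <= rr ->
  \sum_s (label s rr a != label s rr b)%:R <=
  #|{perm P}|%:R * \sum_c (Num.min (d a c) (d b c) <= rr < Num.max (d a c) (d b c))%R%:R /
    #|finset (fun x => Num.min (d a x) (d b x) <= Num.min (d a c) (d b c))|%:R :> R.
Proof.
move=> r0.
pose cut c := Num.min (d a c) (d b c) <= rr < Num.max (d a c) (d b c).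
pose A c := finset (fun x => Num.min (d a x) (d b x) <= Num.min (d a c) (d b c)).
apply: (@le_trans _ _ (\sum_s \sum_c (cut c)%:R * (first s (A c) c)%:R)).
  apply: ler_sum => s _; case: eqP => [_|/eqP /(label_cut r0)[c /andP[fc cc]]].
    by apply: sumr_ge0 => c _; rewrite mulr_ge0.
  rewrite (bigD1 c) //= /cut cc mul1r (_ : first s (A c) c).
    by rewrite lerDl; apply: sumr_ge0 => x _; rewrite mulr_ge0.
  apply/'forall_implyP => x; rewrite inE => xc; apply: (implyP (forallP fc x)).
  rewrite inE; case/andP: cc => cr _; have := le_trans xc cr; by rewrite ge_min.
rewrite exchange_big /= mulr_sumr; apply: ler_sum => c _.
rewrite -mulr_sumr mulrCA; apply: ler_wpM2l => //.
by apply: first_prob; rewrite inE.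
Qed.

End RandomOrder.

(** * Sums over a geometric grid of radii *)

Section GeometricRadii.
Context {R : realType}.

Lemma sum_radix (f : nat -> R) N m : \sum_(i < m) \sum_(j < N) f (j + N * i)%N = \sum_(q < N * m) f q.
Proof.
elim: m => [|m IH]; first by rewrite muln0 !big_ord0.
rewrite big_ord_recr /= IH mulnS addnC.
rewrite -[RHS](big_mkord xpredT f) -[X in X + _](big_mkord xpredT f).
rewrite -[X in _ + X](big_mkord xpredT (fun j => f (j + N * m)%N)).
rewrite [RHS](big_cat_nat (n := (N * m)%N)) ?leq_addr //=; congr (_ + _).
by rewrite -[in RHS](add0n (N * m)%N) big_addn add0n addKn.
Qed.

(** [rho - 1] times a grid radius is the gap to the next one, so the sum telescopes, with at most
    one overshoot past [M]. *)
Lemma geometric_window (u rho nu M : R) Q : 0 < u -> 1 < rho -> 0 <= nu <= M ->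
  (rho - 1) * \sum_(q < Q) (nu <= u * rho ^+ q < M)%R%:R * (u * rho ^+ q) <= rho * M - nu.
Proof.
move=> u0 r1 /andP[nu0 nuM].
have nuM' : nu <= rho * M.
  apply: (le_trans nuM); rewrite -[leLHS]mul1r; apply: ler_wpM2r; [exact: le_trans nuM|exact: ltW].
pose G q := Num.min (Num.max (u * rho ^+ q) nu) (rho * M).
have Gb q : nu <= G q <= rho * M.
  by rewrite /G le_min le_max lexx orbT nuM' /= ge_min lexx orbT.
apply: (@le_trans _ _ (G Q - G 0%N)); last by have /andP[? _] := Gb 0%N; have /andP[_ ?] := Gb Q; lra.
elim: Q => [|q IH]; first by rewrite big_ord0 mulr0 subrr.
rewrite big_ord_recr /= mulrDr.
suff : (rho - 1) * ((nu <= u * rho ^+ q < M)%R%:R * (u * rho ^+ q)) <= G q.+1 - G q by lra.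
set z := u * rho ^+ q; have z0 : 0 < z by rewrite mulr_gt0 // exprn_gt0 // (lt_trans ltr01).
have zS : u * rho ^+ q.+1 = rho * z by rewrite exprS mulrCA.
rewrite /G zS -/z.
have zz : z <= rho * z by rewrite -[leLHS]mul1r ler_wpM2r // ltW.
case: (boolP (nu <= z < M)) => [/andP[nz zM]|_] /=.
  have h1 : rho * z <= rho * M by rewrite ler_pM2l; lra.
  rewrite mul1r (max_l nz) (@max_l _ _ (rho * z)) ?(le_trans nz zz) //.
  by rewrite (min_l (le_trans zz h1)) (min_l h1); lra.
rewrite mul0r mulr0 subr_ge0 le_min !ge_min lexx orbT andbT.
by apply/orP; left; rewrite ge_max !le_max zz lexx orbT.
Qed.

End GeometricRadii.

(** * Nested clusters from arbitrary labels *)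

Section ClustersFromLabels.
Context {R : realType} {P : finType}.
Variables (L : nat) (lam : nat -> P -> P).
Implicit Types (a b : P) (i : nat).

Definition same_from i a b : bool :=
  [forall i' : 'I_L.+1, (i <= i')%N ==> (lam i' a == lam i' b)].

(** Agreement on all higher labels forces nesting; [pick] gives the same witness for equal classes,
    hence a canonical member. *)
Definition label_cluster i a : P := odflt a [pick b | same_from i a b].

Lemma same_fromP i a b :
  reflect (forall i', (i <= i' <= L)%N -> lam i' a = lam i' b) (same_from i a b).
Proof.
apply: (iffP forallP) => [H i' /andP[ii iL]|H i'].
  by have := H (inord i'); rewrite inordK // ii => /eqP.
by apply/implyP => ii; apply/eqP/H; rewrite ii -ltnS ltn_ord.
Qed.

Lemma same_from_cluster i a : same_from i a (label_cluster i a).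
Proof.
rewrite /label_cluster; case: pickP => [//|/(_ a)].
by have -> : same_from i a a by apply/same_fromP.
Qed.

Lemma label_clusterE i a b : (label_cluster i a == label_cluster i b) = same_from i a b.
Proof.
have self := same_from_cluster i.
apply/eqP/idP => [E|ab].
  apply/same_fromP => j ij; have /same_fromP/(_ _ ij) -> := self a.
  by rewrite E; have /same_fromP/(_ _ ij) -> := self b.
have E : same_from i a =1 same_from i b.
  by move=> x; apply/same_fromP/same_fromP => H j ij; have /same_fromP/(_ _ ij) := ab; rewrite -H.
rewrite /label_cluster (eq_pick E); case: pickP => //= /(_ b).
by have -> : same_from i b b by apply/same_fromP.
Qed.

Hypothesis lam0 : forall a, lam 0 a = a.
Hypothesis lamL : forall a b, lam L a = lam L b.

Lemma label_hierarchy : hierarchy L label_cluster.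
Proof.
have self i x : label_cluster i (label_cluster i x) = label_cluster i x.
  apply/eqP; rewrite label_clusterE; apply/same_fromP => j ij.
  by have /same_fromP/(_ _ ij) := same_from_cluster i x.
split=> // [a|i a b /eqP|a b].
- have /eqP := self 0%N a; rewrite label_clusterE => /same_fromP/(_ 0%N isT).
  by rewrite !lam0.
- rewrite label_clusterE => /same_fromP H; apply/eqP; rewrite label_clusterE.
  by apply/same_fromP => j /andP[ij jL]; apply: H; rewrite (ltnW ij).
- apply/eqP; rewrite label_clusterE; apply/same_fromP => j; rewrite -eqn_leq => /eqP <-.
  exact: lamL.
Qed.

(** Differing labels at level [j] separate all levels up to [j], whose weights add up to less than 4
    * 2^j. *)
Lemma label_tdist_le a b :
  tdist L label_cluster a b <= \sum_(i < L.+1) 4 * 2 ^+ i * (lam i a != lam i b)%:R :> R.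
Proof.
apply: (@le_trans _ _ (\sum_(i < L.+1) \sum_(j < L.+1)
    (i <= j)%N%:R * (2 * 2 ^+ i) * (lam j a != lam j b)%:R)).
  have pos i j : 0 <= (i <= j)%N%:R * (2 * 2 ^+ i) * (lam j a != lam j b)%:R :> R.
    by rewrite !mulr_ge0 // exprn_ge0.
  apply: ler_sum => i _; rewrite label_clusterE.
  case: (boolP (same_from i a b)) => /= [_|]; first by rewrite !mulr0 sumr_ge0.
  rewrite negb_forall => /existsP[j]; rewrite negb_imply => /andP[ij nab].
  by rewrite (bigD1 j) //= nab ij mul1r !mulr1 mulrC lerDl sumr_ge0.
rewrite exchange_big /=; apply: ler_sum => j _; rewrite -mulr_suml; apply: ler_wpM2r => //.
have -> : \sum_(i < L.+1) (i <= j)%N%:R * (2 * 2 ^+ i) = 2 * \sum_(i < j.+1) 2 ^+ i :> R.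
  rewrite (big_ord_widen L.+1 (fun i => 2 ^+ i)) // mulr_sumr [RHS]big_mkcond /=.
  by apply: eq_bigr => i _; rewrite ltnS; case: (_ <= _)%N; rewrite ?mul1r ?mul0r.
by rewrite sum_pow2 exprS; lra.
Qed.

Lemma label_sep_level a b : a != b ->
  exists i : 'I_L.+1, [/\ (i < L)%N, label_cluster i a != label_cluster i b & lam i.+1 a = lam i.+1 b].
Proof.
move=> ab; have [c0 _ nest ctop] := label_hierarchy.
have z : label_cluster (ord0 : 'I_L.+1) a != label_cluster (ord0 : 'I_L.+1) b by rewrite !c0.
case: (@arg_maxnP _ ord0 (fun i : 'I_L.+1 => label_cluster i a != label_cluster i b)
  (fun i : 'I_L.+1 => i : nat) z) => i ni imax.
have iL : (i < L)%N.
  rewrite ltn_neqAle -ltnS ltn_ord andbT; apply: contraNneq ni => ->; apply/eqP; exact: ctop.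
exists i; split=> //.
have := imax (inord i.+1); rewrite /geq /= inordK // ltnn => /contraNN/(_ isT); rewrite negbK label_clusterE.
by move=> /same_fromP/(_ i.+1); apply; rewrite leqnn.
Qed.

End ClustersFromLabels.

(** * Random embedding into hierarchies *)

Section FRT.
Context {R : realType} {P : finType}.
Variable d : P -> P -> R.
Hypothesis d_xx : forall a, d a a = 0.
Hypothesis d_gt0 : forall a b, a != b -> 0 < d a b.
Hypothesis d_sym : forall a b, d a b = d b a.
Hypothesis d_triangle : forall a b c, d a c <= d a b + d b c.

(* [T] consists of the pairs of a random order of the points and a radius drawn
   log-uniformly from a fine geometric grid. *)
Theorem random_hierarchy :
  exists (T : finType) (L : nat) (cl : T -> nat -> P -> P) (u : R),
  [/\ (0 < #|T|)%N, 0 < u, forall t, hierarchy L (cl t),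
      forall t a b, d a b <= 4 * u * tdist L (cl t) a b &
      forall a b, u * \sum_t tdist L (cl t) a b <=
        #|T|%:R * (8 / ln 2 * (1 + ln #|P|%:R)) * d a b].
Proof.
have d_ge0 a b : 0 <= d a b.
  by have [->|/d_gt0/ltW//] := eqVneq a b; rewrite d_xx.
(* A positive lower bound on all nonzero distances; the 1 keeps it positive even without any pair of
   distinct points. *)
pose dmin : R := (1 + \sum_a \sum_b (d a b)^-1)^-1.
have dsum0 : 0 <= \sum_a \sum_b (d a b)^-1.
  by apply: sumr_ge0 => a _; apply: sumr_ge0 => b _; rewrite invr_ge0.
have dmin_gt0 : 0 < dmin by rewrite invr_gt0; lra.
have dminP a b : a != b -> dmin <= d a b.
  move=> ab; rewrite -[leRHS]invrK lef_pV2 ?posrE ?invr_gt0 ?d_gt0 //; last by lra.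
  rewrite (bigD1 a) //= (bigD1 b) //= [X in _ <= 1 + X]addrAC -addrA [1 + _]addrCA lerDl.
  have h1 : 0 <= \sum_(i | i != b) (d a i)^-1 by apply: sumr_ge0 => x _; rewrite invr_ge0.
  have h2 : 0 <= \sum_(i | i != a) \sum_b (d i b)^-1.
    by apply: sumr_ge0 => x _; apply: sumr_ge0 => y _; rewrite invr_ge0.
  by lra.
pose dmax : R := \sum_a \sum_b d a b.
have dmaxP a b : d a b <= dmax.
  rewrite /dmax (bigD1 a) //= (bigD1 b) //= -addrA lerDl addr_ge0 // sumr_ge0 // => x _.
  by apply: sumr_ge0.
have dmax_ge0 : 0 <= dmax by apply: sumr_ge0 => a _; apply: sumr_ge0.
(* Fine enough that passing to the next grid radius adds at most [dmin] to any radius up to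
   [dmax]. *)
pose N := (Num.truncn (dmax / dmin)).+1.
have NP : dmax <= N%:R * dmin.
  rewrite -ler_pdivrMr //; apply: ltW.
  by have /andP[_] := truncn_itv (divr_ge0 dmax_ge0 (ltW dmin_gt0)).
have N0 : 0 < N%:R :> R by rewrite ltr0n.
pose rho : R := expR (ln 2 / N%:R).
have ln2 : 0 < ln 2 :> R by apply: ln_gt0; rewrite ltr1n.
have rhoN : rho ^+ N = 2 by rewrite /rho -expRM_natl mulrC divfK ?gt_eqF // lnK // posrE.
have rho1 : 1 < rho by rewrite -expR0 ltr_expR divr_gt0.
have rhoU : (rho - 1) * N%:R <= 1.
  have := @bernoulli_ineq R (rho - 1) N; rewrite subr_ge0 (ltW rho1) => /(_ isT).
  by rewrite (addrC 1 (rho - 1)) subrK rhoN; lra.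
have rhoL : ln 2 <= (rho - 1) * N%:R.
  have := @ln_le_subr1 R rho (lt_trans ltr01 rho1); rewrite expRK => h.
  by rewrite -ler_pdivrMr.
have rhoM i : rho ^+ (N * i) = 2 ^+ i by rewrite exprM rhoN.
have rho_lt2 j : (j < N)%N -> rho ^+ j < 2 by move=> jN; rewrite -rhoN ltr_eXn2l.
have rho_ge1 j : 1 <= rho ^+ j by rewrite exprn_ege1 // ltW.
(* The radii of level 0 lie between [dmin / 2] and [dmin], the latter excluded, so every point is
   its own label there. *)
pose u : R := dmin / 2.
have u0 : 0 < u by rewrite divr_gt0.
pose L := (Num.truncn (dmax / u)).+1.
have LP : dmax <= u * 2 ^+ L.
  have : dmax / u < L%:R.
    by have /andP[_] := truncn_itv (divr_ge0 dmax_ge0 (ltW u0)).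
  rewrite ltr_pdivrMr // => h; apply: (le_trans (ltW h)); rewrite mulrC ler_pM2l //.
  by rewrite -natrX ler_nat ltnW // ltn_expl.
pose rad (j : 'I_N) i : R := u * rho ^+ (j + N * i).
have radE j i : rad j i = u * rho ^+ j * 2 ^+ i by rewrite /rad exprD rhoM mulrA.
have rad0 j i : 0 <= rad j i by rewrite mulr_ge0 ?ltW // exprn_gt0 // (lt_trans ltr01).
pose T : finType := ({perm P} * 'I_N)%type.
pose lam (t : T) i a := label d t.1 (rad t.2 i) a.
have lam0 t a : lam t 0%N a = a.
  apply: label_eq => // [|x xr]; first by rewrite d_xx.
  have [->//|/dminP ax] := eqVneq a x.
  have := rho_lt2 t.2 (ltn_ord _); have := le_trans ax xr.
  rewrite radE expr0 mulr1 => h1 h2; exfalso.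
  have : u * rho ^+ t.2 < u * 2 by rewrite ltr_pM2l.
  by rewrite /u divfK //; move: h1; rewrite /u; lra.
have lamL t a b : lam t L a = lam t L b.
  have radL x y : d x y <= rad t.2 L.
    apply: (le_trans (dmaxP x y)); apply: (le_trans LP); rewrite radE -mulrA ler_pM2l //.
    by rewrite -[leLHS]mul1r ler_wpM2r // exprn_ge0.
  have [h1 h2] := labelP d_xx t.1 b (rad0 t.2 L).
  by apply: label_eq => // x _; exact: h2.
pose cl t := label_cluster L (lam t).
have clH t : hierarchy L (cl t) by apply: label_hierarchy; [exact: lam0|exact: lamL].
exists T, L, cl, u; split=> //.
- by rewrite card_prod card_ord muln_gt0 andbT; apply/card_gt0P; exists 1%g.
- move=> t a b; have [->|ab] := eqVneq a b.
    by rewrite d_xx mulr_ge0 ?tdist_ge0 // mulr_ge0 // ltW.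
  have [i [iL ni li]] := label_sep_level (lam0 t) (lamL t) ab.
  have [h1 _] := labelP d_xx t.1 a (rad0 t.2 i.+1).
  have [h2 _] := labelP d_xx t.1 b (rad0 t.2 i.+1).
  have h3 := d_triangle a (lam t i.+1 a) b.
  rewrite -/(lam t i.+1 a) in h1; rewrite -/(lam t i.+1 b) -li d_sym in h2.
  have h4 : rad t.2 i.+1 <= 4 * u * 2 ^+ i.
    rewrite radE exprS; have := ltW (rho_lt2 t.2 (ltn_ord _)).
    have e2 : 0 <= 2 ^+ i :> R by exact: exprn_ge0.
    by move=> /(ler_wpM2l (ltW u0)) /(ler_wpM2r e2); lra.
  have h5 : 2 ^+ i * 2 <= tdist L (cl t) a b :> R.
    rewrite /tdist (bigD1 i) //= ni mulr1 lerDl; apply: sumr_ge0 => j _.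
    by rewrite !mulr_ge0 // exprn_ge0.
  have : 4 * u * (2 ^+ i * 2) <= 4 * u * tdist L (cl t) a b by rewrite ler_wpM2l // mulr_ge0 // ltW.
  by lra.
move=> a b; have [->|ab] := eqVneq a b.
  by rewrite big1 => [|t _]; rewrite ?tdist_xx // d_xx !mulr0.
pose nu c := Num.min (d a c) (d b c); pose mx c := Num.max (d a c) (d b c).
pose A c := finset (fun x => nu x <= nu c).
pose F : R := #|{perm P}|%:R.
have F0 : 0 <= F by [].
have s1 : u * \sum_t tdist L (cl t) a b <=
    \sum_(j < N) \sum_(i < L.+1) 4 * rad j i * \sum_s (label d s (rad j i) a != label d s (rad j i) b)%:R.
  rewrite mulr_sumr.
  apply: (@le_trans _ _ (\sum_(t : T) \sum_(i < L.+1) 4 * rad t.2 i * (lam t i a != lam t i b)%:R)).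
    apply: ler_sum => t _; apply: (le_trans (ler_wpM2l (ltW u0) (label_tdist_le _ _ _ _))).
    rewrite mulr_sumr; apply: ler_sum => i _; rewrite mulrA; apply: ler_wpM2r => //.
    rewrite mulrCA ler_wpM2l // radE -mulrA ler_wpM2l ?(ltW u0) //.
    by rewrite -[leLHS]mul1r ler_wpM2r // exprn_ge0.
  rewrite -(pair_bigA _ (fun s j => \sum_(i < L.+1) 4 * rad j i * (lam (s, j) i a != lam (s, j) i b)%:R)) /=.
  rewrite exchange_big /=; apply: ler_sum => j _; rewrite exchange_big /=; apply: ler_sum => i _.
  by rewrite mulr_sumr.
apply: (le_trans s1).
have s2 : \sum_(j < N) \sum_(i < L.+1) 4 * rad j i * \sum_s (label d s (rad j i) a != label d s (rad j i) b)%:R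
   <= 4 * F * \sum_c (#|A c|%:R)^-1 * \sum_(q < N * L.+1) (nu c <= u * rho ^+ q < mx c)%R%:R * (u * rho ^+ q).
  apply: (@le_trans _ _ (\sum_(j < N) \sum_(i < L.+1) 4 * rad j i *
      (F * \sum_c (nu c <= rad j i < mx c)%R%:R / #|A c|%:R))).
    apply: ler_sum => j _; apply: ler_sum => i _; apply: ler_wpM2l; first by rewrite mulr_ge0.
    exact: label_neq_prob.
  rewrite exchange_big /=.
  rewrite (_ : \sum_(i < L.+1) _ = 4 * F * \sum_(i < L.+1) \sum_(j < N)
      \sum_c (#|A c|%:R)^-1 * ((nu c <= rad j i < mx c)%R%:R * rad j i)); last first.
    rewrite mulr_sumr; apply: eq_bigr => i _; rewrite mulr_sumr; apply: eq_bigr => j _.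
    by rewrite !mulr_sumr; apply: eq_bigr => c _; ring.
  apply: ler_wpM2l; first by rewrite mulr_ge0.
  rewrite (eq_bigr (fun i : 'I_L.+1 => \sum_c \sum_(j < N) (#|A c|%:R)^-1 * ((nu c <= rad j i < mx c)%R%:R * rad j i))).
    rewrite exchange_big /=; apply: ler_sum => c _; rewrite -(sum_radix (fun q => (nu c <= u * rho ^+ q < mx c)%R%:R * (u * rho ^+ q))).
    by rewrite mulr_sumr; apply: ler_sum => i _; rewrite mulr_sumr.
  by move=> i _; rewrite exchange_big.
apply: (le_trans s2).
have dab0 := d_gt0 ab.
(* The width of the window is at most [d a b] by the triangle inequality, and the overshoot of the
   grid at most as much again. *)
have s3 c : \sum_(q < N * L.+1) (nu c <= u * rho ^+ q < mx c)%R%:R * (u * rho ^+ q) <= N%:R * (2 * d a b / ln 2).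
  have nm : 0 <= nu c <= mx c by rewrite /nu /mx le_min !d_ge0 /= ge_min !le_max lexx.
  have := geometric_window (N * L.+1)%N u0 rho1 nm; set Z := \sum_(q < _) _ => h.
  have Z0 : 0 <= Z by apply: sumr_ge0 => q _; rewrite mulr_ge0 // mulr_ge0 ?(ltW u0) // (le_trans ler01 (rho_ge1 q)).
  have m1 : mx c <= dmax by rewrite /mx ge_max !dmaxP.
  have m2 : mx c - nu c <= d a b.
    have t1 := d_triangle a b c; have t2 := d_triangle b a c; rewrite [d b a]d_sym in t2.
    by rewrite /mx /nu; case: (lerP (d a c) (d b c)) => _; lra.
  have m3 : (rho - 1) * mx c <= d a b.
    apply: le_trans (dminP a b ab); apply: (@le_trans _ _ ((rho - 1) * (N%:R * dmin))).
      by rewrite ler_wpM2l ?(le_trans m1) // subr_ge0 ltW.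
    by rewrite mulrA -[leRHS]mul1r ler_wpM2r // ltW.
  have h' : (rho - 1) * Z <= 2 * d a b by lra.
  rewrite mulrA ler_pdivlMr //.
  apply: (@le_trans _ _ (Z * ((rho - 1) * N%:R))); first by rewrite ler_wpM2l.
  by have := ler_wpM2l (ltW N0) h'; lra.
have s4 : \sum_c (#|A c|%:R)^-1 <= 1 + ln #|P|%:R :> R.
  have P0 : (0 < #|P|)%N by apply/card_gt0P; exists a.
  apply: le_trans (harmonic_le_ln P0).
  have := rank_sum_le nu [set: P]%SET; rewrite cardsT; congr (_ <= _).
  rewrite (eq_bigl xpredT) => [|c]; last by rewrite inE.
  by apply: eq_bigr => c _; congr (_%:R^-1); apply: eq_card => x; rewrite !inE.
have s5 : \sum_c (#|A c|%:R)^-1 * \sum_(q < N * L.+1) (nu c <= u * rho ^+ q < mx c)%R%:R * (u * rho ^+ q) <=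
    (1 + ln #|P|%:R) * (N%:R * (2 * d a b / ln 2)).
  apply: (@le_trans _ _ (\sum_c (#|A c|%:R)^-1 * (N%:R * (2 * d a b / ln 2)))).
    by apply: ler_sum => c _; apply: ler_wpM2l; rewrite ?invr_ge0.
  rewrite -mulr_suml; apply: ler_wpM2r => //.
  by rewrite mulr_ge0 // divr_ge0 ?(ltW ln2) // mulr_ge0.
(* The constant 8 / ln 2 is 4 from [label_tdist_le] times 2 / ln 2 from the radii. *)
apply: (le_trans (ler_wpM2l (mulr_ge0 (ler0n _ 4) F0) s5)).
rewrite card_prod card_ord natrM -/F.
rewrite (_ : 4 * F * _ = F * N%:R * (8 / ln 2 * (1 + ln #|P|%:R)) * d a b) //.
by field; rewrite gt_eqF.
Qed.

End FRT.

(** * Splitting sets under the uniform law *)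

Section AtomlessSplitting.
Context {R : realType}.

Definition unit_prob : probability _ R := uniform_prob (@ltr01 R).

Local Notation U := unit_prob.
Local Notation Om := (measurableTypeR R).
Implicit Types A B : set Om.

Lemma unit_prob_itv_le (s t : R) : s <= t -> (U `]s, t]%classic <= (t - s)%:E)%E.
Proof.
move=> st; rewrite /unit_prob /= /uniform_prob.
apply: (@le_trans _ _ (\int[lebesgue_measure]_(x in `]s, t]%classic) (cst 1%E x))%E).
  apply: ge0_le_integral => //=.
  - by move=> x _; rewrite lee_fin uniform_pdf_ge0.
  - apply/measurable_EFinP; apply: measurable_funTS; exact: measurable_uniform_pdf.
  - by move=> x _; rewrite lee_fin /uniform_pdf subr0 invr1; case: ifP.
rewrite integral_cst //= mul1e lebesgue_measure_itv /=.
by case: ifP => // _; rewrite lee_fin subr_ge0.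
Qed.

Lemma unit_prob_out A : measurable A -> A `&` `[0, 1]%classic = set0 -> U A = 0%E.
Proof.
by move=> mA A0; rewrite /unit_prob /= /uniform_prob integral_uniform_pdf A0 integral_set0.
Qed.

Lemma unit_prob_fin A : measurable A -> (U A)%E \is a fin_num.
Proof. by move=> mA; exact: fin_num_measure. Qed.

(* The measure of [A `&` ]-oo, t]] is a continuous function of [t]. *)
Lemma unit_prob_split A (p : R) : measurable A -> 0 <= p -> (p%:E <= U A)%E ->
  exists B, [/\ measurable B, B `<=` A & U B = p%:E].
Proof.
move=> mA p0 pA.
pose H (t : R) := A `&` `]-oo, t]%classic.
have mH t : measurable (H t) by apply: measurableI.
pose F t := fine (U (H t)).
have FE t : U (H t) = (F t)%:E by rewrite fineK // unit_prob_fin.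
have Finc s t : s <= t -> F s <= F t <= F s + (t - s).
  move=> st; apply/andP; split.
    rewrite -lee_fin -!FE; apply: le_measure; rewrite ?inE // => x [Ax]; rewrite /= !in_itv /= => xs.
    by split=> //=; rewrite in_itv /= (le_trans xs).
  have -> : F s + (t - s) = fine ((F s)%:E + (t - s)%:E)%E by [].
  rewrite -lee_fin EFinD -!FE.
  apply: (@le_trans _ _ (U (H s `|` `]s, t]%classic))).
    apply: le_measure; rewrite ?inE //; first exact: measurableU.
    move=> x [Ax]; rewrite /= in_itv /= => xt; case: (lerP x s) => xs.
      by left; split=> //=; rewrite in_itv.
    by right; rewrite /= in_itv /= xs.
  apply: (le_trans (measureU2 _ _ _)) => //.
  by apply: leeD => //; exact: unit_prob_itv_le.
have F0 : F (-1) = 0.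
  apply/eqP; rewrite -eqe -FE; apply/eqP; apply: unit_prob_out => //.
  apply/seteqP; split => x //= [[_]]; rewrite /= !in_itv /= => x1 /andP[x0 _]; lra.
have F1 : (F 1)%:E = U A.
  rewrite -FE -[in RHS](setIT A) -(setUv `]-oo, (1:R)]%classic) setIUr measureU //.
  - rewrite [X in (_ + X)%E](_ : _ = 0%E) ?adde0 //; apply: unit_prob_out.
      by apply: measurableI => //; exact: measurableC.
    apply/seteqP; split => x //= [[_]]; rewrite /= !in_itv /= => x1 /andP[_ x2]; exact: x1.
  - exact: mH.
  - by apply: measurableI => //; exact: measurableC.
  - by rewrite setIACA setICr setI0.
have cF : continuous F.
  move=> x; apply/cvgrPdist_le => e e0; near=> y.
  have xy : `|x - y| <= e by near: y; apply: cvgr_dist_le => //; exact: cvg_id.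
  apply: le_trans xy; case: (lerP x y) => xy.
    by have /andP[h1 h2] := Finc _ _ xy; rewrite ler0_norm ?subr_le0 //; lra.
  have /andP[h1 h2] := Finc _ _ (ltW xy).
  by rewrite ger0_norm ?subr_ge0 //; lra.
have [|||c _ Fc] := @IVT R F (-1) 1 p.
- by lra.
- exact: continuous_subspaceT.
- have pF : p <= F 1 by rewrite -lee_fin F1.
  by rewrite F0 ge_min p0 le_max pF orbT.
exists (H c); split=> //; first by move=> x [].
by rewrite FE Fc.
Unshelve. all: by end_near. Qed.

(** Values are carved out of [A] one at a time and the last takes the whole remainder, so [g] stays
    in the list on all of [A], not just almost surely. *)
Lemma unit_prob_partition (Y : choiceType) (y0 : Y) (ys : seq Y) (p : Y -> R) A :
  uniq (y0 :: ys) -> (forall y, 0 <= p y) -> measurable A ->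
  U A = (\sum_(y <- y0 :: ys) p y)%:E ->
  exists g : Om -> Y, [/\ forall x, A x -> g x \in y0 :: ys,
    forall y, measurable (A `&` [set x | g x = y]) &
    forall y, y \in y0 :: ys -> U (A `&` [set x | g x = y]) = (p y)%:E].
Proof.
elim: ys y0 A => [|y1 ys IH] y0 A uy p0 mA UA.
  exists (fun=> y0); split=> [x _|y|y].
  - by rewrite mem_seq1.
  - have [->|ny] := eqVneq y y0.
      by rewrite (_ : [set x | y0 = y0] = setT) ?setIT //; apply/seteqP; split.
    rewrite (_ : [set x | y0 = y] = set0) ?setI0 //; apply/seteqP; split => // x /= yy.
    by rewrite yy eqxx in ny.
  - rewrite mem_seq1 => /eqP ->; rewrite (_ : [set x | y0 = y0] = setT) ?setIT.
      by rewrite UA big_seq1.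
    by apply/seteqP; split.
move: uy; rewrite cons_uniq => /andP[y0n uy].
have rest0 : 0 <= \sum_(y <- y1 :: ys) p y by apply: sumr_ge0.
have [|B [mB BA UB]] := @unit_prob_split A (p y0) mA (p0 y0).
  by rewrite UA big_cons lee_fin lerDl.
have mAB : measurable (A `\` B) by exact: measurableD.
have [|g [g1 g2 g3]] := IH y1 (A `\` B) uy p0 mAB.
  have E : U (A `\` B) = (U A - U (A `&` B))%E.
    by apply: measureD => //; rewrite ltey_eq unit_prob_fin.
  rewrite E (setIidr BA) UA UB big_cons -EFinB.
  by rewrite addrAC subrr add0r.
pose G x := if pselect (B x) then y0 else g x.
have GB y : A `&` [set x | G x = y] = if y == y0 then B else (A `\` B) `&` [set x | g x = y].
  case: eqP => [->|/eqP yy0]; apply/seteqP; split => x /=.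
  - rewrite /G; case: pselect => //= nB [Ax gx].
    by have := g1 x (conj Ax nB); rewrite gx (negbTE y0n).
  - by move=> Bx; split; [exact: BA|rewrite /G; case: pselect].
  - by rewrite /G; case: pselect => /= [Bx [_ yE]|nB [Ax gx]]; [rewrite yE eqxx in yy0|].
  - by rewrite /G => -[[Ax nB] gx]; split=> //; case: pselect.
exists G; split=> [x Ax|y|y].
- rewrite /G in_cons; case: pselect => [Bx|nB] /=; first by rewrite eqxx.
  by rewrite (g1 x (conj Ax nB)) orbT.
- by rewrite GB; case: eqP => // _; exact: g2.
- rewrite GB in_cons; case: eqP => [->//|_] /=; exact: g3.
Qed.

End AtomlessSplitting.

(** * Realising transition laws on one probability space *)

Section Realisation.
Context {R : realType} {M : Type} {X : finType}.
Local Notation U := (@unit_prob R).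
Local Notation Om := (measurableTypeR R).
Implicit Types (f g : Om -> X) (mu : X -> R).

Definition fibers f := forall x, measurable [set w | f w = x].

Definition has_law f mu := forall x, U [set w | f w = x] = (mu x)%:E.

Lemma fibers_union f (A : set Om) : A = \bigcup_(x in [set: X]) (A `&` [set w | f w = x]).
Proof. by apply/seteqP; split => w; [move=> Aw; exists (f w)|case=> x _ []]. Qed.

Lemma prob_fibers f (A : set Om) : fibers f -> measurable A ->
  U A = (\sum_(x : X) U (A `&` [set w | f w = x]))%E.
Proof.
move=> mf mA; rewrite {1}(fibers_union f A) measure_fin_bigcup //.
- rewrite [RHS]fsbig_seq ?index_enum_uniq //; apply: eq_fsbigl.
  by apply/seteqP; split => x //= _; rewrite mem_index_enum.
- exact: finite_finset.
- apply/trivIsetP => x y _ _ xy; apply/seteqP; split => w //= [[_ fx] [_ fy]].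
  by move: xy; rewrite -fx -fy eqxx.
- by move=> x _; apply: measurableI.
Qed.

(** Each fibre of [f] is split according to [pi]. The values are [good] surely, since a policy has
    to serve the requests for every outcome. *)
Lemma extend_law f mu (pi : X -> X -> R) (good : pred X) :
  fibers f -> has_law f mu -> (forall x y, 0 <= pi x y) -> (forall x, \sum_y pi x y = mu x) ->
  (forall x y, ~~ good y -> pi x y = 0) -> (exists y, good y) ->
  exists g, [/\ fibers g, forall w, good (g w),
    forall x y, U ([set w | f w = x] `&` [set w | g w = y]) = (pi x y)%:E &
    has_law g (fun y => \sum_x pi x y)].
Proof.
move=> mf lf pi0 pis pig [y0 gy0].
have uE : uniq (enum good) by exact: enum_uniq.
have [y1 [ys eE]] : exists y1 ys, enum good = y1 :: ys.
  have : y0 \in enum good by rewrite mem_enum.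
  by case: (enum good) => // y1 ys _; exists y1, ys.
have ex x : exists g : Om -> X, [/\ forall w, f w = x -> good (g w),
    forall y, measurable ([set w | f w = x] `&` [set w | g w = y]) &
    forall y, good y -> U ([set w | f w = x] `&` [set w | g w = y]) = (pi x y)%:E].
  have [||||g [g1 g2 g3]] := @unit_prob_partition R X y1 ys (pi x) [set w | f w = x].
  - by rewrite -eE.
  - exact: pi0.
  - exact: mf.
  - rewrite lf -pis -eE big_enum /= [in LHS](bigID good) /= [X in _ + X]big1 ?addr0 // => y.
    exact: pig.
  exists g; split=> // [w fw|y gy]; first by have := g1 w fw; rewrite -eE mem_enum.
  by apply: g3; rewrite -eE mem_enum.
have [G GP] := choice ex.
pose g w := G (f w) w.
have gE x y : [set w | f w = x] `&` [set w | g w = y] = [set w | f w = x] `&` [set w | G x w = y].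
  by apply/seteqP; split => w [/= fx]; rewrite /g fx.
have good_g w : good (g w) by have [h _ _] := GP (f w); exact: h.
have mg : fibers g.
  move=> y; rewrite (fibers_union f [set w | g w = y]); apply: fin_bigcup_measurable => // x _.
  by rewrite setIC gE; have [_ h _] := GP x; exact: h.
have joint x y : U ([set w | f w = x] `&` [set w | g w = y]) = (pi x y)%:E.
  case: (boolP (good y)) => gy; first by rewrite gE; have [_ _ h] := GP x; exact: h.
  rewrite pig // (_ : _ `&` _ = set0) ?measure0 //; apply/seteqP; split => w //= [_ gw].
  by move: (good_g w); rewrite gw (negbTE gy).
exists g; split=> // y; rewrite (prob_fibers mf (mg y)) -sumEFin; apply: eq_bigr => x _.
by rewrite setIC joint.
Qed.

(** One outcome must serve all request sequences at once: the process is built along the tree of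
    histories, and all continuations of [s] extend the same [f s]. *)
Theorem realise_process (mu : seq M -> X -> R) (pi : seq M -> M -> X -> X -> R)
    (good0 : pred X) (good : M -> pred X) :
  is_law (mu [::]) -> (forall x, ~~ good0 x -> mu [::] x = 0) ->
  (forall s r x y, 0 <= pi s r x y) -> (forall s r x, \sum_y pi s r x y = mu s x) ->
  (forall s r y, \sum_x pi s r x y = mu (rcons s r) y) ->
  (forall s r x y, ~~ good r y -> pi s r x y = 0) -> (forall r, exists y, good r y) ->
  exists f : seq M -> Om -> X, [/\ forall s, fibers (f s), forall w, good0 (f [::] w),
    forall s r w, good r (f (rcons s r) w) &
    forall s r x y, U ([set w | f s w = x] `&` [set w | f (rcons s r) w = y]) = (pi s r x y)%:E].
Proof.
move=> [mu0 mu1] mug pi0 pis pit pig exg.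
have exg0 : exists y, good0 y.
  apply/existsP; apply: contraT => /existsPn h.
  by move: mu1; rewrite big1 => [/eqP|x _]; [rewrite eq_sym oner_eq0|exact: mug].
have [f0 [mf0 gf0 _ lf0]] : exists g, [/\ fibers g, forall w, good0 (g w),
    forall x y : X, True & has_law g (mu [::])].
  have [x0 gx0] := exg0.
  have [||||||g [g1 g2 _ g4]] :=
    @extend_law (fun=> x0) (fun x => (x == x0)%:R) (fun x y => (x == x0)%:R * mu [::] y) good0.
  - move=> x; have [->|xx0] := eqVneq x x0.
      by rewrite (_ : [set _ | _] = setT) //; apply/seteqP; split.
    rewrite (_ : [set _ | _] = set0) //; apply/seteqP; split => // w /= h.
    by rewrite h eqxx in xx0.
  - move=> x; have [->|xx0] := eqVneq x x0.
      by rewrite (_ : [set _ | _] = setT) ?probability_setT //; apply/seteqP; split.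
    rewrite (_ : [set _ | _] = set0) ?measure0 //; apply/seteqP; split => // w /= h.
    by rewrite h eqxx in xx0.
  - by move=> x y; rewrite mulr_ge0.
  - by move=> x; rewrite -mulr_sumr mu1 mulr1.
  - by move=> x y gy; rewrite mug // mulr0.
  - exact: exg0.
  exists g; split=> // y; rewrite g4; congr (_%:E).
  by rewrite -mulr_suml (bigD1 x0) //= eqxx big1 ?addr0 ?mul1r // => x /negbTE ->.
pose Pr s f := fibers f /\ has_law f (mu s).
have ex (a : seq M * M * (Om -> X)) : exists g, Pr a.1.1 a.2 ->
    [/\ Pr (rcons a.1.1 a.1.2) g, forall w, good a.1.2 (g w) &
    forall x y, U ([set w | a.2 w = x] `&` [set w | g w = y]) = (pi a.1.1 a.1.2 x y)%:E].
  case: a => [[s r] f] /=; have [[mf lf]|nP] := pselect (Pr s f); last by exists f.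
  have [g [g1 g2 g3 g4]] := extend_law mf lf (pi0 s r) (pis s r) (pig s r) (exg r).
  exists g => _; split=> //; split=> // y; by rewrite g4 pit.
have [S SP] := choice ex.
(* Histories are reversed, so that appending a request is a step of structural recursion. *)
pose frec := fix frec (l : seq M) : Om -> X := if l is r :: l' then S (rev l', r, frec l') else f0.
have frecP l : Pr (rev l) (frec l).
  by elim: l => [|r l IH] /=; [split|rewrite rev_cons; have [] := SP (rev l, r, frec l) IH].
pose f s := frec (rev s).
have fP s : Pr s (f s) by have := frecP (rev s); rewrite revK.
have fS s r : f (rcons s r) = S (s, r, f s) by rewrite /f rev_rcons /= revK.
exists f; split=> [s|//|s r w|s r x y].
- by case: (fP s).
- by rewrite fS; have [_ h _] := SP (s, r, f s) (fP s); exact: h.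
- by rewrite fS; have [_ _ h] := SP (s, r, f s) (fP s); exact: h.
Qed.

Lemma expectation_indic_sum (I : Type) (ts : seq I) (c : I -> R) (A : I -> set Om) :
  (forall i, 0 <= c i) -> (forall i, measurable (A i)) ->
  ('E_U[fun w => (\sum_(i <- ts) c i * \1_(A i) w)%R] = \sum_(i <- ts) (c i)%:E * U (A i))%E.
Proof.
move=> c0 mA; rewrite unlock.
under eq_integral do rewrite -sumEFin.
under eq_integral do under eq_bigr do rewrite EFinM.
have mI i : measurable_fun [set: Om] (fun w => (\1_(A i) w : R)%:E).
  by apply/measurable_EFinP; exact: measurable_indic.
rewrite ge0_integral_sum //.
- apply: eq_bigr => i _; rewrite ge0_integralZl //.
  + by rewrite integral_indic // setIT.
  + by rewrite lee_fin.
- by move=> i; apply: measurable_funeM.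
- by move=> i w _; rewrite mule_ge0 ?lee_fin.
Qed.

Lemma expectation_transitions (ts : seq nat) (F G : nat -> Om -> X) (q : nat -> X -> X -> R)
    (phi : X -> X -> R) :
  (forall x y, 0 <= phi x y) ->
  (forall t, fibers (F t)) -> (forall t, fibers (G t)) ->
  (forall t x y, U ([set w | F t w = x] `&` [set w | G t w = y]) = (q t x y)%:E) ->
  ('E_U[fun w => (\sum_(t <- ts) phi (F t w) (G t w))%R] =
   (\sum_(t <- ts) \sum_x \sum_y phi x y * q t x y)%R%:E)%E.
Proof.
move=> phi0 mF mG joint.
pose A (i : nat * (X * X)) := [set w | F i.1 w = i.2.1] `&` [set w | G i.1 w = i.2.2].
pose c (i : nat * (X * X)) := phi i.2.1 i.2.2.
pose L := [seq (t, p) | t <- ts, p <- index_enum (X * X)%type].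
have -> : (fun w => \sum_(t <- ts) phi (F t w) (G t w)) = (fun w => \sum_(i <- L) c i * \1_(A i) w).
  apply/funext => w; rewrite big_allpairs_dep /=; apply: eq_bigr => t _.
  rewrite (bigD1 (F t w, G t w)) //= big1 ?addr0 => [|[x y] xy].
    by rewrite indicE mem_set ?mulr1.
  rewrite indicE memNset ?mulr0 // => -[/= fx gy].
  by move: xy; rewrite /c /= -fx -gy eqxx.
rewrite expectation_indic_sum.
- rewrite -sumEFin big_allpairs_dep /=; apply: eq_bigr => t _.
  rewrite pair_bigA /= -sumEFin; apply: eq_bigr => p _.
  by rewrite /A /= joint -EFinM.
- by move=> i; exact: phi0.
- by move=> i; apply: measurableI; [exact: mF|exact: mG].
Qed.

End Realisation.

(** * The online algorithm for a fixed hierarchy *)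

Section TreeAlgorithm.
Context {R : realType} {P : finType}.
Variables (L : nat) (cl : nat -> P -> P) (r0 : P) (k : nat).
Hypothesis clH : hierarchy L cl.
Hypothesis k_gt0 : (0 < k)%N.
Local Notation conf := {ffun 'I_k -> P}.
Local Notation root := (root L cl r0).
Local Notation par := (par L cl).
Local Notation below := (below L cl).
Local Notation level := (level L cl).
Local Notation edge := (edge L cl : P -> R).
Local Notation del := (margin k : R).
Local Notation X := (P * 'I_k -> R).
Implicit Types (l : conf) (s : seq P) (r : P).

Definition subtree_load l v : nat := \sum_(j < k) below v (l j).

Lemma subtree_load_le l v : (subtree_load l v <= k)%N.
Proof. by rewrite -[leqRHS]card_ord -sum1_card; apply: leq_sum => j _; exact: leq_b1. Qed.

Lemma subtree_load_root l : subtree_load l root = k.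
Proof.
by rewrite /subtree_load (eq_bigr (fun=> 1%N)) ?sum1_card ?card_ord // => j _; rewrite below_root.
Qed.

Lemma subtree_load_child l u :
  (\sum_(c | child root par u c) subtree_load l c + load l u = subtree_load l u)%N.
Proof.
by rewrite /subtree_load exchange_big /= -big_split /=; apply: eq_bigr => j _; rewrite below_child.
Qed.

Definition occupies r l : bool := [exists j, l j == r].

Lemma occupies_load r l : occupies r l = (0 < load l r)%N.
Proof.
rewrite lt0n sum_nat_eq0 negb_forall; apply: eq_existsb => j.
by case: eqP.
Qed.

Definition anti l : X := count_point (subtree_load l).

Lemma anti_feasible r l : occupies r l -> antiserver root par r 0 (anti l).
Proof.
rewrite occupies_load => lr; apply: antiserver_counts.
- exact: k_gt0.
- exact: subtree_load_le.
- exact: subtree_load_root.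
by move=> u; rewrite -[leqRHS]subtree_load_child leq_add2l; case: eqP => // ->.
Qed.

Lemma anti_root l j : anti l (root, j) = 0.
Proof. by rewrite /anti /count_point /= subtree_load_root leqNgt ltn_ord. Qed.

Lemma mass_anti l u : mass root par (anti l) u = (load l u)%:R.
Proof.
rewrite /mass quota_counts ?subtree_load_le //.
under eq_bigr do rewrite quota_counts ?subtree_load_le //.
by rewrite -natr_sum -(subtree_load_child l u) natrD; ring.
Qed.

Lemma tree_move_le l l' :
  \sum_v edge v * `|(subtree_load l' v)%:R - (subtree_load l v)%:R| <=
  4 * \sum_(j < k) tdist L cl (l j) (l' j).
Proof.
apply: (@le_trans _ _ (\sum_(j < k) \sum_v edge v * (below v (l j) != below v (l' j))%:R)).
  rewrite exchange_big /=; apply: ler_sum => v _; rewrite -mulr_sumr.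
  apply: ler_wpM2l; first exact/ltW/edge_gt0.
  rewrite /subtree_load !natr_sum -sumrB; apply: le_trans (ler_norm_sum _ _ _) _.
  apply: ler_sum => j _; case: (below v (l j)); case: (below v (l' j));
    by rewrite /= ?subrr ?subr0 ?sub0r ?normrN ?normr0 ?normr1.
by rewrite mulr_sumr; apply: ler_sum => j _; exact: below_dist.
Qed.

Definition tree_proj r (a b : X) : Prop := is_projection root par edge del r a b.

Lemma tree_proj_exists r a : in_box a -> exists b, tree_proj r a b.
Proof.
move=> ab; apply: projection_exists => //; first exact: margin_gt0.
exists (anti [ffun=> r]); last exact: count_point_box.
by apply: anti_feasible; apply/existsP; exists (Ordinal k_gt0); rewrite ffunE.
Qed.

(** Arranged so that the online cost of a request is at most the drop of [psi] once the offline
    solution has moved. *)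
Definition psi (x y : X) : R :=
  4 * (@depth P)%:R * divergence edge del y x - potential level edge x.

Lemma psi_step r a b l : in_box a -> (forall j, a (root, j) = 0) -> tree_proj r a b ->
  occupies r l -> \sum_p edge p.1 * `|b p - a p| <= psi a (anti l) - psi b (anti l).
Proof.
move=> ab ar bP rl.
have := @projection_step R P k root par level (@depth P) edge del (margin_gt0 k) (edge_gt0 L cl)
  (level_root r0 clH) (level_par clH) (level_le L cl) r a b (anti l) ab ar bP (anti_feasible rl).
by rewrite /psi; lra.
Qed.

(** The 16 is the 4 in [psi] times the 4 lost between the heavy tree and [tdist]. *)
Lemma psi_move x l l' : in_box x ->
  psi x (anti l') <= psi x (anti l) +
  16 * (@depth P)%:R * log_range del * \sum_(j < k) tdist L cl (l j) (l' j).
Proof.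
move=> xb; have w0 v : 0 <= edge v by exact/ltW/edge_gt0.
have := divergence_count_lip k_gt0 w0 xb (subtree_load_le l) (subtree_load_le l').
have LR0 : 0 <= log_range del := log_range_ge0 (margin_gt0 k).
move=> h; have := le_trans h (ler_wpM2l LR0 (tree_move_le l l')).
have D0 : 0 <= 4 * (@depth P)%:R :> R by rewrite mulr_ge0.
by move=> /(ler_wpM2l D0); rewrite /psi /anti; lra.
Qed.

Definition psi_bound : R := \sum_(p : P * 'I_k) edge p.1 * (2 * (level p.1)%:R + 1).

Lemma psi_lower x y : in_box x -> (forall p, 0 <= y p) -> - psi_bound <= psi x y.
Proof.
move=> xb y0; have w0 v : 0 <= edge v by exact/ltW/edge_gt0.
have dv : 0 <= divergence edge del y x.
  by apply: divergence_ge0 => // [|v|p]; [exact: margin_gt0|exact: edge_gt0|case/andP: (xb p)].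
have D0 : 0 <= 4 * (@depth P)%:R * divergence edge del y x by rewrite !mulr_ge0.
have : potential level edge x <= psi_bound.
  apply: ler_sum => p _; apply: ler_wpM2l => //; have /andP[x0 x1] := xb p.
  have l0 : 0 <= (level p.1)%:R :> R by [].
  nra.
by rewrite /psi; lra.
Qed.

Lemma psi_upper l : psi (anti l) (anti l) <= psi_bound.
Proof.
have w0 v : 0 <= edge v by exact/ltW/edge_gt0.
have xb := @count_point_box R P k (subtree_load l).
have -> : psi (anti l) (anti l) = - potential level edge (anti l).
  rewrite /psi (_ : divergence _ _ _ _ = 0) ?mulr0 ?sub0r // /divergence big1 // => p _.
  have /andP[x0 _] := xb p.
  by rewrite /breg /anti lgapxx ?margin_gt0 // mulr0 subrr subr0 mulr0.
rewrite /potential -sumrN; apply: ler_sum => p _; rewrite -mulrN; apply: ler_wpM2l => //.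
have /andP[x0 x1] := xb p; have l0 : 0 <= (level p.1)%:R :> R by [].
by rewrite -/(anti l) in x0 x1; rewrite -/(anti l) in xb; nra.
Qed.

(** A change of the quota of [v] shifts mass between [v] and [par v], at cost at most [edge v]; the
    3 comes from [quota_lip]. *)
Lemma tnorm_mass (x y : X) : (forall j, x (root, j) = 0) -> (forall j, y (root, j) = 0) ->
  tnorm L cl (fun a => mass root par x a - mass root par y a) <=
  3 * \sum_p edge p.1 * `|y p - x p|.
Proof.
move=> xr yr.
apply: (@le_trans _ _ (\sum_(v | v != root) `|quota x v - quota y v| * tdist L cl v (par v))).
  rewrite /tnorm.
  apply: (@le_trans _ _ (\sum_(i < L.+1) \sum_c \sum_(v | v != root)
      `|quota x v - quota y v| * (2 ^+ i * ((cl i v == c) != (cl i (par v) == c))%:R))).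
    apply: ler_sum => i _; apply: ler_sum => c _; rewrite cmassB.
    have e0 : 0 <= 2 ^+ i :> R by rewrite exprn_ge0.
    have h := mass_cluster_lip par k_gt0 (fun a => cl i a == c) xr yr.
    apply: le_trans (ler_wpM2l e0 h) _.
    by rewrite mulr_sumr; apply: ler_sum => v _; rewrite mulrCA.
  rewrite (eq_bigr _ (fun i _ => exchange_big _ _ _ _ _ _)) /= exchange_big /=.
  apply: ler_sum => v _; rewrite /tdist mulr_sumr; apply: ler_sum => i _.
  rewrite -mulr_sumr; apply: ler_wpM2l => //; rewrite -mulr_sumr ler_wpM2l ?exprn_ge0 //.
  rewrite -natr_sum -[2 * _]natrM ler_nat.
  have [->|ne] := eqVneq (cl i v) (cl i (par v)).
    by rewrite big1 // => c _; rewrite eqxx.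
  apply: (@leq_trans (\sum_c ((cl i v == c) + (cl i (par v) == c)))).
    by apply: leq_sum => c _; case: (_ == c); case: (_ == c).
  have one z : (\sum_c (z == c) = 1)%N.
    by rewrite (bigD1 z) //= eqxx big1 // => c; rewrite eq_sym => /negbTE ->.
  by rewrite big_split /= !one.
apply: (@le_trans _ _ (\sum_v edge v * (3 * \sum_(j < k) `|y (v, j) - x (v, j)|))).
  rewrite big_mkcond /=; apply: ler_sum => v _.
  have pos : 0 <= \sum_(j < k) `|y (v, j) - x (v, j)| by apply: sumr_ge0.
  have e0 : 0 <= edge v by exact/ltW/edge_gt0.
  case: ifP => [vr|_]; last by rewrite !mulr_ge0.
  rewrite mulrC; apply: ler_pM => //; first exact: tdist_ge0.
    exact: (tdist_par clH vr).
  rewrite distrC; exact: quota_lip.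
have -> : \sum_p edge p.1 * `|y p - x p| = \sum_v \sum_(j < k) edge v * `|y (v, j) - x (v, j)|.
  by rewrite pair_bigA /=; apply: eq_bigr => -[].
rewrite mulr_sumr.
by apply: ler_sum => v _; rewrite !mulr_sumr; apply: ler_sum => j _; rewrite mulrCA.
Qed.

Variable l0 : conf.

Definition dirac_law l : R := (l == l0)%:R.

Lemma balanced_dirac : balanced L cl (fun a => (load l0 a)%:R) dirac_law.
Proof.
split=> [|i c l iL|i c iL].
- split=> [l|]; first exact: ler0n.
  by have := sum_delta l0 (fun=> 1 : R); under eq_bigr do rewrite mulr1.
- rewrite /dirac_law; case: eqP => [-> _|_]; last by rewrite ltxx.
  by rewrite cmass_load natrK leqnn leqnSn.
- by rewrite (sum_delta l0 (fun l => (cload cl l i c)%:R)) cmass_load.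
Qed.

Fixpoint schedule_tcost l (S : seq conf) : R :=
  if S is l' :: S' then \sum_(j < k) tdist L cl (l j) (l' j) + schedule_tcost l' S' else 0.

(** Rounding costs a factor 9 and the quotas a factor 3, so a step is paid by 27 times the drop of
    [psi]; 432 is 27 * 16. *)
Theorem tree_algorithm :
  exists (mu : seq P -> conf -> R) (pi : seq P -> P -> conf -> conf -> R) (b : R),
  [/\ mu [::] = dirac_law,
      forall s r l l', 0 <= pi s r l l' /\ (~~ occupies r l' -> pi s r l l' = 0),
      forall s r l, \sum_l' pi s r l l' = mu s l,
      forall s r l', \sum_l pi s r l l' = mu (rcons s r) l' &
      forall x0 rho S, all2 occupies rho S ->
      \sum_(t <- iota 0 (size rho)) \sum_l \sum_l'
        pi (take t rho) (nth x0 rho t) l l' * (\sum_(j < k) tdist L cl (l j) (l' j)) <=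
      432 * (@depth P)%:R * log_range del * schedule_tcost l0 S + b].
Proof.
have exproj (a : P * X) : exists b, in_box a.2 -> tree_proj a.1 a.2 b.
  have [ab|nb] := pselect (in_box a.2); last by exists a.2.
  by have [b bP] := tree_proj_exists a.1 ab; exists b.
have [pj pjP] := choice exproj.
pose xs s := foldl (fun a r => pj (r, a)) (anti l0) s.
have xsS s r : xs (rcons s r) = pj (r, xs s) by rewrite /xs -cats1 foldl_cat.
have xsB s : in_box (xs s) /\ forall j, xs s (root, j) = 0.
  elim/last_ind: s => [|s r [IH1 IH2]].
    by split=> [|j]; [exact: count_point_box|exact: anti_root].
  by rewrite xsS; have [[_ br _] bb _] := pjP (r, xs s) IH1.
have xsP s r : tree_proj r (xs s) (xs (rcons s r)).
  by rewrite xsS; apply: (pjP (r, xs s)); case: (xsB s).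
pose m s a := mass root par (xs s) a.
have m_ge s r a : (a == r)%:R <= m (rcons s r) a.
  by have [bK bb _] := xsP s r; apply: mass_ge.
have m0 s a : 0 <= m s a.
  case/lastP: s => [|s r]; first by rewrite /m /xs /= mass_anti.
  by apply: le_trans (m_ge s r a).
have mk s : \sum_a m s a = k%:R.
  by rewrite sum_mass quota_root //; case: (xsB s).
have exr (a : seq P * P * (conf -> R)) : exists pi : conf -> conf -> R,
    balanced L cl (m a.1.1) a.2 ->
    [/\ forall l l', 0 <= pi l l', forall l, \sum_l' pi l l' = a.2 l,
      balanced L cl (m (rcons a.1.1 a.1.2)) (fun l' => \sum_l pi l l') &
      \sum_l \sum_l' pi l l' * (\sum_(j < k) tdist L cl (l j) (l' j)) <=
      9 * tnorm L cl (fun x => m a.1.1 x - m (rcons a.1.1 a.1.2) x)].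
  case: a => [[s r] mu] /=.
  have [bal|nb] := pselect (balanced L cl (m s) mu); last by exists (fun _ _ => 0).
  by have [pi piP] := round_step r0 clH (m0 s) (m0 (rcons s r)) (mk (rcons s r)) bal; exists pi.
have [ro roP] := choice exr.
pose mrec := fix mrec (q : seq P) : conf -> R :=
  if q is r :: q' then (fun l' => \sum_l ro (rev q', r, mrec q') l l') else dirac_law.
pose mu s := mrec (rev s).
have muS s r : mu (rcons s r) = fun l' => \sum_l ro (s, r, mu s) l l'.
  by rewrite /mu rev_rcons /= revK.
have mub s : balanced L cl (m s) (mu s).
  elim/last_ind: s => [|s r IH].
    rewrite (_ : m [::] = fun a => (load l0 a)%:R); first exact: balanced_dirac.
    by apply/funext => a; rewrite /m /xs /= mass_anti.
  by rewrite muS; have [_ _ h _] := roP (s, r, mu s) IH.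
pose pi s r := ro (s, r, mu s).
pose stepc s r := \sum_l \sum_l' pi s r l l' * (\sum_(j < k) tdist L cl (l j) (l' j)).
have stepP s r l : occupies r l ->
    stepc s r <= 27 * (psi (xs s) (anti l) - psi (xs (rcons s r)) (anti l)).
  move=> rl; have [_ _ _ h] := roP (s, r, mu s) (mub s); apply: (le_trans h) => /=.
  have [b1 b2] := xsB s; have [_ c2] := xsB (rcons s r).
  have h1 := tnorm_mass b2 c2; have h2 := psi_step b1 b2 (xsP s r) rl.
  by rewrite -/(m s) -/(m (rcons s r)) in h1 *; lra.
(* Generalised over the served prefix [s] and the current offline configuration [l]. *)
have main x0 rho : forall s l S, all2 occupies rho S ->
    \sum_(t <- iota (size s) (size rho)) stepc (take t (s ++ rho)) (nth x0 (s ++ rho) t) <=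
    27 * (psi (xs s) (anti l) + psi_bound) +
    432 * (@depth P)%:R * log_range del * schedule_tcost l S.
  elim: rho => [|r rho IH] s l [|l' S] //=.
    move=> _; rewrite big_nil mulr0 addr0 mulr_ge0 //.
    have y0 p : 0 <= anti l p by have /andP[] := @count_point_box R P k (subtree_load l) p.
    by have [b1 _] := xsB s; have := psi_lower b1 y0; lra.
  move=> /andP[rl' /(IH (rcons s r) l')]; rewrite big_cons size_rcons cat_rcons => h.
  rewrite take_size_cat // nth_cat ltnn subnn /=.
  have h1 := stepP s r l' rl'; have [b1 _] := xsB s; have h2 := psi_move l l' b1.
  by rewrite mulrDr; lra.
exists mu, pi, (27 * (psi_bound + psi_bound)); split.
- by [].
- move=> s r l l'; have [p0 _ h _] := roP (s, r, mu s) (mub s); split; first exact: p0.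
  move=> nl'; apply/eqP; rewrite eq_le p0 andbT leNgt; apply/negP => pp.
  (* Positive probability of leaving [r] uncovered would make the integer part of its mass 0, yet
     that mass is at least 1. *)
  have [_ hb _] := h; have nu0 : 0 < \sum_l ro (s, r, mu s) l l'.
    by rewrite (bigD1 l) //= ltr_pwDl // sumr_ge0.
  have /andP[h1 _] := hb 0%N r l' isT nu0.
  move: nl'; rewrite occupies_load -leqNgt leqn0 => /eqP ll'.
  have cl0E : cload cl l' 0 r = 0%N.
    by apply/eqP; rewrite -(eqr_nat R) -cmass_load (cmass0 clH) ll'.
  move: h1; rewrite cl0E leqn0 => /eqP tr.
  have := truncn_itv (m0 (rcons s r) r); rewrite (cmass0 clH) in tr; rewrite tr => /andP[_].
  by rewrite ltNge; have := m_ge s r r; rewrite eqxx => ->.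
- by move=> s r l; have [_ h _ _] := roP (s, r, mu s) (mub s); exact: h.
- by move=> s r l'; rewrite muS.
- move=> x0 rho S rS; have := main x0 rho [::] l0 S rS; rewrite /= -/(stepc _ _) => h.
  apply: (le_trans h); have := psi_upper l0; rewrite /xs /=; lra.
Qed.

End TreeAlgorithm.

(** * Numerical bounds for the ratio *)

Section CompetitiveRatio.
Context {R : realType}.

Lemma ln_succ_ge (j : nat) : (0 < j)%N -> ln j%:R + j.+1%:R^-1 <= ln j.+1%:R :> R.
Proof.
move=> j0; have jp : 0 < j%:R :> R by rewrite ltr0n.
have sp : 0 < j.+1%:R :> R by rewrite ltr0n.
have := ln_le_subr1 (divr_gt0 jp sp); rewrite ln_div ?posrE //.
suff -> : j%:R / j.+1%:R - 1 = - j.+1%:R^-1 :> R by rewrite lerBlDl lerBrDr.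
by rewrite -natr1 in sp *; field; rewrite gt_eqF.
Qed.

(** ln 12 - ln 4 is at least 1/5 + ... + 1/12, which exceeds 1. This makes ln (ln n) positive from n
    = 3 on. *)
Lemma ln3_gt1 : 1 < ln 3 :> R.
Proof.
have -> : 3 = 12 / 4 :> R by field.
rewrite ln_div ?posrE ?ltr0n //.
have := @ln_succ_ge 4 isT; have := @ln_succ_ge 5 isT; have := @ln_succ_ge 6 isT.
have := @ln_succ_ge 7 isT; have := @ln_succ_ge 8 isT; have := @ln_succ_ge 9 isT.
have := @ln_succ_ge 10 isT; have := @ln_succ_ge 11 isT; lra.
Qed.

(** For [k >= 2] one has 2k + 2 <= k^3 and 1 + 2 * margin <= 2. *)
Lemma log_range_margin k : (2 <= k)%N -> log_range (margin k) <= 6 * ln k%:R + 1 :> R.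
Proof.
move=> k2; have k2R : 2 <= k%:R :> R by rewrite ler_nat.
have kp : 0 < k%:R :> R by lra.
rewrite /log_range lerD2r.
have -> : lgap (margin k) 0 1 = ln (2 * k%:R + 2) :> R.
  rewrite /lgap /margin natrD natrM; congr ln; field.
  by rewrite !gt_eqF //; lra.
have lk : ln (2 * k%:R + 2) <= 3 * ln k%:R :> R.
  have p1 : 0 < 2 * k%:R + 2 :> R by lra.
  rewrite [leRHS]mulr_natl -lnXn // ler_ln ?posrE ?exprn_gt0 //.
  by rewrite !exprS expr0 mulr1; nra.
have l0 : 0 <= ln (2 * k%:R + 2) :> R by apply: ln_ge0; lra.
have m1 : margin k <= 2^-1 :> R.
  by rewrite /margin lef_pV2 ?posrE ?ltr0n ?addn1 // ler_nat; lia.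
have := margin_gt0 k : 0 < margin k :> R.
by move=> m0; nra.
Qed.

Lemma trunc_log_le_ln n : (0 < n)%N -> (trunc_log 2 n)%:R * ln 2 <= ln n%:R :> R.
Proof.
move=> n0; rewrite mulr_natl -lnXn // ler_ln ?posrE ?exprn_gt0 ?ltr0n //.
by rewrite -natrX ler_nat; have /andP[] := trunc_log_bounds (isT : 1 < 2)%N n0.
Qed.

(** The 4 comes from domination by tree distances, the last factor from their expected stretch, the
    rest from [tree_algorithm]. *)
Definition ratio k n : R :=
  4 * 432 * (trunc_log 2 n)%:R * log_range (margin k) * (8 / ln 2 * (1 + ln n%:R)).

(** The surplus factors ln k, ln n and ln (ln n) are bounded below by ln 2, 1 and ln (ln 3);
    dividing by these makes them harmless. *)
Lemma ratio_bound : exists C : R, forall k n, (2 <= k)%N -> (3 <= n)%N ->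
  let c := C * (ln (k%:R : R) ^+ 2 * ln (n%:R : R) ^+ 3 * ln (ln (n%:R : R))) in
  0 < c /\ ratio k n <= c.
Proof.
have l2 : 0 < ln 2 :> R by apply: ln_gt0; rewrite ltr1n.
have l3 := ln3_gt1; have ll3 : 0 < ln (ln 3) :> R by exact: ln_gt0.
have : 0 < 4 * 432 :> R by rewrite mulr_gt0 ?ltr0n.
rewrite /ratio; move: (4 * 432 : R) => q q0.
pose C0 : R := q / ln 2 * (6 + 1 / ln 2) * (8 / ln 2 * 2).
have C00 : 0 < C0.
  have i2 : 0 < (ln 2 : R)^-1 by rewrite invr_gt0.
  by rewrite /C0 mul1r !mulr_gt0 // addr_gt0.
exists (C0 / (ln 2 * ln (ln 3))) => k n k2 n3 /=.
set a := ln k%:R; set N := ln n%:R; set e := ln N.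
have aP : ln 2 <= a by rewrite ler_ln ?posrE ?ltr0n ?ler_nat //; lia.
have NP : ln 3 <= N by rewrite ler_ln ?posrE ?ltr0n ?ler_nat //; lia.
have eP : ln (ln 3) <= e by rewrite ler_ln ?posrE //; lra.
have a0 : 0 < a by lra.
have N1 : 1 <= N by lra.
have N0 : 0 < N by lra.
have e0 : 0 < e by lra.
split.
  apply: mulr_gt0; first by apply: divr_gt0 => //; exact: mulr_gt0.
  by rewrite !mulr_gt0 ?exprn_gt0.
have h : q * (trunc_log 2 n)%:R * log_range (margin k) * (8 / ln 2 * (1 + N)) <= C0 * (a * N ^+ 2).
  have t1 : (trunc_log 2 n)%:R <= N / ln 2.
    by rewrite ler_pdivlMr //; apply: trunc_log_le_ln; exact: ltn_trans n3.
  have t2 : log_range (margin k) <= (6 + 1 / ln 2) * a.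
    apply: le_trans (log_range_margin k2) _; rewrite [leRHS]mulrDl lerD2l mul1r.
    by rewrite mulrC ler_pdivlMr // mul1r.
  have t3 : 8 / ln 2 * (1 + N) <= 8 / ln 2 * (2 * N).
    by apply: ler_wpM2l; [rewrite divr_ge0 // ltW|lra].
  have r0 : 0 <= log_range (margin k) :> R := log_range_ge0 (margin_gt0 k).
  have -> : C0 * (a * N ^+ 2) = q * (N / ln 2) * ((6 + 1 / ln 2) * a) * (8 / ln 2 * (2 * N)).
    by rewrite /C0; field; rewrite gt_eqF.
  apply: ler_pM => //.
  - by rewrite !mulr_ge0 ?(ltW q0).
  - by rewrite mulr_ge0 ?divr_ge0 ?(ltW l2) //; lra.
  by apply: ler_pM => //; [rewrite mulr_ge0 ?(ltW q0)|rewrite ler_wpM2l ?(ltW q0)].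
apply: (le_trans h).
have -> : C0 / (ln 2 * ln (ln 3)) * (a ^+ 2 * N ^+ 3 * e) =
    C0 * (a * N ^+ 2) * (a / ln 2 * N * (e / ln (ln 3))).
  by field; rewrite !gt_eqF.
have B0 : 0 <= C0 * (a * N ^+ 2).
  by apply: mulr_ge0; [exact: ltW|rewrite mulr_ge0 ?exprn_ge0 ?(ltW a0) ?(ltW N0)].
rewrite ler_peMr //.
have u1 : 1 <= a / ln 2 by rewrite ler_pdivlMr // mul1r.
have u2 : 1 <= e / ln (ln 3) by rewrite ler_pdivlMr // mul1r.
by apply: mulr_ege1 => //; apply: mulr_ege1.
Qed.

End CompetitiveRatio.

(** * Randomising over the hierarchies *)

Section Assembly.
Context {R : realType} {k n : nat} {M : metricType R}.
Variables (hM : M -> 'I_n) (gM : 'I_n -> M) (x0 : config k M).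
Hypotheses (hMK : cancel hM gM) (gMK : cancel gM hM).
Hypotheses (k_gt0 : (0 < k)%N) (n_gt0 : (0 < n)%N).
Implicit Types (rho : seq M) (S : seq (config k M)).
Local Notation conf := {ffun 'I_k -> 'I_n}.

Lemma schedule_cost_map (F : nat -> config k M) a m :
  schedule_cost (F a) [seq F t | t <- iota a.+1 m] =
  \sum_(t <- iota a m) move_cost (F t) (F t.+1).
Proof. by elim: m a => [|m IH] a /=; rewrite ?big_nil // big_cons IH. Qed.

Lemma schedule_cost_ge0 x S : 0 <= schedule_cost x S.
Proof.
elim: S x => [|y S IH] x //=; rewrite addr_ge0 // sumr_ge0 // => i _; exact: mdist_ge0.
Qed.

Definition encode x : conf := [ffun j => hM (x j)].
Definition decode (l : conf) : config k M := fun j => gM (l j).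

Lemma encodeK x : decode (encode x) = x.
Proof. by apply/funext => j; rewrite /decode ffunE hMK. Qed.

Lemma covers_decode r l : covers r (decode l) = occupies (hM r) l.
Proof. by apply: eq_existsb => j; rewrite /decode (can2_eq gMK hMK). Qed.

Lemma serves_encode rho S : serves rho S -> all2 (@occupies _ k) (map hM rho) (map encode S).
Proof.
elim: rho S => [|r rho IH] [|y S] //= /andP[ry /IH ->].
by rewrite -covers_decode encodeK ry.
Qed.

Lemma sum_schedule_tcost (T : finType) (L : nat) (cl : T -> nat -> 'I_n -> 'I_n) (u Z : R) x S :
  (forall a b, u * \sum_t tdist L (cl t) a b <= Z * mdist (gM a) (gM b)) ->
  u * \sum_t schedule_tcost L (cl t) (encode x) (map encode S) <= Z * schedule_cost x S.
Proof.
move=> h; elim: S x => [|y S IH] x /=; first by rewrite big1 // !mulr0.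
rewrite big_split /= !mulrDr; apply: lerD (IH y).
rewrite exchange_big /= mulr_sumr /move_cost mulr_sumr; apply: ler_sum => j _.
by have := h (encode x j) (encode y j); rewrite !ffunE !hMK.
Qed.

(** The hierarchy is drawn once, as a component of the state that all transitions preserve, so a
    single process carries both random choices. *)
Theorem kserver_finite : exists A : rand_policy k M, kserver_algorithm A /\
  exists b : R, forall rho S, serves rho S ->
  (expected_cost A x0 rho <= (ratio k n * schedule_cost x0 S + b)%:E)%E.
Proof.
pose d (a b : 'I_n) := mdist (gM a) (gM b).
have d_xx a : d a a = 0 by rewrite /d mdistxx.
have d_gt0 a b : a != b -> 0 < d a b by rewrite /d mdist_gt0 (can_eq gMK).
have d_sym a b : d a b = d b a by rewrite /d metric_sym.
have d_tri a b c : d a c <= d a b + d b c by exact: metric_triangle.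
have [T [L [cl [u [T0 u0 clH dom str]]]]] := random_hierarchy d_xx d_gt0 d_sym d_tri.
pose p0 : 'I_n := Ordinal n_gt0; pose l0 := encode x0.
have [mu muP] := choice (fun t => tree_algorithm (R := R) p0 (clH t) k_gt0 l0).
have [pi piP] := choice muP; have [be beP] := choice piP => {muP piP}.
pose Tn : R := #|T|%:R.
have Tn0 : 0 < Tn by rewrite ltr0n.
have TnN : Tn != 0 by rewrite gt_eqF.
pose mu' s (x : T * conf) := mu x.1 s x.2 / Tn.
pose pi' s r (x y : T * conf) : R := (x.1 == y.1)%:R / Tn * pi x.1 s r x.2 y.2.
have pi'_ge0 s r (x y : T * conf) : 0 <= pi' s r x y.
  rewrite /pi' !mulr_ge0 ?invr_ge0 ?(ltW Tn0) //.
  by have [_ h _ _ _] := beP x.1; have [] := h s r x.2 y.2.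
have pi'_fst s r (x : T * conf) : \sum_y pi' s r x y = mu' s x.
  rewrite -(pair_bigA _ (fun t l => pi' s r x (t, l))) /= (bigD1 x.1) //= [X in _ + X]big1 => [|t tx].
    rewrite addr0 /mu' mulrC; have [_ _ h _ _] := beP x.1; rewrite -(h s r) mulr_sumr.
    by apply: eq_bigr => l _; rewrite /pi' eqxx mul1r.
  by rewrite big1 // => l _; rewrite /pi' /= eq_sym (negbTE tx) !mul0r.
have pi'_snd s r (y : T * conf) : \sum_x pi' s r x y = mu' (rcons s r) y.
  rewrite -(pair_bigA _ (fun t l => pi' s r (t, l) y)) /= (bigD1 y.1) //= [X in _ + X]big1 => [|t tx].
    rewrite addr0 /mu' mulrC; have [_ _ _ h _] := beP y.1; rewrite -h mulr_sumr.
    by apply: eq_bigr => l _; rewrite /pi' eqxx mul1r.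
  by rewrite big1 // => l _; rewrite /pi' /= (negbTE tx) !mul0r.
have mu'0 (x : T * conf) : mu' [::] x = (x.2 == l0)%:R / Tn.
  by rewrite /mu'; have [-> _ _ _ _] := beP x.1.
have [||||f [mf f0 fg fJ]] := @realise_process R _ _ mu' pi' (fun x => x.2 == l0)
    (fun r x => occupies r x.2) _ _ pi'_ge0 pi'_fst pi'_snd.
- split=> [x|]; first by rewrite mu'0 divr_ge0 // ltW.
  rewrite -(pair_bigA _ (fun t l => mu' [::] (t, l))) /=.
  rewrite (eq_bigr (fun=> Tn^-1)) => [|t _]; first by rewrite sumr_const -mulr_natl divff.
  by rewrite (bigD1 l0) //= mu'0 eqxx mul1r big1 ?addr0 // => l /negbTE h; rewrite mu'0 /= h mul0r.
- by move=> x /negbTE h; rewrite mu'0 h mul0r.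
- move=> s r x y ny; rewrite /pi'; have [_ h _ _ _] := beP x.1.
  by have [_ ->] := h s r x.2 y.2; rewrite ?mulr0.
- move=> r; have [t _] : exists t : T, t \in T by apply/card_gt0P.
  by exists (t, [ffun=> r]); apply/existsP; exists (Ordinal k_gt0); rewrite ffunE.
pose pol (w : measurableTypeR R) s := decode (f (map hM s) w).2.
pose A := RandPolicy (@unit_prob R) pol.
exists A; split; first split.
- move=> rho x; rewrite (_ : [set w | _] = \bigcup_(y in [set y : T * conf | decode y.2 = x])
      [set w | f (map hM rho) w = y]); last first.
    by apply/seteqP; split => w /= [h]; [exists (f (map hM rho) w)|move=> <- <-].
  by apply: fin_bigcup_measurable => [|y _]; [exact: finite_finset|exact: mf].
- move=> w rho; rewrite /run /=.
  suff h rho' s : serves rho' [seq pol w (take t (s ++ rho')) | t <- iota (size s).+1 (size rho')].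
    exact: (h rho [::]).
  elim: rho' s => [|r rho' IH] s //=; apply/andP; split.
    rewrite -cat_rcons take_size_cat ?size_rcons // covers_decode map_rcons; exact: fg.
  by have := IH (rcons s r); rewrite size_rcons cat_rcons.
exists (\sum_t 4 * u / Tn * be t) => rho S rS.
pose rho' := map hM rho.
pose F t := f (take t rho'); pose G t := f (rcons (take t rho') (nth p0 rho' t)).
pose phi (x y : T * conf) := \sum_(j < k) d (x.2 j) (y.2 j).
have phi0 (x y : T * conf) : 0 <= phi x y by apply: sumr_ge0 => j _; exact: mdist_ge0.
have -> : expected_cost A x0 rho =
    ('E_(@unit_prob R)[fun w => (\sum_(t <- iota 0 (size rho)) phi (F t w) (G t w))%R])%E.
  rewrite /expected_cost; congr expectation; apply/funext => w.
  have -> : x0 = pol w (take 0 rho).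
    by rewrite take0 /pol (eqP (f0 w)) encodeK.
  rewrite /run (schedule_cost_map (fun t => pol w (take t rho)) 0) !big_seq.
  apply: eq_bigr => t; rewrite mem_iota add0n => /andP[_ tr].
  rewrite /move_cost /phi /F /G /pol /rho' !map_take (@take_nth _ p0 t (map hM rho)) ?size_map //.
have mF t : fibers (F t) := mf _.
have mG t : fibers (G t) := mf _.
have jFG t (x y : T * conf) : unit_prob ([set w | F t w = x] `&` [set w | G t w = y]) =
    (pi' (take t rho') (nth p0 rho' t) x y)%:E := fJ _ _ x y.
rewrite (expectation_transitions _ phi0 mF mG jFG) lee_fin.
pose tcost th t := \sum_l \sum_l' pi th (take t rho') (nth p0 rho' t) l l' *
   (\sum_(j < k) tdist L (cl th) (l j) (l' j)).
apply: (@le_trans _ _ (\sum_(t <- iota 0 (size rho)) \sum_th 4 * u / Tn * tcost th t)).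
  apply: ler_sum => t _.
  rewrite -(pair_bigA _ (fun th l => \sum_y phi (th, l) y * pi' (take t rho') (nth p0 rho' t) (th, l) y)) /=.
  apply: ler_sum => th _; rewrite /tcost mulr_sumr; apply: ler_sum => l _.
  rewrite -(pair_bigA _ (fun th' l' => phi (th, l) (th', l') *
    pi' (take t rho') (nth p0 rho' t) (th, l) (th', l'))) /=.
  rewrite (bigD1 th) //= [X in _ + X]big1 ?addr0 => [|th' hth]; last first.
    by rewrite big1 // => l' _; rewrite /pi' /= eq_sym (negbTE hth) !mul0r mulr0.
  rewrite mulr_sumr; apply: ler_sum => l' _; rewrite /pi' eqxx /=.
  have ph : phi (th, l) (th, l') <= 4 * u * \sum_(j < k) tdist L (cl th) (l j) (l' j).
    by rewrite mulr_sumr; apply: ler_sum => j _; exact: dom.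
  have q0 : 0 <= pi th (take t rho') (nth p0 rho' t) l l' / Tn.
    rewrite divr_ge0 ?(ltW Tn0) //.
    by have [_ h _ _ _] := beP th; have [] := h (take t rho') (nth p0 rho' t) l l'.
  have := ler_wpM2r q0 ph; lra.
pose K : R := 432 * (trunc_log 2 n)%:R * log_range (margin k).
have K0 : 0 <= K.
  apply: mulr_ge0 (log_range_ge0 (margin_gt0 k)); exact: mulr_ge0 (ler0n _ _) (ler0n _ _).
rewrite exchange_big /=.
apply: (@le_trans _ _ (\sum_th 4 * u / Tn *
    (K * schedule_tcost L (cl th) l0 (map encode S) + be th))).
  apply: ler_sum => th _; rewrite -mulr_sumr; apply: ler_wpM2l.
    by rewrite !mulr_ge0 ?invr_ge0 ?(ltW Tn0) ?(ltW u0).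
  have [_ _ _ _ h] := beP th.
  have := h p0 rho' (map encode S) (serves_encode rS).
  by rewrite size_map /depth card_ord.
rewrite (eq_bigr (fun th => 4 * K / Tn * (u * schedule_tcost L (cl th) l0 (map encode S)) +
   4 * u / Tn * be th)) => [|th _]; last by ring.
rewrite big_split /= lerD2r -mulr_sumr -mulr_sumr.
have c0 : 0 <= 4 * K / Tn by apply: divr_ge0 (mulr_ge0 (ler0n _ _) K0) (ltW Tn0).
(* The schedule [S] does not depend on the hierarchy, so the expected stretch applies to each of its
   moves. *)
have := @sum_schedule_tcost T L cl u _ x0 S str => /(ler_wpM2l c0) h; apply: (le_trans h).
rewrite card_ord /ratio -/Tn le_eqVlt; apply/orP; left; apply/eqP.
rewrite /K; field; rewrite TnN gt_eqF //; apply: ln_gt0; by rewrite ltr1n.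
Qed.

Theorem kserver_competitive (c : R) : 0 < c -> ratio k n <= c ->
  exists A : rand_policy k M, kserver_algorithm A /\ competitive A x0 c.
Proof.
move=> c0 rc; have [A [Ak [b bP]]] := kserver_finite; exists A; split=> //.
exists b => rho.
have ne : [set schedule_cost x0 S | S in [set S | serves rho S]] !=set0.
  exists (schedule_cost x0 [seq (fun=> r) | r <- rho]); exists [seq (fun=> r) | r <- rho] => //=.
  by elim: rho => //= r rho ->; rewrite andbT; apply/existsP; exists (Ordinal k_gt0).
have bc S : serves rho S -> (expected_cost A x0 rho <= (c * schedule_cost x0 S + b)%:E)%E.
  move=> /(bP rho) h; apply: (le_trans h); rewrite lee_fin lerD2r.
  by apply: ler_wpM2r => //; exact: schedule_cost_ge0.
move: bc; case: (expected_cost A x0 rho) => [e|h|_].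
- move=> bc; rewrite lee_fin -lerBlDr mulrC -ler_pdivrMr //.
  apply: lb_le_inf => // _ [S sS <-]; rewrite ler_pdivrMr // lerBlDr mulrC -lee_fin; exact: bc.
- by have [_ [S sS _]] := ne; have := h S sS.
- exact: leNye.
Qed.

End Assembly.

(** * Arbitrary finite metric spaces *)

Lemma card_bijection (R : realType) (M : metricType R) (n : nat) :
  ([set: M] #= `I_n)%card -> exists (h : M -> 'I_n) (g : 'I_n -> M), cancel h g /\ cancel g h.
Proof.
move=> /card_set_bijP[f [fun_f inj_f sur_f]].
have fn x : (f x < n)%N by apply: (fun_f x).
pose h x := Ordinal (fn x).
have ex (i : 'I_n) : exists x, f x = i by have [x _ <-] := sur_f i (ltn_ord i); exists x.
have [g gP] := choice ex; exists h, g.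
have gh : cancel g h by move=> i; apply/val_inj; rewrite /= gP.
split=> // x; apply: inj_f; rewrite ?inE //; exact: gP.
Qed.

Local Open Scope card_scope.

Theorem theorem1p1 (R : realType) :
  exists (C : R)
    (A : forall (k : nat) (M : metricType R), config k M -> rand_policy k M),
  forall (k n : nat) (M : metricType R) (x0 : config k M),
    (2 <= k)%N -> (3 <= n)%N -> [set: M] #= `I_n ->
    kserver_algorithm (A k M x0) /\
    competitive (A k M x0) x0
      (C * (ln (k%:R : R) ^+ 2 * ln (n%:R : R) ^+ 3 * ln (ln (n%:R : R)))).
Proof.
have [C CP] := @ratio_bound R.
pose good k (M : metricType R) (x0 : config k M) (B : rand_policy k M) := forall n,
  (2 <= k)%N -> (3 <= n)%N -> [set: M] #= `I_n -> kserver_algorithm B /\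
  competitive B x0 (C * (ln (k%:R : R) ^+ 2 * ln (n%:R : R) ^+ 3 * ln (ln (n%:R : R)))).
have ex k (M : metricType R) (x0 : config k M) : exists B, good k M x0 B.
  (* A default for parameters outside the range of the statement. *)
  pose D := RandPolicy (@unit_prob R) (fun _ _ => x0).
  have [[n [k2 n3 Mn]]|no] := pselect (exists n, [/\ (2 <= k)%N, (3 <= n)%N & [set: M] #= `I_n]);
    last by exists D => n k2 n3 Mn; case: no; exists n.
  have [h [g [hg gh]]] := card_bijection Mn.
  have [c0 rc] := CP k n k2 n3.
  have [||B BP] := @kserver_competitive R k n M h g x0 hg gh _ _ _ c0 rc; try by lia.
  (* The policy may not depend on [n], but the cardinality of [M] determines it. *)
  exists B => n' _ _ Mn'; suff <- : n = n' by [].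
  by apply/card_eq_II; rewrite (card_eql (card_esym Mn)).
pose A k (M : metricType R) (x0 : config k M) : rand_policy k M := projT1 (cid (ex k M x0)).
exists C, A => k n M x0; exact: (projT2 (cid (ex k M x0)) n).
Qed.
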